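(* Suppose that $\Gamma$ is a Lipschitz curve, $k^2\neq\gamma^2$ and the impedance coefficient satisfies $\lambda<0$. Then the variational problem $$\text{find } (u,v)\in X \text{ such that } B(u,v;\varphi,\psi)=F(\varphi,\psi)\quad\text{for all }(\varphi,\psi)\in X$$ has at most one solution $(u,v)\in X$.
   Context: Constants. $\omega,\epsilon,\mu>0$, $\lambda<0$ are real constants, $k=\omega\sqrt{\epsilon\mu}$, and $\theta,\phi\in(-\pi/2,\pi/2)$ are the incidence angles. The wave vector is $\mathbf k=(\alpha,-\beta,\gamma)=k(\sin\theta\cos\phi,-\cos\theta\cos\phi,\sin\phi)$, and $\kappa^2=k^2-\gamma^2$, $\kappa=k\cos\phi>0$. $\mathbf p\in\mathbb C^3$ satisfies $\mathbf p\cdot\mathbf k=0$, $\mathbf q=(\omega\mu)^{-1}\mathbf k\times\mathbf p$, and $p_3,q_3$ are the third components of $\mathbf p,\mathbf q$. Geometry. The grating profile is a curve in $\mathbb R^2$ that is $2\pi$-periodic in $x_1$; $\Gamma$ is its part in one periodic cell $0<x_1<2\pi$, and $\Omega$ is the part in this cell of the unbounded domain above the profile. Fix $b>\max_{x\in\Gamma}x_2$ and set $\Gamma_b=\{(x_1,b):0<x_1<2\pi\}$, $\Omega_b=\{x\in\Omega:x_2<b\}$. Spaces. A function $u$ is $\alpha$-quasiperiodic if $e^{-i\alpha x_1}u(x_1,x_2)$ is $2\pi$-periodic in $x_1$. $X=\{(u,v)\in H^1(\Omega_b)^2: u,v \text{ are }\alpha\text{-quasiperiodic}\}$. DtN map.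 For $n\in\mathbb Z$ let $\alpha_n=n+\alpha$, and $\beta_n=\sqrt{\kappa^2-\alpha_n^2}$ if $|\alpha_n|\le\kappa$, $\beta_n=i\sqrt{\alpha_n^2-\kappa^2}$ if $|\alpha_n|>\kappa$. Let $$M_n=\frac1{\kappa^2}\begin{pmatrix}-i\omega\epsilon\beta_n & i\gamma\alpha_n\\ -i\gamma\alpha_n & -i\omega\mu\beta_n\end{pmatrix}.$$ For $\alpha$-quasiperiodic $w=\sum_n\hat w_ne^{i\alpha_nx_1}\in H^{1/2}_\alpha(\Gamma_b)^2$ (with $\hat w_n\in\mathbb C^2$), $Tw=\sum_{n\in\mathbb Z}M_n\hat w_ne^{i\alpha_nx_1}\in H^{-1/2}_\alpha(\Gamma_b)^2$. Forms. With $\nabla=(\partial_1,\partial_2)$, $\nabla^\bot=(-\partial_2,\partial_1)$, and $a\cdot b$ the bilinear product, $$B(u,v;\varphi,\psi)=\int_\Gamma\Big(\frac i\lambda u\overline\varphi+i\lambda v\overline\psi\Big)ds+\int_{\Omega_b}\Big[\frac{\omega\epsilon}{\kappa^2}\nabla u\cdot\nabla\overline\varphi-\frac\gamma{\kappa^2}\nabla v\cdot\nabla^\bot\overline\varphi+\frac{\omega\mu}{\kappa^2}\nabla v\cdot\nabla\overline\psi+\frac\gamma{\kappa^2}\nabla u\cdot\nabla^\bot\overline\psi-\omega\epsilon u\overline\varphi-\omega\mu v\overline\psi\Big]dx+\int_{\Gamma_b}T\binom uv\cdot\binom{\overline\varphi}{\overline\psi}ds,$$ $$F(\varphi,\psi)=-\frac{2i\omega\beta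 e^{-i\beta b}}{\kappa^2}\int_{\Gamma_b}(\epsilon p_3\overline\varphi+\mu q_3\overline\psi)e^{i\alpha x_1}ds,$$ where the integral over $\Gamma_b$ involving $T$ is understood as the $H^{-1/2}$–$H^{1/2}$ duality pairing. *)

(* Defs.v *)
From HB Require Import structures.
From mathcomp Require Import all_boot all_order all_algebra.
From mathcomp Require Import all_classical all_reals all_analysis.
From mathcomp Require Import complex.

Set Implicit Arguments.
Unset Strict Implicit.
Unset Printing Implicit Defensive.

Import Order.TTheory GRing.Theory Num.Theory.
Import numFieldNormedType.Exports.

Local Open Scope classical_set_scope.
Local Open Scope ring_scope.
Local Open Scope complex_scope.

Definition cis (R : realType) (t : R) : R[i] := cos t +i* sin t.

Definition ci (R : realType) : R[i] := 0 +i* 1.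
Arguments ci R : clear implicits.

Definition sqnorm (R : realType) (z : R[i]) : R :=
  (complex.Re z) ^+ 2 + (complex.Im z) ^+ 2.

Definition plane_measure (R : realType) :
    {measure set (measurableTypeR R * measurableTypeR R) -> \bar R} :=
  (@lebesgue_measure R \x @lebesgue_measure R)%E.
Arguments plane_measure R : clear implicits.

Definition cint (R : realType) (d : measure_display) (T : measurableType d)
    (mu : {measure set T -> \bar R}) (D : set T) (f : T -> R[i]) : R[i] :=
  (\int[mu]_(x in D) complex.Re (f x)) +i* (\int[mu]_(x in D) complex.Im (f x)).

(* Squared L^2 norm, as an extended real. *)
Definition sqL2 (R : realType) (d : measure_display) (T : measurableType d)
    (mu : {measure set T -> \bar R}) (D : set T) (f : T -> R[i]) : \bar R :=
  (\int[mu]_(x in D) (sqnorm (f x))%:E)%E.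

Definition cmeasurable (R : realType) (d : measure_display)
    (T : measurableType d) (D : set T) (f : T -> R[i]) : Prop :=
  measurable_fun D (fun x => complex.Re (f x)) /\
  measurable_fun D (fun x => complex.Im (f x)).

Definition in_L2 (R : realType) (d : measure_display) (T : measurableType d)
    (mu : {measure set T -> \bar R}) (D : set T) (f : T -> R[i]) : Prop :=
  cmeasurable D f /\ (sqL2 mu D f < +oo)%E.

(* The sum over Z, as the limit of the symmetric partial sums. *)
Definition csumZ (R : realType) (a : int -> R[i]) : R[i] :=
  let S (N : nat) := \sum_(0 <= m < N.*2.+1) a (m%:Z - N%:Z) in
  (lim ((fun N => complex.Re (S N)) @ \oo))
  +i* (lim ((fun N => complex.Im (S N)) @ \oo)).

(* Partial derivatives: false stands for x_1, true for x_2. *)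
Definition basis2 (R : realType) (j : bool) : R * R :=
  if j then (0, 1) else (1, 0).

Definition pd (R : realType) (j : bool) (f : R * R -> R) : R * R -> R :=
  fun x => 'D_(basis2 R j) f x.

Definition cpd (R : realType) (j : bool) (f : R * R -> R[i]) : R * R -> R[i] :=
  fun x => pd j (fun y => complex.Re (f y)) x
           +i* pd j (fun y => complex.Im (f y)) x.

Definition smooth (R : realType) (f : R * R -> R) : Prop :=
  forall s : seq bool,
    continuous (foldr (@pd R) f s) /\
    forall j x, derivable (foldr (@pd R) f s) x (basis2 R j).

Definition csmooth (R : realType) (f : R * R -> R[i]) : Prop :=
  smooth (fun x => complex.Re (f x)) /\ smooth (fun x => complex.Im (f x)).

Definition test_function (R : realType) (O : set (R * R)) (f : R * R -> R) :=
  smooth f /\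
  exists K : set (R * R),
    [/\ compact K, K `<=` O & forall x, ~ K x -> f x = 0].

Definition weak_pd (R : realType) (O : set (R * R)) (j : bool)
    (u g : R * R -> R[i]) : Prop :=
  forall f, test_function O f ->
    cint (plane_measure R) O (fun x => (pd j f x)%:C * u x) =
    - cint (plane_measure R) O (fun x => (f x)%:C * g x).

Definition dot3 (R : realType) (a b : 'rV[R[i]]_3) : R[i] :=
  \sum_j a 0 j * b 0 j.

Definition cross3 (R : realType) (a b : 'rV[R[i]]_3) : 'rV[R[i]]_3 :=
  \row_(j < 3) (a 0 (j + 1) * b 0 (j + 2%:R) - a 0 (j + 2%:R) * b 0 (j + 1)).

Record grating (R : realType) := Grating {
  omega : R;
  eps : R;
  mu : R;
  lambda : R;
  inc_theta : R;
  inc_phi : R;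
  pvec : 'rV[R[i]]_3;
  profile : R -> R * R;
  height : R
}.

Definition wavenumber (R : realType) (G : grating R) : R :=
  omega G * Num.sqrt (eps G * mu G).

Definition alpha (R : realType) (G : grating R) : R :=
  wavenumber G * sin (inc_theta G) * cos (inc_phi G).

Definition beta (R : realType) (G : grating R) : R :=
  wavenumber G * cos (inc_theta G) * cos (inc_phi G).

Definition gamma (R : realType) (G : grating R) : R :=
  wavenumber G * sin (inc_phi G).

Definition kappa (R : realType) (G : grating R) : R :=
  wavenumber G * cos (inc_phi G).

Definition kvec (R : realType) (G : grating R) : 'rV[R[i]]_3 :=
  \row_(j < 3) ([:: alpha G; - beta G; gamma G]`_j)%:C.

Definition qvec (R : realType) (G : grating R) : 'rV[R[i]]_3 :=
  ((omega G * mu G)^-1)%:C *: cross3 (kvec G) (pvec G).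

Definition p3 (R : realType) (G : grating R) : R[i] := pvec G 0 (inord 2).
Definition q3 (R : realType) (G : grating R) : R[i] := qvec G 0 (inord 2).

(* The whole profile is a simple curve, parametrised by arc length over R and
   invariant under the translation by (2 pi, 0). *)
Definition periodic_profile (R : realType) (c : R -> R * R) : Prop :=
  [/\ injective c,
      exists M : R, M.-lipschitz c,
      {ae @lebesgue_measure R, forall t : R,
        [/\ derivable (fun s => (c s).1) t 1,
            derivable (fun s => (c s).2) t 1
          & (derive1 (fun s => (c s).1) t) ^+ 2
            + (derive1 (fun s => (c s).2) t) ^+ 2 = 1]}
    & exists2 L : R, 0 < L &
        forall t, c (t + L) = ((c t).1 + 2 * pi, (c t).2)].

(* The component of the complement of the profile that contains the
   points far up. *)
Definition above (R : realType) (c : R -> R * R) : set (R * R) :=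
  [set x | exists h : R, (forall t, (c t).2 < h) /\
                         connected_component (~` range c) (0, h) x].

Definition rotate (R : realType) (a : R) (p : R * R) (s t : R) : R * R :=
  (p.1 + s * cos a - t * sin a, p.2 + s * sin a + t * cos a).

(* Near each of its points the profile is, in suitable rotated coordinates, the
   graph of a Lipschitz function, with the domain exactly on one side of it. *)
Definition lipschitz_curve (R : realType) (c : R -> R * R) : Prop :=
  forall p, range c p ->
    exists (a r h : R) (M : R) (g : R -> R),
      [/\ 0 < r, 0 < h, M.-lipschitz g &
        forall s t, `|s| < r -> `|t| < h ->
          (range c (rotate a p s t) <-> t = g s) /\
          (above c (rotate a p s t) <-> g s < t)].

(* The 2 pi-periodic strip-like domain of which Omega_b is one cell. *)
Definition periodic_domain (R : realType) (G : grating R) : set (R * R) :=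
  above (profile G) `&` [set x | x.2 < height G].

Definition Omega_b (R : realType) (G : grating R) : set (R * R) :=
  periodic_domain G `&` [set x | 0 < x.1 < 2 * pi].

(* Parameters of the part Gamma of the profile in one cell; as the parameter is
   arc length, integrals ds over Gamma are integrals over this set. The cell is
   half-open so that a piece of the profile lying on the vertical line between
   two cells is counted exactly once. *)
Definition Gamma_param (R : realType) (G : grating R) : set R :=
  [set t | 0 <= (profile G t).1 < 2 * pi].

Definition cell (R : realType) : set R := [set t | 0 < t < 2 * pi].

Definition int_Omega_b (R : realType) (G : grating R) (f : R * R -> R[i]) :=
  cint (plane_measure R) (Omega_b G) f.

Definition int_Gamma (R : realType) (G : grating R) (f : R * R -> R[i]) :=
  cint (@lebesgue_measure R) (Gamma_param G) (fun t => f (profile G t)).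

Definition int_Gamma_b (R : realType) (G : grating R) (f : R * R -> R[i]) :=
  cint (@lebesgue_measure R) (@cell R) (fun t => f (t, height G)).

Definition quasiperiodic (R : realType) (a : R) (D : set (R * R))
    (f : R * R -> R[i]) : Prop :=
  forall x, D x ->
    cis (- (a * (x.1 + 2 * pi))) * f (x.1 + 2 * pi, x.2) =
    cis (- (a * x.1)) * f x.

(* A function on the periodic domain, with its weak partial derivatives
   and its boundary values on Gamma and Gamma_b. *)
Record h1fun (R : realType) := H1Fun {
  fval : R * R -> R[i];
  fpd : bool -> R * R -> R[i];
  trace : R * R -> R[i]
}.

(* The trace operator is the continuous extension of the restriction
   w |-> w|_Gamma, w|_Gamma_b of smooth functions, from H^1(Omega_b) to L^2. *)
Definition is_trace (R : realType) (G : grating R) (U : h1fun R) : Prop :=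
  exists w : nat -> R * R -> R[i],
    (forall m, csmooth (w m) /\ quasiperiodic (alpha G) setT (w m)) /\
    [/\ sqL2 (plane_measure R) (Omega_b G) (fun x => w m x - fval U x)
          @[m --> \oo] --> 0%E,
        forall j, sqL2 (plane_measure R) (Omega_b G)
                    (fun x => cpd j (w m) x - fpd U j x)
          @[m --> \oo] --> 0%E,
        sqL2 (@lebesgue_measure R) (Gamma_param G)
          (fun t => w m (profile G t) - trace U (profile G t))
          @[m --> \oo] --> 0%E
      & sqL2 (@lebesgue_measure R) (@cell R)
          (fun t => w m (t, height G) - trace U (t, height G))
          @[m --> \oo] --> 0%E].

Definition L2_alpha (R : realType) (G : grating R) (f : R * R -> R[i]) : Prop :=
  [/\ quasiperiodic (alpha G) (periodic_domain G) f,
      cmeasurable (periodic_domain G) f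
    & (sqL2 (plane_measure R) (Omega_b G) f < +oo)%E].

(* The alpha-quasiperiodic functions of H^1(Omega_b). Taking weak derivatives
   on the periodic domain excludes jumps across the lines between cells. For
   given values, the derivatives and the boundary values are unique up to null
   sets; existence of the boundary values is the trace theorem. *)
Definition H1_alpha (R : realType) (G : grating R) (U : h1fun R) : Prop :=
  [/\ L2_alpha G (fval U),
      forall j, L2_alpha G (fpd U j) /\
                weak_pd (periodic_domain G) j (fval U) (fpd U j),
      in_L2 (@lebesgue_measure R) (Gamma_param G)
        (fun t => trace U (profile G t)),
      in_L2 (@lebesgue_measure R) (@cell R) (fun t => trace U (t, height G))
    & is_trace G U].

Definition in_X (R : realType) (G : grating R) (W : h1fun R * h1fun R) : Prop :=
  H1_alpha G W.1 /\ H1_alpha G W.2.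

Definition alpha_n (R : realType) (G : grating R) (n : int) : R :=
  n%:~R + alpha G.

Definition beta_n (R : realType) (G : grating R) (n : int) : R[i] :=
  if `|alpha_n G n| <= kappa G
  then (Num.sqrt (kappa G ^+ 2 - alpha_n G n ^+ 2))%:C
  else ci R * (Num.sqrt (alpha_n G n ^+ 2 - kappa G ^+ 2))%:C.

Definition M_n (R : realType) (G : grating R) (n : int) : 'M[R[i]]_(1 + 1) :=
  ((kappa G ^+ 2)^-1)%:C *:
  block_mx (- ci R * (omega G * eps G)%:C * beta_n G n)%:M
           (ci R * (gamma G * alpha_n G n)%:C)%:M
           (- ci R * (gamma G * alpha_n G n)%:C)%:M
           (- ci R * (omega G * mu G)%:C * beta_n G n)%:M.

(* Elements of H^s_alpha(Gamma_b)^2 are represented by their Fourier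
   coefficients with respect to exp(i alpha_n x_1). *)
Definition fourier (R : realType) (G : grating R) (f : R * R -> R[i])
    (n : int) : R[i] :=
  ((2 * pi)^-1)%:C *
  int_Gamma_b G (fun x => f x * cis (- (alpha_n G n * x.1))).

Definition fourier2 (R : realType) (G : grating R) (f g : R * R -> R[i])
    (n : int) : 'cV[R[i]]_(1 + 1) :=
  col_mx (fourier G f n)%:M (fourier G g n)%:M.

Definition DtN (R : realType) (G : grating R)
    (w : int -> 'cV[R[i]]_(1 + 1)) : int -> 'cV[R[i]]_(1 + 1) :=
  fun n => M_n G n *m w n.

(* The extension to H^{-1/2} x H^{1/2} of int_Gamma_b w . conj z ds. *)
Definition duality (R : realType) (w z : int -> 'cV[R[i]]_(1 + 1)) : R[i] :=
  (2 * pi)%:C * csumZ (fun n => \sum_j w n j 0 * conjc (z n j 0)).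

Definition dot2 (R : realType) (a b : R[i] * R[i]) : R[i] :=
  a.1 * b.1 + a.2 * b.2.

Definition grad (R : realType) (U : h1fun R) (x : R * R) : R[i] * R[i] :=
  (fpd U false x, fpd U true x).

Definition grad_conj (R : realType) (U : h1fun R) (x : R * R) : R[i] * R[i] :=
  (conjc (fpd U false x), conjc (fpd U true x)).

Definition gradperp_conj (R : realType) (U : h1fun R) (x : R * R) :
    R[i] * R[i] :=
  (- conjc (fpd U true x), conjc (fpd U false x)).

Definition Bform (R : realType) (G : grating R) (W Z : h1fun R * h1fun R) : R[i] :=
  let: (u, v) := W in
  let: (f, g) := Z in
  int_Gamma G (fun x =>
    ci R * ((lambda G)^-1)%:C * trace u x * conjc (trace f x)
    + ci R * (lambda G)%:C * trace v x * conjc (trace g x))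
  + int_Omega_b G (fun x =>
      (omega G * eps G / kappa G ^+ 2)%:C * dot2 (grad u x) (grad_conj f x)
      - (gamma G / kappa G ^+ 2)%:C * dot2 (grad v x) (gradperp_conj f x)
      + (omega G * mu G / kappa G ^+ 2)%:C * dot2 (grad v x) (grad_conj g x)
      + (gamma G / kappa G ^+ 2)%:C * dot2 (grad u x) (gradperp_conj g x)
      - (omega G * eps G)%:C * fval u x * conjc (fval f x)
      - (omega G * mu G)%:C * fval v x * conjc (fval g x))
  + duality (DtN G (fourier2 G (trace u) (trace v)))
            (fourier2 G (trace f) (trace g)).

Definition Fform (R : realType) (G : grating R) (Z : h1fun R * h1fun R) : R[i] :=
  let: (f, g) := Z in
  - ((2 * omega G * beta G / kappa G ^+ 2)%:C * ci R
     * cis (- (beta G * height G)))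
  * int_Gamma_b G (fun x =>
      ((eps G)%:C * p3 G * conjc (trace f x) + (mu G)%:C * q3 G * conjc (trace g x))
      * cis (alpha G * x.1)).

Definition solution (R : realType) (G : grating R) (W : h1fun R * h1fun R) :=
  in_X G W /\ forall Z, in_X G Z -> Bform G W Z = Fform G Z.

(* Main.v *)
(* Testing the equations of two solutions with the solutions
   themselves and taking imaginary parts cancels all volume terms.  For all but
   finitely many n the matrix M_n is Hermitian, and the imaginary part of the
   remaining finite quadratic form is nonpositive; as lambda < 0, the traces of
   the two solutions agree on Gamma.  The difference thus has zero Cauchy data
   on Gamma, and testing with exp(i alpha_n x_1) (b - x_2)^k, k >= 2, which
   vanishes on Gamma_b, turns the equation into a two-step recursion
   k (k - 1) m_(k-2) = (alpha_n^2 - kappa^2) m_k for the moments of the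
   difference.  Since |m_k| grows at most geometrically, all moments vanish, and
   the difference is zero by completeness of these functions.  No unique
   continuation is needed, and the only geometric inputs are that the domain is
   open, bounded from below and has a boundary of finite length per period. *)
Require Import Defs.
From HB Require Import structures.
From mathcomp Require Import all_boot all_order all_algebra.
From mathcomp Require Import all_classical all_reals all_analysis.
From mathcomp Require Import measurable_realfun complex.
From mathcomp Require Import zify ring lra.

Set Implicit Arguments.
Unset Strict Implicit.
Unset Printing Implicit Defensive.

Import Order.TTheory GRing.Theory Num.Theory.
Import numFieldNormedType.Exports.

Local Open Scope classical_set_scope.
Local Open Scope ring_scope.
Local Open Scope complex_scope.

(** * Complex-valued integrals *)

(** An element of [H1_alpha] is a record of values, weak derivatives and boundary values, so the
    difference of two solutions is never formed: the energy argument uses an alternating sum of four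
    values of [Bform], and later statements carry both functions. In place of the divergence theorem
    stands a one-sided bound: the integral of a partial derivative of G over the cell is at most C
    times the integral of |G| over Gamma. It comes from translating the domain by h, since the
    symmetric difference lies in a tube of radius h. The bound suffices because the traces agree on
    Gamma, so its right-hand side tends to 0 along smooth approximations. The lower bound of the
    domain is a Jordan-type statement: the component of the complement containing the points far up
    must not leak below the profile. The recursion is scalar although the system is coupled: after
    integration by parts both gamma terms are the same multiple of one moment of the other
    component, with opposite signs. For completeness, real and imaginary parts of the modes span an
    algebra, and indicators of half-planes are bounded limits of its elements. *)

Section complex_integral.
Context (R : realType) (d : measure_display) (T : measurableType d).
Variables (mu : {measure set T -> \bar R}) (D : set T).
Hypothesis mD : measurable D.
Implicit Types (f g : T -> R[i]) (c : R[i]).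

Definition cintegrable f : Prop :=
  mu.-integrable D (EFin \o (fun x => complex.Re (f x))) /\
  mu.-integrable D (EFin \o (fun x => complex.Im (f x))).

Lemma cmeasurableD f g : cmeasurable D f -> cmeasurable D g ->
  cmeasurable D (fun x => f x + g x).
Proof.
by move=> [f1 f2] [g1 g2]; split=> /=; [
  apply: (eq_measurable_fun (fun x => complex.Re (f x) + complex.Re (g x)))
| apply: (eq_measurable_fun (fun x => complex.Im (f x) + complex.Im (g x)))];
  [by move=> x _; case: (f x) (g x) => [a b] [e h]| exact: measurable_funD
  |by move=> x _; case: (f x) (g x) => [a b] [e h]| exact: measurable_funD].
Qed.

Lemma cmeasurableM f g : cmeasurable D f -> cmeasurable D g ->
  cmeasurable D (fun x => f x * g x).
Proof.
move=> [f1 f2] [g1 g2]; split=> /=.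
- apply: (eq_measurable_fun (fun x => complex.Re (f x) * complex.Re (g x) -
    complex.Im (f x) * complex.Im (g x))).
    by move=> x _; case: (f x) (g x) => [a b] [e h].
  by apply: measurable_funB; exact: measurable_funM.
- apply: (eq_measurable_fun (fun x => complex.Re (f x) * complex.Im (g x) +
    complex.Im (f x) * complex.Re (g x))).
    by move=> x _; case: (f x) (g x) => [a b] [e h].
  by apply: measurable_funD; exact: measurable_funM.
Qed.

Lemma cmeasurableJ f : cmeasurable D f -> cmeasurable D (fun x => conjc (f x)).
Proof.
move=> [f1 f2]; split; first by
  apply: (eq_measurable_fun (fun x => complex.Re (f x))) => // x _; case: (f x).
apply: (eq_measurable_fun (fun x => - complex.Im (f x))).
  by move=> x _; case: (f x).
exact: measurableT_comp.
Qed.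

Lemma cmeasurableN f : cmeasurable D f -> cmeasurable D (fun x => - f x).
Proof.
move=> [f1 f2]; split.
  apply: (eq_measurable_fun (fun x => - complex.Re (f x))).
    by move=> x _; case: (f x).
  exact: measurableT_comp.
apply: (eq_measurable_fun (fun x => - complex.Im (f x))).
  by move=> x _; case: (f x).
exact: measurableT_comp.
Qed.

Lemma cintegrableD f g : cintegrable f -> cintegrable g ->
  cintegrable (fun x => f x + g x).
Proof.
move=> [f1 f2] [g1 g2]; split.
  apply: eq_integrable (integrableD mD f1 g1) => // x _.
  by rewrite /= -EFinD; case: (f x) (g x) => [a b] [e h].
apply: eq_integrable (integrableD mD f2 g2) => // x _.
by rewrite /= -EFinD; case: (f x) (g x) => [a b] [e h].
Qed.

Lemma cintD f g : cintegrable f -> cintegrable g ->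
  cint mu D (fun x => f x + g x) = cint mu D f + cint mu D g.
Proof.
move=> [f1 f2] [g1 g2]; rewrite /cint; apply/eqP; rewrite eq_complex /=.
rewrite -!RintegralD//; apply/andP; split; apply/eqP/eq_Rintegral => x _;
  by case: (f x) (g x) => [a b] [e h].
Qed.

Lemma cintegrableZ c f : cintegrable f -> cintegrable (fun x => c * f x).
Proof.
move=> [f1 f2]; case: c => a b; split.
  apply: eq_integrable (integrableB mD (integrableZl mD a f1) (integrableZl mD b f2)) => // x _.
  by rewrite /= -!EFinM -EFinB; case: (f x).
apply: eq_integrable (integrableD mD (integrableZl mD a f2) (integrableZl mD b f1)) => // x _.
by rewrite /= -!EFinM -EFinD; case: (f x).
Qed.

Lemma cintZ c f : cintegrable f ->
  cint mu D (fun x => c * f x) = c * cint mu D f.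
Proof.
move=> [f1 f2]; rewrite /cint; apply/eqP; case: c => a b; rewrite eq_complex /=.
have i1 r := integrableZl mD r f1.
have i2 r := integrableZl mD r f2.
rewrite -!RintegralZl//; apply/andP; split; apply/eqP.
  rewrite -RintegralB //; last 2 first.
  - by apply: eq_integrable (i1 a).
  - by apply: eq_integrable (i2 b).
  by apply: eq_Rintegral => x _; case: (f x).
rewrite -RintegralD //; last 2 first.
- by apply: eq_integrable (i2 a).
- by apply: eq_integrable (i1 b).
by apply: eq_Rintegral => x _; case: (f x).
Qed.

Lemma cintegrableN f : cintegrable f -> cintegrable (fun x => - f x).
Proof. by move/(cintegrableZ (-1)); under [X in cintegrable X]eq_fun do rewrite mulN1r. Qed.

Lemma cintN f : cintegrable f -> cint mu D (fun x => - f x) = - cint mu D f.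
Proof.
move=> h; rewrite -mulN1r -cintZ//; congr cint.
by apply/funext => x; rewrite mulN1r.
Qed.

Lemma cintegrableB f g : cintegrable f -> cintegrable g ->
  cintegrable (fun x => f x - g x).
Proof. by move=> hf /cintegrableN; exact: cintegrableD. Qed.

Lemma cintB f g : cintegrable f -> cintegrable g ->
  cint mu D (fun x => f x - g x) = cint mu D f - cint mu D g.
Proof. by move=> hf hg; rewrite cintD ?cintN//; exact: cintegrableN. Qed.

Lemma eq_cint f g : {in D, f =1 g} -> cint mu D f = cint mu D g.
Proof.
by move=> fg; rewrite /cint; congr (_ +i* _); apply: eq_Rintegral => x xD; rewrite fg.
Qed.

Lemma sqnorm_ge0 (z : R[i]) : 0 <= sqnorm z.
Proof. by rewrite addr_ge0// sqr_ge0. Qed.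

Lemma measurable_sqnorm f : cmeasurable D f -> measurable_fun D (fun x => sqnorm (f x)).
Proof. by move=> [f1 f2]; apply: measurable_funD; exact: measurable_funX. Qed.

Lemma in_L2_sqnorm f : in_L2 mu D f ->
  mu.-integrable D (EFin \o (fun x => sqnorm (f x))).
Proof.
move=> [mf fo]; apply/integrableP; split.
  exact/measurable_EFinP/measurable_sqnorm.
rewrite (le_lt_trans _ fo)// /sqL2 le_eqVlt; apply/orP; left; apply/eqP.
by apply: eq_integral => x _ /=; rewrite ger0_norm// sqnorm_ge0.
Qed.

(** Young's inequality: both parts of the product are dominated by [sqnorm (f x) + sqnorm (g x)].
    The squares listed in the proof are those that [nra] has to combine. *)
Lemma in_L2M f g : in_L2 mu D f -> in_L2 mu D g -> cintegrable (fun x => f x * g x).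
Proof.
move=> hf hg.
have hs := integrableD mD (in_L2_sqnorm hf) (in_L2_sqnorm hg).
have [m1 m2] := cmeasurableM hf.1 hg.1.
split; apply: le_integrable hs => //.
- exact/measurable_EFinP.
- move=> x _ /=; rewrite lee_fin.
  have h : 0 <= sqnorm (f x) + sqnorm (g x) by rewrite addr_ge0 ?sqnorm_ge0.
  rewrite (ger0_norm h) /sqnorm ler_norml; case: (f x) (g x) => [a b] [a' b'] /=.
  have := (sqr_ge0 (a - a'), sqr_ge0 (a + a'), sqr_ge0 (b - b'), sqr_ge0 (b + b'),
    sqr_ge0 (a - b'), sqr_ge0 (a + b'), sqr_ge0 (b - a'), sqr_ge0 (b + a')).
  by move=> [[[[[[[? ?] ?] ?] ?] ?] ?] ?]; apply/andP; split; nra.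
- exact/measurable_EFinP.
- move=> x _ /=; rewrite lee_fin.
  have h : 0 <= sqnorm (f x) + sqnorm (g x) by rewrite addr_ge0 ?sqnorm_ge0.
  rewrite (ger0_norm h) /sqnorm ler_norml; case: (f x) (g x) => [a b] [a' b'] /=.
  have := (sqr_ge0 (a - a'), sqr_ge0 (a + a'), sqr_ge0 (b - b'), sqr_ge0 (b + b'),
    sqr_ge0 (a - b'), sqr_ge0 (a + b'), sqr_ge0 (b - a'), sqr_ge0 (b + a')).
  by move=> [[[[[[[? ?] ?] ?] ?] ?] ?] ?]; apply/andP; split; nra.
Qed.

Lemma in_L2J f : in_L2 mu D f -> in_L2 mu D (fun x => conjc (f x)).
Proof.
move=> [mf fo]; split; first exact: cmeasurableJ.
rewrite (le_lt_trans _ fo)// /sqL2 le_eqVlt; apply/orP; left; apply/eqP.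
by apply: eq_integral => x _ /=; rewrite /sqnorm; case: (f x) => a b /=; rewrite sqrrN.
Qed.

Lemma in_L2MJ f g : in_L2 mu D f -> in_L2 mu D g ->
  cintegrable (fun x => f x * conjc (g x)).
Proof. by move=> hf /in_L2J; exact: in_L2M. Qed.

Lemma in_L2B f g : in_L2 mu D f -> in_L2 mu D g -> in_L2 mu D (fun x => f x - g x).
Proof.
move=> hf hg.
have mB := cmeasurableD hf.1 (cmeasurableN hg.1).
split => //.
have i1 := integrableD mD (in_L2_sqnorm hf) (in_L2_sqnorm hg).
have /integrableP[_] := integrableZl mD 2 i1.
apply: le_lt_trans; apply: ge0_le_integral => //.
- by move=> x _; rewrite lee_fin sqnorm_ge0.
- exact/measurable_EFinP/measurable_sqnorm.
- exact: (measurable_int mu (integrable_abse (integrableZl mD 2 i1))).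
- move=> x _ /=; rewrite lee_fin.
  rewrite ger0_norm; last by rewrite mulr_ge0// addr_ge0// sqnorm_ge0.
  rewrite /sqnorm; case: (f x) (g x) => [a b] [a' b'] /=.
  have := (sqr_ge0 (a + a'), sqr_ge0 (b + b')); move=> [? ?]; nra.
Qed.

Lemma in_L2_bounded f (K : R) : (mu D < +oo)%E -> cmeasurable D f ->
  (forall x, D x -> sqnorm (f x) <= K) -> in_L2 mu D f.
Proof.
move=> fD mf fK; split => //.
apply: (@le_lt_trans _ _ (\int[mu]_(x in D) (K%:E))%E).
  apply: ge0_le_integral => //.
  - by move=> x _; rewrite lee_fin sqnorm_ge0.
  - exact/measurable_EFinP/measurable_sqnorm.
rewrite integral_cst//.
have [K0|K0] := leP 0 K; first by rewrite lte_mul_pinfty.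
(* A negative [K] bounds nothing from above unless [D] is empty. *)
have D0 : D = set0.
  rewrite -subset0 => x /fK h.
  by have := le_lt_trans h K0; rewrite ltNge sqnorm_ge0.
by rewrite D0 measure0 mule0.
Qed.

End complex_integral.

(** * The domain above a periodic Lipschitz curve *)

Section plane_topology.
Context (R : realType).
Implicit Types (x y : R * R) (A B : set (R * R)).

Definition seg x y (s : R) : R * R :=
  (x.1 + s * (y.1 - x.1), x.2 + s * (y.2 - x.2)).

Lemma seg0 x y : seg x y 0 = x.
Proof. by rewrite /seg !mul0r !addr0; case: x. Qed.

Lemma seg1 x y : seg x y 1 = y.
Proof. by rewrite /seg !mul1r ![_ + (_ - _)]addrC !subrK; case: y. Qed.

Lemma continuous_pair2 (S : topologicalType) (f g : S -> R) :
  continuous f -> continuous g -> continuous (fun s => (f s, g s)).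
Proof. by move=> cf cg s; exact: (cvg_pair (cf s) (cg s)). Qed.

Lemma continuous_seg x y : continuous (seg x y).
Proof.
apply: continuous_pair2 => s; apply: cvgD; try exact: cvg_cst;
  apply: cvgM; [exact: cvg_id|exact: cvg_cst|exact: cvg_id|exact: cvg_cst].
Qed.

Lemma connected_image A (f : R * R -> R * R) :
  continuous f -> connected A -> connected (f @` A).
Proof.
move=> cf cA; apply: connected_continuous_connected => //.
exact: continuous_subspaceT.
Qed.

Lemma connected_seg x y : connected (seg x y @` `[0, 1]).
Proof.
apply: connected_continuous_connected; first exact: segment_connected.
apply: continuous_subspaceT; exact: continuous_seg.
Qed.

Lemma component_seg A x y :
  (forall s, 0 <= s <= 1 -> A (seg x y s)) -> connected_component A x y.
Proof.
move=> h; exists (seg x y @` `[0, 1]); last first.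
  by exists 1; rewrite ?seg1//= in_itv /= ler01 lexx.
split; first by exists 0; rewrite ?seg0//= in_itv /= ler01 lexx.
  by move=> _ [s /= s01 <-]; apply: h; move: s01; rewrite in_itv.
exact: connected_seg.
Qed.

Lemma ball2E x (r : R) y :
  ball x r y <-> `|x.1 - y.1| < r /\ `|x.2 - y.2| < r.
Proof. by rewrite /ball /= /prod_ball /ball /=. Qed.

Lemma nbhs2P x A : nbhs x A <-> exists2 r : R, 0 < r &
  forall y, `|x.1 - y.1| < r -> `|x.2 - y.2| < r -> A y.
Proof.
split.
  move=> /nbhs_ballP[r r0 h]; exists r => // y h1 h2.
  by apply: h; exact/ball2E.
move=> [r r0 h]; apply/nbhs_ballP; exists r => // y /ball2E[h1 h2].
exact: h.
Qed.

Lemma seg_ball x y s : 0 <= s <= 1 ->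
  `|x.1 - (seg x y s).1| <= `|x.1 - y.1| /\ `|x.2 - (seg x y s).2| <= `|x.2 - y.2|.
Proof.
move=> /andP[s0 s1]; have sn : `|s| <= 1 by rewrite ger0_norm.
split; rewrite /= opprD addNKr normrN normrM distrC -[leRHS]mul1r.
- by rewrite ler_wpM2r.
- by rewrite ler_wpM2r.
Qed.

End plane_topology.

Definition lipschitz_coords (R : realType) (c : R -> R * R) (M : R) : Prop :=
  forall s t, `|(c s).1 - (c t).1| <= M * `|s - t| /\ `|(c s).2 - (c t).2| <= M * `|s - t|.

Definition shift_periodic (R : realType) (c : R -> R * R) (L : R) : Prop :=
  forall t, c (t + L) = ((c t).1 + 2 * pi, (c t).2).

Section profile.
Context (R : realType) (c : R -> R * R) (M L : R).
Hypothesis M0 : 0 < M.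
Hypothesis cM : lipschitz_coords c M.
Hypothesis L0 : 0 < L.
Hypothesis cL : shift_periodic c L.

Lemma profile_continuous : continuous c.
Proof.
move=> t; apply/cvgrPdist_lt => e e0; near=> s.
rewrite [`|_|]/Num.norm /= gt_max /=.
have h : M * `|t - s| < e.
  rewrite mulrC -ltr_pdivlMr//; near: s; apply: (@cvgr_dist_lt _ R^o) => //.
  by rewrite divr_gt0.
have [h1 h2] := cM t s.
by rewrite (le_lt_trans h1 h)// (le_lt_trans h2 h).
Unshelve. all: by end_near. Qed.

Lemma profile_shift (k : int) t :
  c (t + k%:~R * L) = ((c t).1 + 2 * pi * k%:~R, (c t).2).
Proof.
have hn : forall (n : nat) t, c (t + n%:R * L) = ((c t).1 + 2 * pi * n%:R, (c t).2).
  elim=> [|n ih] u; first by rewrite mul0r !addr0 mulr0 addr0; case: (c u).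
  rewrite -natr1 mulrDl mul1r addrA cL ih /=; congr pair.
  by ring.
case: k => n; first exact: hn.
rewrite NegzE mulrNz mulNr mulrN.
have := hn n.+1 (t - n.+1%:R * L); rewrite subrK => ->/=.
by rewrite addrK; case: (c _).
Qed.

Lemma profile_reduce t : exists (k : int) s, 0 <= s <= L /\ t = s + k%:~R * L.
Proof.
exists (Num.floor (t / L)), (t - (Num.floor (t / L))%:~R * L); split; last by rewrite subrK.
have /andP[h1 h2] := floor_itv (t / L); apply/andP; split.
  by rewrite subr_ge0 -ler_pdivlMr.
by rewrite lerBlDl -[X in _ + X]mul1r -mulrDl -ler_pdivrMr// ltW// -intrD1.
Qed.

(** Over one period the curve stays within [M * L] of [c 0] in each coordinate, and all other
    periods are horizontal translates of this one. *)
Lemma profile_bounded : exists2 B : R, 0 < B & forall t (k : int) s,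
  0 <= s <= L -> t = s + k%:~R * L ->
  `|(c t).1 - 2 * pi * k%:~R| <= B /\ `|(c t).2| <= B.
Proof.
exists (`|(c 0).1| + `|(c 0).2| + M * L).
  by rewrite ltr_wpDl// ?mulr_gt0// addr_ge0.
move=> _ k s /andP[s0 sL] ->; rewrite profile_shift /= addrK.
have [] := cM s 0; rewrite subr0 (ger0_norm s0) => h1 h2.
have hs : M * s <= M * L by rewrite ler_wpM2l// ltW.
split.
  rewrite -[(c s).1](subrK (c 0).1) (le_trans (ler_normD _ _))//.
  have := normr_ge0 (c 0).2; lra.
rewrite -[(c s).2](subrK (c 0).2) (le_trans (ler_normD _ _))//.
have := normr_ge0 (c 0).1; lra.
Qed.

Lemma profile_height : exists2 B : R, 0 < B & forall t, `|(c t).2| <= B.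
Proof.
have [B B0 h] := profile_bounded; exists B => // t.
by have [k [s [hs e]]] := profile_reduce t; have [] := h t k s hs e.
Qed.

(** In the [k]-th period the first coordinate is within [B] of [2 * pi * k], so a bounded first
    coordinate bounds [k] and hence [t]. This is what makes compactness available for a curve
    parametrised by the whole line. *)
Lemma profile_proper (K : R) : exists2 T : R, 0 < T &
  forall t, `|(c t).1| <= K -> `|t| <= T.
Proof.
have [B B0 h] := profile_bounded.
exists (L + (`|K| + B) * L); first by rewrite addr_gt0// mulr_gt0// ltr_wpDl//.
move=> t ht; have [k [s [hs e]]] := profile_reduce t; have [h1 _] := h t k s hs e.
have hk : `|k%:~R : R| <= `|K| + B.
  have h2 : `|2 * pi * k%:~R : R| <= `|K| + B.
    rewrite -[_ * _](subKr (c t).1) (le_trans (ler_normB _ _))//.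
    by rewrite lerD// (le_trans ht)// ler_norm.
  rewrite (le_trans _ h2)// normrM ler_peMl// ger0_norm ?mulr_ge0 ?pi_ge0//.
  have := pi_ge2 R; lra.
rewrite e (le_trans (ler_normD _ _))// lerD//.
  by case/andP: hs => s0 sL; rewrite ger0_norm.
by rewrite normrM (gtr0_norm L0) ler_wpM2r// ltW.
Qed.

Lemma range_profile_shift x : range c x -> range c (x.1 + 2 * pi, x.2).
Proof. by move=> [t _ <-]; exists (t + L); rewrite ?cL. Qed.

Lemma range_profile_shiftN x : range c x -> range c (x.1 - 2 * pi, x.2).
Proof.
move=> [t _ <-]; exists (t + (-1)%:~R * L) => //.
by rewrite profile_shift mulrN1z mulrN1.
Qed.

Lemma profile_avoid x : ~ range c x ->
  exists2 r : R, 0 < r & forall t, `|x.1 - (c t).1| < r -> `|x.2 - (c t).2| < r -> False.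
Proof.
move=> nx; have [T T0 hT] := profile_proper (`|x.1| + 1).
have cK : compact (c @` `[- T, T]).
  apply: continuous_compact; last exact: segment_compact.
  by apply: continuous_subspaceT; exact: profile_continuous.
have clK : closed (c @` `[- T, T]) by apply: compact_closed => //; exact: norm_hausdorff.
have /nbhs2P[r r0 hr] : nbhs x (~` (c @` `[- T, T])).
  apply: open_nbhs_nbhs; split; first exact: closed_openC.
  by move=> [t _ ht]; apply: nx; exists t.
(* The cap 1 keeps the first coordinate of [c t] within [|x.1| + 1], so that only parameters in
   [[- T, T]] matter, where the curve is compact. *)
exists (Num.min r 1); first by rewrite lt_min r0 ltr01.
move=> t; rewrite !lt_min => /andP[h1 h1'] /andP[h2 _].
apply: (hr (c t)) => //; exists t => //=; rewrite in_itv /= -ler_norml; apply: hT.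
rewrite -[(c t).1](subKr x.1) (le_trans (ler_normB _ _))// lerD// ltW//.
Qed.

Local Notation O := (above c).

Lemma above_notin x : O x -> ~ range c x.
Proof. by move=> [h [_ /connected_component_sub]]. Qed.

Lemma above_top x : (forall t, (c t).2 < x.2) -> O x.
Proof.
move=> hx; exists x.2; split => //; apply: component_seg => s _ [t _ /= ct].
have := hx t; rewrite ct /= subrr mulr0 addr0; by rewrite ltxx.
Qed.

Lemma above_component x y : O x -> connected_component (~` range c) x y -> O y.
Proof. by move=> [h [hc hx]] xy; exists h; split=> //; exact: connected_component_trans xy. Qed.

Lemma above_connected x y : O x -> O y -> connected_component (~` range c) x y.
Proof.
move=> [h [hc hx]] [h' [hc' hy]]; apply: connected_component_trans hy.
apply: connected_component_trans (connected_component_sym hx) _.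
apply: component_seg => s /andP[s0 s1] [t _ /= ct].
have := hc t; have := hc' t; rewrite ct /= => h1 h2.
(* Points of the vertical segment between the two heights lie above the lower one, hence above the
   curve. *)
have [hh|hh] := leP h h'.
  have : 0 <= s * (h' - h) by rewrite mulr_ge0// subr_ge0.
  lra.
have : 0 <= (1 - s) * (h - h') by rewrite mulr_ge0// subr_ge0// ltW.
lra.
Qed.

Lemma above_seg x y : O x -> (forall s, 0 <= s <= 1 -> ~ range c (seg x y s)) -> O y.
Proof. by move=> Ox h; apply: above_component Ox _; exact: component_seg. Qed.

Lemma above_open : open O.
Proof.
rewrite openE => x Ox; apply/nbhs2P.
have [r r0 hr] := profile_avoid (above_notin Ox).
exists r => // y h1 h2; apply: above_seg Ox _ => s s01 [t _ ct].
have [] := seg_ball x y s01; rewrite -ct => h3 h4.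
by apply: (hr t); [exact: le_lt_trans h1|exact: le_lt_trans h2].
Qed.

(** The connected set joining [x] to a high point is translated as a whole: [hv] keeps it off the
    profile, and its high point is still above everything. *)
Lemma above_translate (v : R) x :
  (forall y, range c (y.1 + v, y.2) -> range c y) -> O x -> O (x.1 + v, x.2).
Proof.
move=> hv [h [hc [B [B0 BC Bc] Bx]]].
apply: (@above_component (v, h)); first exact: above_top.
exists ((fun y => (y.1 + v, y.2)) @` B); last by exists x.
split; first by exists (0, h); rewrite //= add0r.
  by move=> _ [y By <-] /hv; exact: BC.
apply: connected_image => //; apply: continuous_pair2 => y; last exact: cvg_snd.
by apply: cvgD; [exact: cvg_fst|exact: cvg_cst].
Qed.

Lemma above_shift x : O (x.1 + 2 * pi, x.2) <-> O x.
Proof.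
split=> [h|]; last first.
  by apply: above_translate => y /range_profile_shiftN /=; rewrite addrK; case: y.
have := @above_translate (- (2 * pi)) (x.1 + 2 * pi, x.2); rewrite /= addrK.
have -> : (x.1, x.2) = x by case: x {h}.
by apply => // y /range_profile_shift /=; rewrite subrK; case: y.
Qed.

End profile.

(** * The domain is bounded from below *)

Lemma cisD (R : realType) (a b : R) : cis (a + b) = cis a * cis b.
Proof.
rewrite /cis cosD sinD; apply/eqP; rewrite eq_complex /=; apply/andP; split=> //.
by rewrite addrC.
Qed.

Lemma cis0 (R : realType) : cis 0 = 1 :> R[i].
Proof. by rewrite /cis cos0 sin0. Qed.

Lemma cosD2piz (R : realType) (x : R) (k : int) : cos (x + k%:~R * (2 * pi)) = cos x.
Proof.
have h : forall (n : nat) y, cos (y + n%:R * (2 * pi)) = cos y :> R.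
  move=> n y; rewrite mulr_natl [2 * _]mulr_natl.
  exact: (periodicn (@cosD2pi R)).
case: k => n; first exact: h.
by rewrite NegzE mulrNz mulNr -(h n.+1 (x - _)) subrK.
Qed.

Lemma cos_eq1 (R : realType) (x : R) : cos x = 1 -> exists k : int, x = k%:~R * (2 * pi).
Proof.
have p0 := pi_gt0 R; move=> h.
set k := Num.floor (x / (2 * pi)); exists k; apply/eqP; rewrite -subr_eq0; apply/eqP.
have /andP[] := floor_itv (x / (2 * pi)); rewrite -/k.
rewrite ler_pdivlMr ?ltr_pdivrMr; [|lra..]; rewrite -subr_ge0 => k1 k2.
have hr : cos (x - k%:~R * (2 * pi)) = 1 by rewrite -[RHS]h -mulNr -mulrNz cosD2piz.
move: hr k1; set r := x - _ => hr k1.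
have k3 : r < 2 * pi by move: k2; rewrite /r intrD1; lra.
have [rp|rp] := leP r pi.
  apply: cos_inj; rewrite ?in_itv /= ?lexx ?rp ?k1 ?pi_ge0//.
  by rewrite hr cos0.
have : 2 * pi - r = 0.
  apply: cos_inj; rewrite ?in_itv /= ?lexx ?pi_ge0//; first by apply/andP; split; lra.
  rewrite -cosN opprB -(cosD2piz (r - _) 1) mul1r subrK hr cos0//.
lra.
Qed.

Lemma conjcM (R : realType) (x y : R[i]) : conjc (x * y) = conjc x * conjc y.
Proof. by case: x y => [a b] [d e]; apply/eqP; rewrite eq_complex /=; apply/andP; split; apply/eqP; ring. Qed.

(** * Winding of periodic loops in the punctured plane *)

Section winding.
Context (R : realType) (L : R).
Hypothesis L0 : 0 < L.
Implicit Types (z w : R -> R[i]).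

Definition loop (f : R -> R) := continuous f /\ forall t, f (t + L) = f t.

Definition cloop z :=
  loop (fun t => complex.Re (z t)) /\ loop (fun t => complex.Im (z t)).

(* [z / w] has a periodic continuous argument: the loops [z] and [w] have the same winding number. *)
Definition homotopic_loops z w := exists a r : R -> R,
  loop a /\ forall t, 0 < r t /\ z t = (r t)%:C * cis (a t) * w t.

Lemma homotopic_loops_trans z w v :
  homotopic_loops z w -> homotopic_loops w v -> homotopic_loops z v.
Proof.
move=> [a [r [[ca La] h]]] [b [s [[cb Lb] h']]].
exists (fun t => a t + b t), (fun t => r t * s t); split.
  by split=> t; [apply: cvgD; [exact: ca|exact: cb]|rewrite La Lb].
move=> t; have [r0 ->] := h t; have [s0 ->] := h' t; split; first exact: mulr_gt0.
by rewrite cisD rmorphM /=; ring.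
Qed.

Lemma homotopic_loops_sym z w : homotopic_loops z w -> homotopic_loops w z.
Proof.
move=> [a [r [[ca La] h]]].
exists (fun t => - a t), (fun t => (r t)^-1); split.
  by split=> t; [apply: cvgN; exact: ca|rewrite La].
move=> t; have [r0 ->] := h t; split; first by rewrite invr_gt0.
have e1 : ((r t)^-1)%:C * (r t)%:C = 1 :> R[i] by rewrite -rmorphM /= mulVf ?gt_eqF.
have e2 : cis (- a t) * cis (a t) = 1 by rewrite -cisD addNr cis0.
transitivity (((r t)^-1)%:C * (r t)%:C * (cis (- a t) * cis (a t)) * w t); last by ring.
by rewrite e1 e2 !mul1r.
Qed.

(** If [z] is closer to [w] than [w] is to 0, the quotient [z / w] has positive real part, so the
    arctangent is a continuous periodic choice of its argument. *)
Lemma homotopic_loops_near z w : cloop z -> cloop w ->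
  (forall t, sqnorm (z t - w t) < sqnorm (w t)) -> homotopic_loops z w.
Proof.
move=> [[cz1 Lz1] [cz2 Lz2]] [[cw1 Lw1] [cw2 Lw2]] h.
(* [p] and [q] are the real and imaginary parts of [z] times the conjugate of [w]. *)
pose p t := complex.Re (z t) * complex.Re (w t) + complex.Im (z t) * complex.Im (w t).
pose q t := complex.Im (z t) * complex.Re (w t) - complex.Re (z t) * complex.Im (w t).
have p0 t : 0 < p t.
  move: (h t); rewrite /p /sqnorm; case: (z t) (w t) => [a b] [d e] /= hh.
  have := sqr_ge0 a; have := sqr_ge0 b; nra.
have cp : continuous p.
  by move=> t; apply: cvgD; apply: cvgM; [exact: cz1|exact: cw1|exact: cz2|exact: cw2].
have cq : continuous q.
  by move=> t; apply: cvgB; apply: cvgM; [exact: cz2|exact: cw1|exact: cz1|exact: cw2].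
have w0 t : 0 < sqnorm (w t) by rewrite (le_lt_trans _ (h t))// addr_ge0// sqr_ge0.
exists (fun t => atan (q t / p t)), (fun t => Num.sqrt (p t ^+ 2 + q t ^+ 2) / sqnorm (w t)).
split; first split=> t.
- apply: (@continuous_comp _ _ _ (fun t => q t / p t) atan); last exact: continuous_atan.
  by apply: cvgM; [exact: cq|apply: cvgV; [rewrite gt_eqF|exact: cp]].
- by rewrite /p /q Lz1 Lz2 Lw1 Lw2.
move=> t.
have s0 : 0 < Num.sqrt (p t ^+ 2 + q t ^+ 2).
  by rewrite sqrtr_gt0 ltr_wpDr ?sqr_ge0// exprn_gt0.
split; first by rewrite divr_gt0.
have hc : cos (atan (q t / p t)) = p t / Num.sqrt (p t ^+ 2 + q t ^+ 2).
  rewrite cos_atan.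
  have -> : 1 + (q t / p t) ^+ 2 = (p t ^+ 2 + q t ^+ 2) / p t ^+ 2.
    by field; rewrite gt_eqF.
  rewrite sqrtrM ?addr_ge0 ?sqr_ge0// sqrtrV ?sqr_ge0// sqrtr_sqr gtr0_norm//.
  by rewrite invfM invrK mulrC.
have hs : sin (atan (q t / p t)) = q t / Num.sqrt (p t ^+ 2 + q t ^+ 2).
  have := atanK (q t / p t); rewrite /tan => /(congr1 (fun x => x * cos (atan (q t / p t)))).
  rewrite mulfVK; last by rewrite hc mulf_neq0 ?invr_eq0 ?gt_eqF.
  by rewrite hc => ->; field; rewrite !gt_eqF.
rewrite /cis hc hs.
apply/eqP; rewrite eq_complex; apply/andP.
have w0' : sqnorm (w t) != 0 by rewrite gt_eqF.
have s0' : Num.sqrt (p t ^+ 2 + q t ^+ 2) != 0 by rewrite gt_eqF.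
move: w0' s0'; move: (Num.sqrt _) => S; rewrite /p /q /sqnorm.
case: (z t) (w t) => [a b] [d e] /= W0 S0.
by split; apply/eqP; field; rewrite ?W0 ?S0.
Qed.

End winding.

(** * Winding of the profile around points of the cylinder *)

Section jordan.
Context (R : realType) (c : R -> R * R) (M L : R).
Hypothesis M0 : 0 < M.
Hypothesis cM : lipschitz_coords c M.
Hypothesis L0 : 0 < L.
Hypothesis cL : shift_periodic c L.

Local Notation O := (above c).

(* The quotient of the plane by the period, embedded as the punctured complex plane. *)
Definition cylinder (x : R * R) : R[i] := (expR (- x.2))%:C * cis x.1.

Lemma cylinder_Re x : complex.Re (cylinder x) = expR (- x.2) * cos x.1.
Proof. by rewrite /= mul0r subr0. Qed.

Lemma cylinder_Im x : complex.Im (cylinder x) = expR (- x.2) * sin x.1.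
Proof. by rewrite /= mul0r addr0. Qed.

Lemma sqnorm_cylinder x : sqnorm (cylinder x) = expR (- x.2) ^+ 2.
Proof.
rewrite /sqnorm cylinder_Re cylinder_Im !exprMn -mulrDr.
by rewrite cos2Dsin2 mulr1.
Qed.

Lemma continuous_cylinder :
  continuous (fun x => complex.Re (cylinder x)) /\
  continuous (fun x => complex.Im (cylinder x)).
Proof.
have ce : continuous (fun x : R * R => expR (- x.2)).
  move=> x; apply: (@continuous_comp _ _ _ (fun x : R * R => - x.2) expR).
    by apply: cvgN; exact: cvg_snd.
  exact: continuous_expR.
split=> x.
- under eq_fun do rewrite cylinder_Re.
  apply: cvgM; first exact: ce.
  apply: (@continuous_comp _ _ _ (fun x : R * R => x.1) cos); first exact: cvg_fst.
  exact: continuous_cos.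
- under eq_fun do rewrite cylinder_Im.
  apply: cvgM; first exact: ce.
  apply: (@continuous_comp _ _ _ (fun x : R * R => x.1) sin); first exact: cvg_fst.
  exact: continuous_sin.
Qed.

Lemma cylinder_inj x y : cylinder x = cylinder y ->
  exists k : int, x = (y.1 + 2 * pi * k%:~R, y.2).
Proof.
move=> h; have e2 : x.2 = y.2.
  have : sqnorm (cylinder x) = sqnorm (cylinder y) by rewrite h.
  rewrite !sqnorm_cylinder => /eqP; rewrite eqrXn2 ?expR_ge0// => /eqP /expR_inj.
  exact: oppr_inj.
have e0 : expR (- y.2) != 0 by rewrite gt_eqF// expR_gt0.
have h1 : cos x.1 = cos y.1.
  have := congr1 (@complex.Re R) h; rewrite !cylinder_Re e2; exact: mulfI.
have h2 : sin x.1 = sin y.1.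
  have := congr1 (@complex.Im R) h; rewrite !cylinder_Im e2; exact: mulfI.
have [|k hk] := @cos_eq1 R (x.1 - y.1).
  by rewrite cosB h1 h2 -!expr2 cos2Dsin2.
exists k; rewrite -e2 [LHS]surjective_pairing; congr pair; lra.
Qed.

(** The image of the profile as seen from the image of [y]. The class of this loop under
    [homotopic_loops] plays the part of the winding number about [y]. *)
Definition around (y : R * R) (t : R) : R[i] := cylinder (c t) - cylinder y.

Lemma cloop_around y : cloop L (around y).
Proof.
have cc := profile_continuous M0 cM.
have [c1 c2] := continuous_cylinder.
have hL t : cylinder (c (t + L)) = cylinder (c t).
  rewrite cL /cylinder /cis /=; congr (_ * (_ +i* _)).
    by rewrite mulr_natl cosD2pi.
  by rewrite mulr_natl sinD2pi.
split; split=> t; try by rewrite /around hL.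
- rewrite /around /=; apply: cvgB; last exact: cvg_cst.
  exact: (continuous_comp (cc t) (c1 (c t))).
- rewrite /around /=; apply: cvgB; last exact: cvg_cst.
  exact: (continuous_comp (cc t) (c2 (c t))).
Qed.

Lemma around_neq0 y : ~ range c y -> forall t, around y t != 0.
Proof.
move=> hy t; apply/eqP => /eqP; rewrite subr_eq0 => /eqP /cylinder_inj[k hk].
apply: hy; exists (t + (- k)%:~R * L) => //.
rewrite (profile_shift cL) hk /= mulrNz mulrN addrK.
by case: y {hk}.
Qed.

Lemma sqnorm_gt0 (z : R[i]) : z != 0 -> 0 < sqnorm z.
Proof.
case: z => a b; rewrite eq_complex /= negb_and /sqnorm /= => h.
rewrite lt_neqAle addr_ge0 ?sqr_ge0// andbT eq_sym paddr_eq0 ?sqr_ge0//.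
by rewrite !sqrf_eq0 negb_and.
Qed.

Lemma loop_min (f : R -> R) : loop L f -> (forall t, 0 < f t) ->
  exists2 e : R, 0 < e & forall t, e <= f t.
Proof.
move=> [cf Lf] f0.
have [s sL hs] := @EVT_min R f 0 L (ltW L0) (continuous_subspaceT cf).
exists (f s) => // t.
have hn (n : nat) u : f (u + n%:R * L) = f u.
  elim: n => [|n ih]; first by rewrite mul0r addr0.
  by rewrite -natr1 mulrDl mul1r addrA Lf ih.
have hk (k : int) u : f (u + k%:~R * L) = f u.
  by case: k => n; rewrite ?hn// NegzE mulrNz mulNr -(hn n.+1 (u - _)) subrK.
have [k [u [hu ->]]] := profile_reduce L0 t.
by rewrite hk hs// in_itv.
Qed.

(** Off the profile the loop keeps a positive distance from 0, by compactness of a period, and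
    moving [y] slightly adds a small constant to it. Hence its class is locally constant. *)
Lemma around_near y : ~ range c y ->
  \forall y' \near y, homotopic_loops L (around y') (around y).
Proof.
move=> hy.
have [[c1 L1] [c2 L2]] := cloop_around y.
have [e e0 he] : exists2 e : R, 0 < e & forall t, e <= sqnorm (around y t).
  apply: loop_min; last by move=> t; exact/sqnorm_gt0/around_neq0.
  split=> t; last by rewrite /sqnorm L1 L2.
  by apply: cvgD; apply: cvgM; [exact: c1|exact: c1|exact: c2|exact: c2].
have : (fun y' => sqnorm (cylinder y - cylinder y')) y' @[y' --> y] --> (0 : R).
  have [d1 d2] := continuous_cylinder.
  rewrite [X in _ --> X](_ : 0 = sqnorm (cylinder y - cylinder y)); last first.
    by rewrite subrr /sqnorm /= expr0n addr0.
  apply: cvgD; (apply: cvgM; apply: cvgB; try exact: cvg_cst);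
    (exact: d1 || exact: d2).
move/cvgrPdist_lt => /(_ e e0); apply: filterS => y'.
rewrite sub0r normrN ger0_norm ?addr_ge0 ?sqr_ge0// => h.
apply: homotopic_loops_near; try exact: cloop_around.
move=> t; rewrite (lt_le_trans _ (he t))// (le_lt_trans _ h)//.
by rewrite /around opprB [leLHS](_ : _ = sqnorm (cylinder y - cylinder y'))//; congr sqnorm; ring.
Qed.

Lemma around_above x y : O x -> O y -> homotopic_loops L (around x) (around y).
Proof.
move=> Ox Oy.
have [B [Bx BC Bc] By] := above_connected Ox Oy.
have BO z : B z -> O z by move=> Bz; apply: (above_component Ox); exists B.
have oO := above_open M0 cM L0 cL.
have oP (P : R * R -> Prop) : (forall z, P z -> O z) ->
    (forall z, P z -> \forall z' \near z, O z' -> P z') -> open [set z | P z].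
  move=> PO hP; rewrite openE => z Pz.
  have hz := hP z Pz; have hO : \forall z' \near z, O z'.
    by apply: open_nbhs_nbhs; split => //; exact: PO.
  by near=> z'; apply: (near hz z') => //; near: z'.
(* [P] and [Q] are both open and divide the region, so the part of the connected set [B] in [P] is
   open and closed in [B]. *)
pose P z := O z /\ homotopic_loops L (around x) (around z).
pose Q z := O z /\ ~ homotopic_loops L (around x) (around z).
have oPP : open [set z | P z].
  apply: oP => [z []//|z [Oz hz]].
  apply: filterS (around_near (above_notin Oz)) => z' hz' Oz'; split => //.
  exact: homotopic_loops_trans hz (homotopic_loops_sym hz').
have oQ : open [set z | Q z].
  apply: oP => [z []//|z [Oz hz]].
  apply: filterS (around_near (above_notin Oz)) => z' hz' Oz'; split => // h.
  exact/hz/(homotopic_loops_trans h hz').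
have : B `&` [set z | P z] = B.
  apply: Bc.
  - exists x; split => //; split=> //.
    exists (fun=> 0), (fun=> 1); split; first by split=> // t; exact: cvg_cst.
    by move=> t; split=> //; rewrite cis0 !mul1r.
  - by exists [set z | P z].
  - exists (~` [set z | Q z]); first exact: open_closedC.
    apply/seteqP; split=> z [Bz]; first by move=> [Oz hz]; split => // -[].
    move=> hz; split=> //; split; first exact: BO.
    by apply: contrapT => h; apply: hz; split=> //; exact: BO.
by move=> /seteqP[_ /(_ y By)[_ []]].
Unshelve. all: by end_near. Qed.

Lemma sqnormN (z : R[i]) : sqnorm (- z) = sqnorm z.
Proof. by case: z => a b; rewrite /sqnorm /= !sqrrN. Qed.

Lemma cloop_cst (z : R[i]) : cloop L (fun=> z).
Proof. by split; split=> // t; exact: cvg_cst. Qed.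

Lemma cloop_cylinder : cloop L (fun t => cylinder (c t)).
Proof.
have [[c1 L1] [c2 L2]] := cloop_around 0.
split; split=> t.
- under eq_fun do rewrite -[complex.Re _](subrK (complex.Re (cylinder 0))).
  by apply: cvgD; [exact: c1|exact: cvg_cst].
- by have := L1 t; rewrite /around /= => /addIr.
- under eq_fun do rewrite -[complex.Im _](subrK (complex.Im (cylinder 0))).
  by apply: cvgD; [exact: c2|exact: cvg_cst].
- by have := L2 t; rewrite /around /= => /addIr.
Qed.

(* Seen from a point far above, the image of the profile winds once around it in the
   cylinder; seen from far below, it does not wind. *)
Lemma above_bounded_below : exists m : R, forall x, O x -> m <= x.2.
Proof.
have [B B0 hB] := profile_height M0 cM L0 cL.
exists (- B - 1) => y Oy; rewrite leNgt; apply/negP => hy.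
have cB t : - B <= (c t).2 <= B by rewrite -ler_norml.
have Ox : O (0, B + 1).
  by apply: above_top => t /=; have /andP[_] := cB t; lra.
have hxy := around_above Ox Oy.
have hx : homotopic_loops L (around (0, B + 1)) (fun t => cylinder (c t)).
  apply: homotopic_loops_near; [exact: cloop_around|exact: cloop_cylinder|] => t.
  rewrite /around addrAC subrr sub0r sqnormN !sqnorm_cylinder.
  rewrite ltrXn2r ?expR_ge0// ltr_expR /=; have /andP[_] := cB t; lra.
have hy' : homotopic_loops L (around y) (fun=> - cylinder y).
  apply: homotopic_loops_near; [exact: cloop_around|exact: cloop_cst|] => t.
  rewrite /around opprK subrK sqnormN !sqnorm_cylinder.
  rewrite ltrXn2r ?expR_ge0// ltr_expR /=; have /andP[+ _] := cB t; lra.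
have [a [r [[ca La] h]]] : homotopic_loops L (fun t => cylinder (c t)) (fun=> - cylinder y).
  apply: homotopic_loops_trans (homotopic_loops_sym hx) _.
  exact: homotopic_loops_trans hxy hy'.
(* [f] compares the argument of the profile with that of the constant loop, so it takes only values
   in multiples of 2 pi. Yet it gains 2 pi over one period, and by the intermediate value theorem it
   would also take the value [f 0 + pi]. *)
pose f t := (c t).1 - a t - (y.1 + pi).
have cf : continuous f.
  have cc := profile_continuous M0 cM.
  move=> t; apply: cvgB; last exact: cvg_cst.
  by apply: cvgB; [exact: (continuous_comp (cc t) cvg_fst)|exact: ca].
have f1 t : cos (f t) = 1.
  have [rt ht] := h t.
  have e1 : cylinder (c t) = (r t * expR (- y.2))%:C * cis (a t + (y.1 + pi)).
    have cpi : cis (pi : R) = -1.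
      by rewrite /cis cospi sinpi; apply/eqP; rewrite eq_complex /= oppr0 !eqxx.
    by rewrite ht /cylinder cisD (cisD y.1) cpi rmorphM /=; ring.
  have e2 : cis (f t) * (expR (- (c t).2))%:C = (r t * expR (- y.2))%:C.
    transitivity (cis (- (a t + (y.1 + pi))) * cylinder (c t)).
      rewrite /cylinder /f -addrA -opprD cisD; ring.
    rewrite e1 mulrCA -cisD addNr cis0 mulr1//.
  have e3 := congr1 (@complex.Im R) e2; have e4 := congr1 (@complex.Re R) e2.
  move: e3 e4; rewrite /= !mulr0 subr0 add0r => e3 e4.
  have ec : expR (- (c t).2) != 0 by rewrite gt_eqF// expR_gt0.
  have sf : sin (f t) = 0 by apply: (mulIf ec); rewrite mul0r.
  have cf0 : 0 < cos (f t).
    by rewrite -(pmulr_lgt0 _ (expR_gt0 (- (c t).2))) e4 mulr_gt0// expR_gt0.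
  have := sin0cos1 sf; rewrite gtr0_norm//.
have fL : f L = f 0 + 2 * pi.
  rewrite /f -[L in c L]add0r cL -[L in a L]add0r La /=; lra.
have p0 := pi_gt0 R.
have [s _ fs] : exists2 s, s \in `[0, L] & f s = f 0 + pi.
  apply: IVT; [exact: ltW|exact: continuous_subspaceT|].
  by rewrite fL min_l ?max_r; lra.
by have := f1 s; rewrite fs cosDpi f1; lra.
Qed.

End jordan.

(** * Translations of the plane and tubes around the curve *)

Section translation.
Context (R : realType).
Local Notation leb := (@lebesgue_measure R).
Local Notation TR := (measurableTypeR R).
Local Open Scope ereal_scope.

Lemma measurable_shift (v : R) D :
  measurable_fun D (fun x : measurableTypeR R => (x + v)%R : measurableTypeR R).
Proof. by apply: measurable_funD. Qed.

(** The pushforward under the shift agrees with Lebesgue measure on half-open intervals, which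
    determine the measure. *)
Lemma lebesgue_measure_shift (v : R) (A : set TR) : measurable A ->
  leb ((fun x => (x + v)%R) @^-1` A) = leb A.
Proof.
move=> mA; have mv := @measurable_shift v setT.
rewrite -/(pushforward leb (fun x : measurableTypeR R => (x + v)%R : measurableTypeR R) A).
apply/esym/lebesgue_measure_unique => //= _ [[a b]] _ <-.
rewrite /pushforward.
have -> : (fun x => (x + v)%R) @^-1` `](a, b).1, (a, b).2] = `](a - v)%R, (b - v)%R]%classic :> set TR.
  by apply/seteqP; split=> x /=; rewrite !in_itv/= ltrBlDr lerBrDr.
rewrite /= !lebesgue_measure_itv/= !lte_fin ltrD2r.
by case: ifP => // _; rewrite -!EFinD; congr EFin; ring.
Qed.

Lemma ge0_integral_shift (v : R) (D : set TR) (f : TR -> \bar R) :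
  measurable D -> measurable_fun D f -> (forall x, D x -> 0 <= f x) ->
  \int[leb]_(x in (fun x => (x + v)%R) @^-1` D) f (x + v)%R = \int[leb]_(x in D) f x.
Proof.
move=> mD mf f0.
rewrite -(@ge0_integral_pushforward _ _ _ _ R _ (measurable_shift v (D := setT)) leb) //; last first.
  by move=> x; rewrite inE; exact: f0.
apply: eq_measure_integral; first exact: (measurable_shift v (D := setT)).
by move=> ? A mA _; exact: lebesgue_measure_shift.
Qed.

(** The shift moves the window to [[v, 2 pi + v)]; the piece beyond 2 pi folds back by periodicity
    onto [[0, v)], which is the missing piece. *)
Lemma ge0_integral_periodic (v : R) (f : TR -> \bar R) : (0 <= v <= 2 * pi)%R ->
  measurable_fun setT f -> (forall x, 0 <= f x) -> (forall x, f (x + 2 * pi)%R = f x) ->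
  \int[leb]_(x in `]0%R, (2 * pi)%R[) f (x + v)%R = \int[leb]_(x in `]0%R, (2 * pi)%R[) f x.
Proof.
move=> /andP[v0 v2] mf f0 fp.
have mfS (D : set TR) : measurable_fun D f by exact: measurable_funTS.
have mfv (D : set TR) : measurable_fun D (fun x : TR => f (x + v)%R).
  by apply: (measurableT_comp mf); exact: measurable_shift.
rewrite (integral_itv_obnd_cbnd (mfv _)) (integral_itv_obnd_cbnd (mfS _)).
have -> : \int[leb]_(x in `[0%R, (2 * pi)%R[) f (x + v)%R = \int[leb]_(x in (fun x => (x + v)%R) @^-1` `[v, (2 * pi + v)%R[) f (x + v)%R.
  congr integral.
  by apply/seteqP; split=> x /=; rewrite !in_itv/= -lerBlDr subrr ltrD2r.
rewrite ge0_integral_shift//.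
have -> : `[v, (2 * pi + v)%R[%classic = `[v, (2 * pi)%R[ `|` `[(2 * pi)%R, (2 * pi + v)%R[ :> set TR.
  apply/seteqP; split=> x /=; rewrite !in_itv/=.
    by move=> /andP[h1 h2]; have [h|h] := ltP x (2 * pi)%R; [left|right]; rewrite ?h1 ?h2.
  by move=> [/andP[h1 h2]|/andP[h1 h2]]; apply/andP; split; lra.
have -> : `[0%R, (2 * pi)%R[%classic = `[0%R, v[ `|` `[v, (2 * pi)%R[ :> set TR.
  apply/seteqP; split=> x /=; rewrite !in_itv/=.
    by move=> /andP[h1 h2]; have [h|h] := ltP x v; [left|right]; rewrite ?h1 ?h2.
  by move=> [/andP[h1 h2]|/andP[h1 h2]]; apply/andP; split; lra.
have d1 : [disjoint `[v, (2 * pi)%R[%classic & `[(2 * pi)%R, (2 * pi + v)%R[%classic :> set TR].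
  by apply/disj_setPS => x /= []; rewrite !in_itv/= => /andP[_ h1] /andP[h2 _]; lra.
have d2 : [disjoint `[0%R, v[%classic & `[v, (2 * pi)%R[%classic :> set TR].
  by apply/disj_setPS => x /= []; rewrite !in_itv/= => /andP[_ h1] /andP[h2 _]; lra.
rewrite (ge0_integral_setU _ _ _ (mfS _) _ d1)// (ge0_integral_setU _ _ _ (mfS _) _ d2)//.
rewrite addeC; congr (_ + _).
rewrite -(@ge0_integral_shift (2 * pi)%R)//.
transitivity (\int[leb]_(x in (fun x => (x + 2 * pi)%R) @^-1` `[(2 * pi)%R, (2 * pi + v)%R[) f x).
  by apply: eq_integral => x _; exact: fp.
congr integral; apply/seteqP; split=> x /=; rewrite !in_itv/=; lra.
Qed.

End translation.

(** * Measure on the plane and integrals over a periodic strip *)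

Section plane.
Context (R : realType).
Local Notation leb := (@lebesgue_measure R).
Local Notation T2 := (measurableTypeR R * measurableTypeR R)%type.
Local Open Scope ereal_scope.

(** The plane carries the product sigma-algebra, so an open set has to be written as a countable
    union of products: here squares with rational centres and radii [1 / (n + 1)]. *)
Lemma open_measurable_plane (A : set (R * R)) : open A -> measurable (A : set T2).
Proof.
rewrite openE => oA.
pose box (q : rat * rat * nat) : set T2 :=
  ball (ratr q.1.1 : R) (q.2.+1%:R^-1)%R `*` ball (ratr q.1.2 : R) (q.2.+1%:R^-1)%R.
have -> : A = \bigcup_(q in [set q | box q `<=` A]) box q.
  apply/seteqP; split=> [x /oA /nbhs2P[r r0 hr]|x [q /= + ?]]; last exact.
  have [n hn] : exists n : nat, (n.+1%:R^-1 < r / 2)%R.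
    have [n _ hn] := near_infty_natSinv_lt (PosNum (divr_gt0 r0 (ltr0Sn R 1))).
    by exists n; exact: (hn n (leqnn n)).
  have [e he] : exists e : R, e = (n.+1%:R^-1)%R by eexists.
  have e0 : (0 < e)%R by rewrite he.
  rewrite -he in hn.
  have rq (y : R) : exists q : rat, (`|ratr q - y| < e)%R.
    have [|q] := @rat_in_itvoo R (y - e)%R (y + e)%R; first lra.
    by rewrite in_itv /= => /andP[h1 h2]; exists q; rewrite ltr_norml; lra.
  have [q1 h1] := rq x.1; have [q2 h2] := rq x.2.
  exists (q1, q2, n); last by split; rewrite /ball /= -he.
  move=> y [/=]; rewrite /ball /= -he => h3 h4; apply: hr.
    have := ler_distD (ratr q1) x.1 y.1; move: h1; rewrite [(`|ratr q1 - x.1|)%R]distrC; lra.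
  have := ler_distD (ratr q2) x.2 y.2; move: h2; rewrite [(`|ratr q2 - x.2|)%R]distrC; lra.
rewrite bigcup_mkcond; apply: countable_bigcupT_measurable; first exact: countableP.
by move=> q; case: ifP => // _; apply: measurableX; exact: measurable_ball.
Qed.

Lemma continuous_measurable_plane (f : R * R -> R) : continuous f ->
  measurable_fun setT (f : T2 -> R).
Proof.
move=> cf; apply: (measurability _ (RGenOpens.measurableE R)).
move=> _ [_ [a [b ->] <-]]; rewrite setTI; apply: open_measurable_plane.
by apply: open_comp; [move=> ? _; exact: cf|exact: interval_open].
Qed.

Definition strip : set T2 := [set x | (0 < x.1 < 2 * pi)%R].

Lemma stripE : strip = `]0%R, (2 * pi)%R[%classic `*` setT.
Proof. by apply/seteqP; split=> x /=; rewrite ?in_itv//= => -[]. Qed.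

Lemma measurable_strip : measurable strip.
Proof. by rewrite stripE; apply: measurableX. Qed.

Lemma measurable_translate (v : R * R) :
  measurable_fun setT (fun x : T2 => (x.1 + v.1, x.2 + v.2)%R : T2).
Proof.
by apply: measurable_fun_pair; apply: measurable_funD.
Qed.

Lemma patch_strip (f : T2 -> \bar R) x y :
  (f \_ strip) (x, y) = ((fun x : measurableTypeR R => f (x, y)) \_ `]0%R, (2 * pi)%R[) x.
Proof.
rewrite /patch; have -> // : ((x, y) \in strip) = (x \in `]0%R, (2 * pi)%R[%classic).
by apply: asbool_equiv_eq; rewrite /strip /= in_itv.
Qed.

Lemma integral_strip (f : T2 -> \bar R) : measurable_fun setT f -> (forall x, 0 <= f x) ->
  \int[plane_measure R]_(x in strip) f x =
  \int[leb]_y \int[leb]_(x in `]0%R, (2 * pi)%R[) f (x, y).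
Proof.
move=> mf f0; rewrite integral_mkcond fubini_tonelli2.
- apply: eq_integral => y _; rewrite /fubini_G [RHS]integral_mkcond.
  by apply: eq_integral => x _; exact: patch_strip.
- by apply/(measurable_restrictT _ measurable_strip); exact: measurable_funTS.
- by move=> x; rewrite patchE; case: ifP.
Qed.

(** By Tonelli the translation splits into a horizontal one, absorbed by periodicity, and a vertical
    one over the whole line. *)
Lemma ge0_integral_strip_translate (v : R * R) (f : T2 -> \bar R) : (0 <= v.1 <= 2 * pi)%R ->
  measurable_fun setT f -> (forall x, 0 <= f x) ->
  (forall x, f (x.1 + 2 * pi, x.2)%R = f x) ->
  \int[plane_measure R]_(x in strip) f (x.1 + v.1, x.2 + v.2)%R =
  \int[plane_measure R]_(x in strip) f x.
Proof.
move=> hv mf f0 fp.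
have mfv : measurable_fun setT (fun x : T2 => f (x.1 + v.1, x.2 + v.2)%R).
  exact: (measurableT_comp mf (measurable_translate v)).
rewrite !integral_strip//.
have mf1 y : measurable_fun setT (fun x : measurableTypeR R => f (x, y)).
  exact: (measurableT_comp mf (measurable_pair2 y)).
transitivity (\int[leb]_y (\int[leb]_(x in `]0%R, (2 * pi)%R[) f (x, y + v.2)%R)).
  apply: eq_integral => y _.
  apply: (@ge0_integral_periodic R v.1 (fun x => f (x, y + v.2)%R) hv) => //.
  by move=> x; exact: (fp (x, (y + v.2)%R)).
rewrite -[RHS](@ge0_integral_shift R v.2)//.
- pose g (x : T2) := (f \_ strip) x.
  have := @measurable_fun_fubini_tonelli_G _ _ _ _ R leb g.
  rewrite /fubini_G.
  have -> : (fun y : R => \int[leb]_x g (x, y)) =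
      (fun y => \int[leb]_(x in `]0%R, (2 * pi)%R[) f (x, y)).
    apply/funext => y; rewrite [RHS]integral_mkcond.
    by apply: eq_integral => x _; exact: patch_strip.
  apply.
  + by apply/(measurable_restrictT _ measurable_strip); exact: measurable_funTS.
  + by move=> x; rewrite /g patchE; case: ifP.
- by move=> y _; exact: integral_ge0.
Qed.

Lemma Rintegral_strip_translate (v : R * R) (f : T2 -> R) : (0 <= v.1 <= 2 * pi)%R ->
  measurable_fun setT f -> (forall x, f (x.1 + 2 * pi, x.2)%R = f x) ->
  (\int[plane_measure R]_(x in strip) f (x.1 + v.1, x.2 + v.2) =
  \int[plane_measure R]_(x in strip) f x)%R.
Proof.
move=> hv mf fp; rewrite /Rintegral; congr fine.
rewrite integralE [RHS]integralE; congr (_ - _).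
- rewrite -[RHS](ge0_integral_strip_translate hv)//.
  + by apply: eq_integral => x _; rewrite unlock.
  + by apply: measurable_realfun.measurable_funepos; exact/measurable_EFinP.
  + by move=> x; rewrite unlock fp.
- rewrite -[RHS](ge0_integral_strip_translate hv)//.
  + by apply: eq_integral => x _; rewrite unlock.
  + by apply: measurable_realfun.measurable_funeneg; exact/measurable_EFinP.
  + by move=> x; rewrite unlock fp.
Qed.

End plane.

Section plane_facts.
Context (R : realType).
Local Notation T2 := (measurableTypeR R * measurableTypeR R)%type.

Lemma plane_measureX (A B : set (measurableTypeR R)) : measurable A -> measurable B ->
  plane_measure R (A `*` B) = (@lebesgue_measure R A * @lebesgue_measure R B)%E.
Proof. by move=> mA mB; exact: product_measure1E. Qed.

Lemma plane_sigma_finite : sigma_finite setT (plane_measure R).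
Proof.
exists (fun n : nat => (`[- n%:R, n%:R]%classic `*` `[- n%:R, n%:R]%classic : set T2)).
  apply/esym; rewrite -subTset => x _.
  have [n nx] : exists n : nat, `|x.1| + `|x.2| <= n%:R.
    by exists (Num.bound (`|x.1| + `|x.2|)); apply/ltW/archi_boundP; rewrite addr_ge0.
  exists n => //; split => /=; rewrite in_itv /= -ler_norml.
    by rewrite (le_trans _ nx)// lerDl.
  by rewrite (le_trans _ nx)// lerDr.
move=> n; split; first exact: measurableX.
rewrite plane_measureX// !lebesgue_measure_itv/=.
by case: ifP => _; rewrite ?mule0 ?ltry// -EFinD -EFinM ltry.
Qed.

(** Bundled with its sigma-finiteness, the plane can serve as a factor in Tonelli's theorem for
    plane times line. *)
Definition plane_sfm : {sigma_finite_measure set T2 -> \bar R} :=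
  HB.pack (@lebesgue_measure R \x @lebesgue_measure R)%E
    (Measure_isSigmaFinite.Build _ _ _ (@lebesgue_measure R \x @lebesgue_measure R)%E plane_sigma_finite).

Lemma fubini_plane_line (Phi : T2 * measurableTypeR R -> \bar R) :
  measurable_fun setT Phi -> (forall z, 0 <= Phi z)%E ->
  (\int[plane_measure R]_x \int[@lebesgue_measure R]_s Phi (x, s) =
   \int[@lebesgue_measure R]_s \int[plane_measure R]_x Phi (x, s))%E.
Proof. exact: (@fubini_tonelli _ _ _ _ R plane_sfm (@lebesgue_measure R) Phi). Qed.

End plane_facts.

(** * Integrals over tubes around the profile *)

Section tube.
Context (R : realType) (c : R -> R * R) (M L : R).
Hypothesis M0 : 0 < M.
Hypothesis cM : lipschitz_coords c M.
Hypothesis L0 : 0 < L.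
Hypothesis cL : shift_periodic c L.

Local Notation leb := (@lebesgue_measure R).
Local Notation TR := (measurableTypeR R).
Local Notation T2 := (measurableTypeR R * measurableTypeR R)%type.

Lemma continuous_profile1 : continuous (fun t => (c t).1).
Proof. by have cc := profile_continuous M0 cM; move=> t; exact: (continuous_comp (cc t) cvg_fst). Qed.

Lemma continuous_profile2 : continuous (fun t => (c t).2).
Proof. by have cc := profile_continuous M0 cM; move=> t; exact: (continuous_comp (cc t) cvg_snd). Qed.

Lemma measurable_comp_profile (G : R * R -> R) : continuous G ->
  measurable_fun setT (fun t : TR => G (c t)).
Proof.
move=> cG; have cc := profile_continuous M0 cM; apply: continuous_measurable_fun => t.
exact: (continuous_comp (cc t) (cG (c t))).
Qed.

Definition fundamental_param : set TR := [set t | 0 <= (c t).1 < 2 * pi].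

Lemma measurable_fundamental_param : measurable fundamental_param.
Proof.
have m1 := continuous_measurable_fun continuous_profile1.
have -> : fundamental_param = (fun t => (c t).1) @^-1` `[0, (2 * pi)[.
  by apply/seteqP; split=> t /=; rewrite in_itv.
by rewrite -[X in measurable X]setTI; apply: m1 => //; exact: measurable_itv.
Qed.

(* Finitely many translates of a fundamental domain cover a bounded interval. *)
Lemma integral_le_fundamental (T : R) : exists2 N : R, 0 <= N &
  forall g : TR -> \bar R, measurable_fun setT g -> (forall t, 0 <= g t)%E ->
    (forall t, g (t + L) = g t) ->
    (\int[leb]_(t in `[(- T)%R, T]) g t <= N%:E * \int[leb]_(t in fundamental_param) g t)%E.
Proof.
(* For [|t| <= T] the first coordinate of [c t] is at most [K] cell widths in modulus, so the shifts
   by [- n] to [n] periods cover the interval. *)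
pose K := (Num.ceil ((`|(c 0).1| + M * T) / (2 * pi))).
have [n Kn] : exists n : nat, K%:~R <= n%:R - 1 :> R.
  exists `|K|%N.+1; rewrite -natr1 addrK -[X in _ <= X]/((`|K|%N%:Z)%:~R) ler_int.
  by rewrite abszE ler_norm.
have [N hN] : exists N, N = n.*2.+1 by exists n.*2.+1.
exists N%:R => // g mg g0 gL.
have gk (k : int) t : g (t + k%:~R * L) = g t.
  have gn (m : nat) u : g (u + m%:R * L) = g u.
    elim: m => [|m ih]; first by rewrite mul0r addr0.
    by rewrite -natr1 mulrDl mul1r addrA gL ih.
  by case: k => m; rewrite ?gn// NegzE mulrNz mulNr -(gn m.+1 (t - _)) subrK.
pose A (i : nat) : set TR := (fun t => t + (i%:Z - n%:Z)%:~R * L) @^-1` fundamental_param.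
have mA i : measurable (A i).
  rewrite /A -[X in measurable X]setTI.
  by apply: measurable_shift => //; exact: measurable_fundamental_param.
have intA i : (\int[leb]_(t in A i) g t = \int[leb]_(t in fundamental_param) g t)%E.
  rewrite -[RHS](@ge0_integral_shift R ((i%:Z - n%:Z)%:~R * L))//.
  - by apply: eq_integral => t _; rewrite gk.
  - exact: measurable_fundamental_param.
  - exact: measurable_funTS.
have cov t : - T <= t <= T -> exists2 i, (i < N)%N & A i t.
  (* [q] numbers the cell containing [c t]. Shifting [t] by [- q] periods leads to the fundamental
     cell, and this is the translate of index [n - q]. *)
  move=> hT; set q := Num.floor ((c t).1 / (2 * pi)).
  have p0 := pi_gt0 R.
  have /andP[q1 q2] := floor_itv ((c t).1 / (2 * pi)); rewrite -/q in q1 q2.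
  have hc : `|(c t).1| <= `|(c 0).1| + M * T.
    have [h1 _] := cM t 0; rewrite subr0 in h1.
    rewrite -[(c t).1](subrK (c 0).1) (le_trans (ler_normD _ _))// addrC lerD2l.
    by rewrite (le_trans h1)// ler_pM2l// ler_norml.
  have K1 : (`|(c 0).1| + M * T) / (2 * pi) <= K%:~R by exact: ceil_ge.
  rewrite ler_pdivrMr in K1; last lra.
  have qK : (- n%:Z <= q <= n%:Z).
    rewrite ler_pdivlMr in q1; last lra.
    rewrite ltr_pdivrMr in q2; last lra.
    move: hc; rewrite ler_norml => /andP[hc1 hc2].
    apply/andP; split.
      have : (- n%:Z)%:~R < (q + 1)%:~R :> R.
        rewrite -(ltr_pM2r (_ : 0 < 2 * pi)); last lra.
        rewrite (le_lt_trans _ q2)// mulrNz.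
        have : K%:~R * (2 * pi) <= (n%:R - 1) * (2 * pi) :> R by rewrite ler_pM2r//; lra.
        rewrite -[n%:~R]/(n%:R : R); lra.
      by rewrite ltr_int ltzD1.
    have : q%:~R <= n%:Z%:~R :> R.
      rewrite -(ler_pM2r (_ : 0 < 2 * pi)); last lra.
      rewrite (le_trans q1)//.
      have : K%:~R * (2 * pi) <= (n%:R - 1) * (2 * pi) :> R by rewrite ler_pM2r//; lra.
      rewrite -[n%:~R]/(n%:R : R); lra.
    by rewrite ler_int.
  exists `|n%:Z - q|%N.
    rewrite -ltz_nat gez0_abs ?subr_ge0; last by case/andP: qK.
    by rewrite hN; case/andP: qK => h1 h2; lia.
  rewrite /A /= gez0_abs ?subr_ge0; last by case/andP: qK.
  rewrite /fundamental_param /= (_ : n%:Z - q - n%:Z = - q); last by ring.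
  rewrite (profile_shift cL) /= mulrNz.
  rewrite ler_pdivlMr in q1; last lra.
  rewrite ltr_pdivrMr in q2; last lra.
  by move: q2; rewrite intrD => q2; apply/andP; split; lra.
apply: (@le_trans _ _ (\int[leb]_t (\sum_(i <- iota 0 N) (g \_ (A i)) t))%E).
  rewrite integral_mkcond; apply: ge0_le_integral => //.
  - by move=> t _; rewrite patchE; case: ifP.
  - by apply/(measurable_restrictT _ _).1 => //; exact: measurable_funTS.
  - apply: emeasurable_sum => i; apply/(measurable_restrictT _ _).1 => //.
    exact: measurable_funTS.
  - move=> t _; rewrite patchE; case: ifP; last first.
      by move=> _; apply: sume_ge0 => i _; rewrite patchE; case: ifP.
    rewrite inE /= in_itv /= => /cov[i ilt Ait].
    rewrite (bigD1_seq i) ?iota_uniq ?mem_iota//= patchE mem_set// leeDl//.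
    by apply: sume_ge0 => k _; rewrite patchE; case: ifP.
rewrite ge0_integral_sum//; last 2 first.
- by move=> i; apply/(measurable_restrictT _ _).1 => //; exact: measurable_funTS.
- by move=> i t _; rewrite patchE; case: ifP.
rewrite (eq_bigr (fun=> \int[leb]_(t in fundamental_param) g t)%E); last first.
  by move=> i _; rewrite -integral_mkcond intA.
rewrite big_const_seq count_predT size_iota.
set I := (\int[leb]_(t in fundamental_param) g t)%E.
have -> // : iter N (+%E I) 0%E = (N%:R%:E * I)%E.
elim: N {hN cov} => [|N ih] /=; first by rewrite mul0e.
by rewrite ih -natr1 EFinD ge0_muleDl// mul1e addeC.
Qed.

(* The average over [s] of the indicator of [near (x, s)] dominates that of the tube of radius [h]
   around the profile; Tonelli then bounds integrals over the tube. *)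
Lemma tube_integral (T : R) : (forall t, `|(c t).1| <= 2 * pi + 1 -> `|t| <= T - 1) ->
  forall (G : R * R -> R) (lip h : R) (D : T2 -> R), 0 < h <= 1 -> 0 <= lip -> continuous G ->
  (forall x y, `|G x - G y| <= lip * (`|x.1 - y.1| + `|x.2 - y.2|)) ->
  measurable_fun setT D -> (forall x, 0 <= D x <= `|G x|) ->
  (forall x : R * R, D x != 0 -> exists t, `|x.1 - (c t).1| <= h /\ `|x.2 - (c t).2| <= h) ->
  (\int[plane_measure R]_(x in @strip R) (D x)%:E <=
   (4 * (M + 1) ^+ 2 * h)%:E *
   \int[leb]_(t in `[(- T)%R, T]) (`|G (c t)| + 2 * lip * (M + 1) * h)%:E)%E.
Proof.
move=> hT G lip h D /andP[h0 h1] lip0 cG hG mD D0 hD.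
(* A point within [h] of [c t] is within [h + M * h] of [c s] whenever [|t - s| <= h]. *)
pose k := (M + 1) * h.
have k0 : 0 < k by rewrite mulr_gt0// addr_gt0.
pose near (z : (R * R) * R) := [&& `|z.2| <= T, `|z.1.1 - (c z.2).1| <= k & `|z.1.2 - (c z.2).2| <= k].
pose v (s : TR) : R := `|G (c s)| + 2 * lip * k.
have v0 s : 0 <= v s by rewrite /v addr_ge0// (mulr_ge0 (mulr_ge0 _ _) (ltW k0)).
pose Phi (z : T2 * TR) : \bar R := ((if near z then v z.2 else 0)%:E).
have mv : measurable_fun setT v.
  apply: measurable_funD => //; apply: measurableT_comp => //.
  exact: measurable_comp_profile.
have mc1 : measurable_fun setT (fun z : T2 * TR => (c z.2).1).
  exact: (measurableT_comp (continuous_measurable_fun continuous_profile1) (measurable_snd)).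
have mc2 : measurable_fun setT (fun z : T2 * TR => (c z.2).2).
  exact: (measurableT_comp (continuous_measurable_fun continuous_profile2) (measurable_snd)).
have mnear : measurable_fun setT (near : T2 * TR -> bool).
  apply: measurable_and; [|apply: measurable_and]; apply: measurable_fun_ler => //;
    apply: measurableT_comp => //; apply: measurable_funB => //.
  - exact: (measurableT_comp measurable_fst measurable_fst).
  - exact: (measurableT_comp measurable_snd measurable_fst).
have mPhi : measurable_fun setT Phi.
  apply/measurable_EFinP; apply: measurable_fun_ifT => //.
  exact: (measurableT_comp mv measurable_snd).
have Phi0 z : (0 <= Phi z)%E by rewrite /Phi lee_fin; case: ifP.
(* A point of the tube is near [c s] for every [s] in an interval [[t, t + h]], whose length is the
   factor on the left. The slack in [T - 1] keeps this interval inside [[- T, T]]. *)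
have low (x : R * R) : @strip R x -> (h%:E * (D x)%:E <= \int[leb]_s Phi (x, s))%E.
  move=> sx; have [->|Dx] := eqVneq (D x) 0; first by rewrite mule0; exact: integral_ge0.
  have [t [t1 t2]] := hD x Dx.
  have tT : `|t| <= T - 1.
    apply: hT; rewrite -[(c t).1](subKr x.1) (le_trans (ler_normB _ _))//.
    move: sx => /andP[x1 x2]; rewrite (ger0_norm (ltW x1)); lra.
  have tn : -(T - 1) <= t <= T - 1 by rewrite -ler_norml.
  have hn s : `[t, t + h]%classic s -> near (x, s) /\ `|G x| <= v s.
    rewrite /= in_itv /= => /andP[s1 s2].
    have st : `|t - s| <= h by rewrite ler_norml; lra.
    have [e1 e2] := cM t s.
    have Mst : M * `|t - s| <= M * h by rewrite ler_pM2l.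
    have b1 : `|x.1 - (c s).1| <= k by have := ler_distD (c t).1 x.1 (c s).1; rewrite /k; lra.
    have b2 : `|x.2 - (c s).2| <= k by have := ler_distD (c t).2 x.2 (c s).2; rewrite /k; lra.
    split.
      apply/and3P; split => //=; rewrite ler_norml; lra.
    have := hG x (c s).
    have : lip * (`|x.1 - (c s).1| + `|x.2 - (c s).2|) <= lip * (k + k).
      by rewrite ler_wpM2l// lerD.
    rewrite /v => a1 a2.
    have := ler_normD (G x - G (c s)) (G (c s)); rewrite subrK; lra.
  have a1 : (h%:E * (D x)%:E <= \int[leb]_(s in `[t, (t + h)%R]) (`|G x|%:E))%E.
    rewrite integral_cst//= lebesgue_measure_itv/= lte_fin ltrDl h0 -EFinD addrAC subrr add0r.
    by rewrite muleC -!EFinM lee_fin ler_pM2r//; have /andP[] := D0 x.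
  have mPx : measurable_fun setT (fun s => Phi (x, s)) by exact: (measurableT_comp mPhi (measurable_pair1 x)).
  have a2 : (\int[leb]_(s in `[t, (t + h)%R]) (`|G x|%:E) <= \int[leb]_(s in `[t, (t + h)%R]) Phi (x, s))%E.
    apply: ge0_le_integral => //.
    - exact: measurable_funTS.
    - by move=> s /hn[ns Gv]; rewrite /Phi ns lee_fin.
  have a3 : (\int[leb]_(s in `[t, (t + h)%R]) Phi (x, s) <= \int[leb]_s Phi (x, s))%E.
    exact: ge0_subset_integral.
  exact: (le_trans a1 (le_trans a2 a3)).
have tonelli := fubini_plane_line mPhi Phi0.
(* For fixed [s] the points near [c s] fill a square of side [2 * k]. *)
have inner s : (\int[plane_measure R]_x Phi (x, s) =
    (4 * k ^+ 2)%:E * ((fun s => (v s)%:E) \_ `[(- T)%R, T]) s)%E.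
  rewrite patchE; case: ifPn => sT; last first.
    rewrite mule0; apply: integral0_eq => x _; rewrite /Phi /near /=.
    by move: sT; rewrite notin_setE /= in_itv /= -ler_norml => /negP/negbTE ->.
  pose B : set T2 := `[(c s).1 - k, (c s).1 + k]%classic `*` `[(c s).2 - k, (c s).2 + k]%classic.
  have mB : measurable B by exact: measurableX.
  transitivity (\int[plane_measure R]_(x in B) (v s)%:E)%E.
    rewrite [RHS]integral_mkcond; apply: eq_integral => x _; rewrite /Phi /near /patch /=.
    have -> : `|s| <= T by move: sT; rewrite inE /= in_itv /= ler_norml.
    have -> : (x \in B) = (`|x.1 - (c s).1| <= k) && (`|x.2 - (c s).2| <= k).
      apply/idP/idP; rewrite inE /B /= !in_itv /= !ler_distl.
        by move=> [-> ->].
      by move=> /andP[-> ->].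
    by rewrite andTb; case: ifP.
  rewrite integral_cst// muleC; congr (_ * _)%E.
  rewrite plane_measureX// !lebesgue_measure_itv/= !lte_fin.
  rewrite !ifT; [|lra|lra].
  by rewrite -!EFinD -EFinM; congr EFin; ring.
have e0 : (h%:E * \int[plane_measure R]_(x in @strip R) (D x)%:E <=
   (4 * k ^+ 2)%:E * \int[leb]_(s in `[(- T)%R, T]) (v s)%:E)%E.
  rewrite -ge0_integralZl//; last 4 first.
  - exact: measurable_strip.
  - by apply/measurable_EFinP; exact: measurable_funTS.
  - by move=> x _; rewrite lee_fin; have /andP[] := D0 x.
  - by rewrite lee_fin ltW.
  apply: (@le_trans _ _ (\int[plane_measure R]_x \int[leb]_s Phi (x, s))%E).
    apply: (@le_trans _ _ (\int[plane_measure R]_(x in @strip R) \int[leb]_s Phi (x, s))%E).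
      apply: ge0_le_integral => //.
      - exact: measurable_strip.
      - by move=> x _; rewrite mule_ge0// lee_fin ?(ltW h0)//; have /andP[] := D0 x.
      - apply: measurable_funeM; apply/measurable_EFinP; exact: measurable_funTS.
      - by apply: measurable_funTS; exact: (measurable_fun_fubini_tonelli_F (m2 := leb) Phi).
    apply: ge0_subset_integral => //.
    - exact: measurable_strip.
    - exact: (measurable_fun_fubini_tonelli_F (m2 := leb) Phi).
    - by move=> x _; exact: integral_ge0.
  rewrite [X in (X <= _)%E]tonelli.
  under eq_integral do rewrite inner.
  rewrite ge0_integralZl//; last 3 first.
  - by apply/(measurable_restrictT _ _).1 => //; apply/measurable_EFinP; exact: measurable_funTS.
  - by move=> s _; rewrite patchE; case: ifP => // _; rewrite lee_fin.
  - by rewrite lee_fin mulr_ge0// sqr_ge0.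
  by rewrite -integral_mkcond.
rewrite -(@lee_pmul2l _ h%:E)// muleA -EFinM.
have -> : h * (4 * (M + 1) ^+ 2 * h) = 4 * k ^+ 2 by rewrite /k; ring.
suff -> : (\int[leb]_(t in `[(- T)%R, T]) (`|G (c t)| + 2 * lip * (M + 1) * h)%:E =
    \int[leb]_(t in `[(- T)%R, T]) (v t)%:E)%E by [].
by apply: eq_integral => s _; rewrite /v /k mulrA.
Qed.

End tube.

(** * Green's inequality *)

Section green.
Context (R : realType) (c : R -> R * R) (M L b : R).
Hypothesis M0 : 0 < M.
Hypothesis cM : lipschitz_coords c M.
Hypothesis L0 : 0 < L.
Hypothesis cL : shift_periodic c L.

Local Notation leb := (@lebesgue_measure R).
Local Notation TR := (measurableTypeR R).
Local Notation T2 := (measurableTypeR R * measurableTypeR R)%type.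
Local Notation O := (above c).

Definition half_domain : set T2 := above c `&` [set x : R * R | x.2 < b].
Definition cell_domain : set T2 := half_domain `&` [set x : R * R | 0 < x.1 < 2 * pi].

Lemma measurable_above : measurable (O : set T2).
Proof. apply: open_measurable_plane; exact: (above_open M0 cM L0 cL). Qed.

Lemma open_half_domain : open (half_domain : set (R * R)).
Proof.
apply: openI; first exact: (above_open M0 cM L0 cL).
apply: (@open_comp _ _ (fun x : R * R => x.2) [set y | y < b]); last exact: open_lt.
by move=> x _; exact: cvg_snd.
Qed.

Lemma measurable_half_domain : measurable half_domain.
Proof. apply: open_measurable_plane; exact: open_half_domain. Qed.

Lemma measurable_cell_domain : measurable cell_domain.
Proof. by apply: measurableI; [exact: measurable_half_domain|exact: measurable_strip]. Qed.

Lemma cell_domain_box : exists m : R, cell_domain `<=` [set x | m <= x.2].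
Proof.
have [m hm] := above_bounded_below M0 cM L0 cL.
by exists m => x [[/hm]].
Qed.

Definition box (m : R) : set T2 := `]0, (2 * pi)[%classic `*` `[m, b]%classic.

Lemma measurable_box (m : R) : measurable (box m) /\ (plane_measure R (box m) < +oo)%E.
Proof.
split; first exact: measurableX.
rewrite /box plane_measureX// !lebesgue_measure_itv/=.
by do 2 case: ifP => _; rewrite ?mule0 ?mul0e ?ltry// -!EFinD -EFinM ltry.
Qed.

Lemma cell_domain_finite : (plane_measure R cell_domain < +oo)%E.
Proof.
have [m hm] := cell_domain_box; have [mB fB] := measurable_box m.
apply: le_lt_trans fB; apply: le_measure; rewrite ?inE//.
  exact: measurable_cell_domain.
move=> x xD; have := hm _ xD; case: xD => -[_ /= x2] x1 mx2.
by split; rewrite /= in_itv //= mx2 ltW.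
Qed.

Lemma integrable_strip (m K : R) (q : T2 -> R) : measurable_fun setT q ->
  (forall x, `|q x| <= K) -> (forall x : R * R, q x != 0 -> m <= x.2 <= b) ->
  (plane_measure R).-integrable (@strip R) (EFin \o q).
Proof.
move=> mq qK qb; have [mB fB] := measurable_box m.
set B := box m in mB fB.
rewrite integrable_mkcond; last exact: measurable_strip.
have -> : (EFin \o q) \_ (@strip R) = (EFin \o q) \_ B.
  apply/funext => -[x y]; rewrite !patchE /=.
  have [->|q0] := eqVneq (q (x, y)) 0; first by do 2 case: ifP.
  have hy := qb (x, y) q0.
  suff -> : ((x, y) \in @strip R) = ((x, y) \in B) by [].
  apply: asbool_equiv_eq; split => /=; first by move=> h; split; rewrite /= in_itv.
  by move=> [/=]; rewrite in_itv.
rewrite -integrable_mkcond//.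
apply: measurable_bounded_integrable => //; first exact: measurable_funTS.
exists K; split; first exact: num_real.
by move=> y Ky x _ /=; rewrite (le_trans (qK x))// ltW.
Qed.

Section green_inequality.
Variables (G : R * R -> R) (lip : R).
Hypothesis lip0 : 0 <= lip.
Hypothesis G_lip : forall x y, `|G x - G y| <= lip * (`|x.1 - y.1| + `|x.2 - y.2|).
Hypothesis G_per : forall x, G (x.1 + 2 * pi, x.2) = G x.
Hypothesis G_top : forall x, b <= x.2 -> G x = 0.

Lemma lip_continuous : continuous G.
Proof.
move=> x; apply/cvgrPdist_lt => e e0; apply/nbhs2P.
have l1 : 0 < 2 * (lip + 1) by rewrite mulr_gt0// ltr_wpDl.
exists (e / (2 * (lip + 1))); first by rewrite divr_gt0.
move=> y h1 h2; rewrite (le_lt_trans (G_lip x y))//.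
have h3 : `|x.1 - y.1| + `|x.2 - y.2| < 2 * (e / (2 * (lip + 1))) by lra.
have h4 : 2 * (e / (2 * (lip + 1))) * (lip + 1) = e by field; lra.
have h5 : (`|x.1 - y.1| + `|x.2 - y.2|) * (lip + 1) < e by rewrite -h4 ltr_pM2r//; lra.
have : 0 <= `|x.1 - y.1| + `|x.2 - y.2| by rewrite addr_ge0.
lra.
Qed.

Lemma measurable_lip : measurable_fun setT (G : T2 -> R).
Proof. apply: continuous_measurable_plane; exact: lip_continuous. Qed.

Definition step (j : bool) (h : R) : R * R := if j then (0, h) else (h, 0).

(* By periodicity the translated and the original integrals of [G] over the domain agree; what
   remains is the integral over points [x] separated by the profile from [x + v]. *)
Lemma step_flux (m T : R) (j : bool) (h : R) : (forall x, O x -> m <= x.2) ->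
  (forall t, `|(c t).1| <= 2 * pi + 1 -> `|t| <= T - 1) -> 0 < h <= 1 ->
  (`|\int[plane_measure R]_(x in cell_domain)
      (G (x.1 + (step j h).1, x.2 + (step j h).2) - G x)|%:E <=
   (4 * (M + 1) ^+ 2 * h)%:E *
   \int[leb]_(t in `[(- T)%R, T]) (`|G (c t)| + 2 * lip * (M + 1) * h)%:E)%E.
Proof.
move=> hm hT /andP[h0 h1]; have [v hv] : exists v, v = step j h by exists (step j h).
rewrite -hv.
have v1 : 0 <= v.1 <= 1 by rewrite hv /step; case: (j) => /=; lra.
have v2 : 0 <= v.2 <= 1 by rewrite hv /step; case: (j) => /=; lra.
have vh : `|v.1| <= h /\ `|v.2| <= h.
  by rewrite hv /step; case: (j) => /=; rewrite normr0 (gtr0_norm h0) lexx ltW.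
have p2 := pi_ge2 R.
pose ind (x : T2) : R := \1_O x.
(* [f] carries the indicator of the domain moved by [v]. Thus [f (x + v) - g x] is the increment of
   [G] on the domain, while [f - g] lives on the symmetric difference of the domain and its
   translate. *)
pose f (x : T2) : R := ind (x.1 - v.1, x.2 - v.2) * G x.
pose g (x : T2) : R := ind x * G x.
have mG := measurable_lip.
have mi : measurable_fun setT ind by apply: measurable_indic; exact: measurable_above.
have mf : measurable_fun setT f.
  apply: measurable_funM => //.
  exact: (measurableT_comp mi (measurable_translate (- v.1, - v.2))).
have mg : measurable_fun setT g by exact: measurable_funM.
have ind01 x : `|ind x| <= 1 by rewrite /ind indicE; case: (_ \in _); rewrite ?normr1 ?normr0.
have indO x : ind x != 0 -> O x.
  by rewrite /ind indicE; case: (boolP (x \in (O : set T2))) => [/set_mem//|_]; rewrite eqxx.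
have G0 x : G x != 0 -> x.2 < b by rewrite ltNge; apply: contra => /G_top ->.
have Gb (x : R * R) : m <= x.2 -> `|G x| <= lip * `|b - m|.
  move=> mx; have [bx|xb] := leP b x.2.
    by rewrite G_top// normr0 mulr_ge0.
  have := G_lip x (x.1, b); rewrite /= subrr normr0 add0r (@G_top (x.1, b))//= subr0.
  move=> /le_trans; apply; rewrite ler_wpM2l// ler0_norm ?ger0_norm; lra.
have fK x : `|f x| <= lip * `|b - m|.
  have [|i0] := eqVneq (ind (x.1 - v.1, x.2 - v.2)) 0.
    by rewrite /f => ->; rewrite mul0r normr0 mulr_ge0.
  have /hm /= mx := indO _ i0.
  rewrite /f normrM -[leRHS]mul1r ler_pM//; apply: Gb; lra.
have gK x : `|g x| <= lip * `|b - m|.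
  have [|i0] := eqVneq (ind x) 0; first by rewrite /g => ->; rewrite mul0r normr0 mulr_ge0.
  by rewrite /g normrM -[leRHS]mul1r ler_pM//; apply: Gb; exact/hm/indO.
have fS (x : R * R) : f x != 0 -> m <= x.2 <= b.
  rewrite mulf_eq0 negb_or => /andP[/indO/hm /= h2 /G0 h3]; lra.
have gS (x : R * R) : g x != 0 -> m <= x.2 <= b.
  rewrite mulf_eq0 negb_or => /andP[/indO/hm /= h2 /G0 h3]; lra.
have intf := integrable_strip mf fK fS.
have intg := integrable_strip mg gK gS.
have f_per x : f (x.1 + 2 * pi, x.2) = f x.
  rewrite /f /= G_per; congr (_ * _); rewrite /ind !indicE; congr ((_ : bool)%:R).
  apply: asbool_equiv_eq => /=.
  by rewrite -(above_shift cL (x.1 - v.1, x.2 - v.2)) /= addrAC.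
have fv : \int[plane_measure R]_(x in @strip R) f (x.1 + v.1, x.2 + v.2) =
          \int[plane_measure R]_(x in @strip R) f x.
  by apply: Rintegral_strip_translate => //; lra.
have mfv : measurable_fun setT (fun x : T2 => f (x.1 + v.1, x.2 + v.2)).
  exact: (measurableT_comp mf (measurable_translate v)).
have intfv : (plane_measure R).-integrable (@strip R) (EFin \o (fun x => f (x.1 + v.1, x.2 + v.2))).
  apply: (@integrable_strip (m - 1) (lip * `|b - m|)) => //.
  by move=> x /fS /=; lra.
(* By [fv] the translate of [f] may be replaced by [f]. Points at height [b] or more contribute
   nothing, because [v.2] is nonnegative and [G] vanishes there. *)
have e1 : \int[plane_measure R]_(x in cell_domain) (G (x.1 + v.1, x.2 + v.2) - G x) =
    \int[plane_measure R]_(x in @strip R) (f x - g x).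
  rewrite [RHS](RintegralB (@measurable_strip R) intf intg) -fv.
  rewrite -(RintegralB (@measurable_strip R) intfv intg).
  rewrite Rintegral_mkcond [RHS]Rintegral_mkcond; apply: eq_Rintegral => -[x1 x2] _.
  rewrite !patchE /f /g /= !addrK.
  have [xs|xs] := boolP ((x1, x2) \in @strip R); last first.
    by rewrite ifF//; apply/negP; rewrite inE => -[_]; move: xs; rewrite notin_setE.
  have [xD|xD] := boolP ((x1, x2) \in cell_domain).
    have xO : O (x1, x2) by move: xD; rewrite inE => -[[]].
    by rewrite /ind indicE mem_set// !mul1r.
  have [xO|xO] := boolP ((x1, x2) \in (O : set T2)); last first.
    by rewrite /ind indicE (negbTE xO) !mul0r subr0.
  have xb : b <= x2.
    rewrite leNgt; apply/negP => xb; move: xD; rewrite notin_setE; apply.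
    by split; [split => //; exact: set_mem|exact: set_mem].
  by rewrite !G_top ?mulr0 ?subr0//=; lra.
pose D x := `|f x - g x|.
have mD : measurable_fun setT D.
  by apply: measurableT_comp => //; exact: measurable_funB.
rewrite e1; apply: (@le_trans _ _ (\int[plane_measure R]_(x in @strip R) (D x)%:E)%E).
  have intfg : (plane_measure R).-integrable (@strip R) (EFin \o (fun x => f x - g x)).
    apply: eq_integrable (integrableB (@measurable_strip R) intf intg) => //.
    exact: measurable_strip.
  rewrite (EFin_normr_Rintegral (@measurable_strip R) intfg).
  exact: (le_abse_integral _ (@measurable_strip R) (measurable_int (plane_measure R) intfg)).
apply: (tube_integral M0 cM hT (D := D)) => //.
- by rewrite h0.
- exact: lip_continuous.
- move=> x; rewrite /D normr_ge0 /f /g -mulrBl normrM -[leRHS]mul1r ler_wpM2r//.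
  by rewrite /ind !indicE; do 2 case: (_ \in _); rewrite ?subrr ?subr0 ?sub0r ?normrN ?normr1 ?normr0.
(* If no point of the profile is within [h] of [x], the segment from [x] to [x - v] avoids it. Its
   two ends are then both inside or both outside the domain, and [D x] is 0. *)
- move=> x Dx; apply: contrapT => /forallNP nt.
  have segr (y : R * R) : (exists2 u, 0 <= u <= 1 & y = (x.1 - u * v.1, x.2 - u * v.2)) -> ~ range c y.
    move=> [u /andP[u0 u1] ->] [t _ ct]; apply: (nt t); rewrite ct /= !opprB ![x.1 + _]addrC ![x.2 + _]addrC !subrK.
    rewrite !normrM (ger0_norm u0); have [w1 w2] := vh.
    by split; [apply: le_trans w1|apply: le_trans w2]; rewrite ler_piMl.
  have OO : O x <-> O (x.1 - v.1, x.2 - v.2).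
    split=> Ox; apply: (above_seg Ox) => u u01; apply: segr.
      by exists u => //; rewrite /seg /=; congr pair; ring.
    by exists (1 - u); [lra|rewrite /seg /=; congr pair; ring].
  move: Dx; rewrite /D /f /g -mulrBl /ind !indicE.
  suff -> : ((x.1 - v.1, x.2 - v.2) \in (O : set T2)) = (x \in (O : set T2)).
    by rewrite subrr mul0r normr0 eqxx.
  by apply: asbool_equiv_eq; rewrite OO.
Qed.

End green_inequality.

Lemma cvg_difference_quotient (G : R * R -> R) (h : nat -> R) j x :
  (forall n, 0 < h n) -> h @ \oo --> (0 : R) -> derivable G x (basis2 R j) ->
  (fun n => (G (x.1 + (step j (h n)).1, x.2 + (step j (h n)).2) - G x) / h n)
    @ \oo --> pd j G x.
Proof.
move=> h0 hc dG; have /cvg_ex[l hl] := dG.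
have -> : pd j G x = l by apply/cvg_lim.
have hd : h @ \oo --> (0 : R)^'.
  move=> A hA; have hh : \forall n \near \oo, h n != 0 -> A (h n) := hc _ hA.
  rewrite -[nbhs _ _]/(\forall n \near \oo, A (h n)).
  by apply: filterS hh => n; apply; rewrite gt_eqF//; exact: h0.
apply: cvg_trans (cvg_comp _ _ hd hl); apply: near_eq_cvg; near=> n.
rewrite /= mulrC; congr (_ * (G _ - _)).
rewrite /step /basis2; case: (j); apply/pair_equal_spec; split=> /=;
  rewrite /GRing.scale /= ?mulr0 ?mulr1 ?add0r ?addr0//; by rewrite addrC.
Unshelve. all: by end_near. Qed.

Lemma fundamental_param_bounded : exists2 T : R, 0 < T & fundamental_param c `<=` `[-T, T]%classic.
Proof.
have [T T0 hT] := profile_proper M0 cM L0 cL (2 * pi).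
exists T => // t /andP[t0 t1]; rewrite /= in_itv /= -ler_norml; apply: hT.
by rewrite ger0_norm// ltW.
Qed.

Lemma fundamental_param_finite : (leb (fundamental_param c) < +oo)%E.
Proof.
have [T T0 hT] := fundamental_param_bounded.
apply: (@le_lt_trans _ _ (leb `[-T, T]%classic)).
  apply: le_measure => //; rewrite inE//; exact: (measurable_fundamental_param M0 cM).
by rewrite lebesgue_measure_itv/=; case: ifP => _; rewrite ?ltry// -EFinD ltry.
Qed.

(** [step_flux] divided by [h] yields this in the limit: the difference quotients are dominated by
    [lip], and the term with [lip] on the right carries a factor [h]. It matters that [C] is
    independent of [lip], as smooth approximations of an H^1 function have no common Lipschitz
    constant. *)
Lemma green_inequality : exists2 C : R, 0 <= C & forall (G : R * R -> R) (lip : R) (j : bool),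
  0 <= lip -> (forall x y, `|G x - G y| <= lip * (`|x.1 - y.1| + `|x.2 - y.2|)) ->
  (forall x, G (x.1 + 2 * pi, x.2) = G x) -> (forall x, b <= x.2 -> G x = 0) ->
  (forall x, cell_domain x -> derivable G x (basis2 R j)) ->
  `|\int[plane_measure R]_(x in cell_domain) pd j G x| <=
    C * \int[leb]_(t in fundamental_param c) `|G (c t)|.
Proof.
have [T0 T00 hT0] := profile_proper M0 cM L0 cL (2 * pi + 1).
have [N N0 hN] := integral_le_fundamental M0 cM L0 cL (T0 + 1).
have [m hm] := above_bounded_below M0 cM L0 cL.
have [B B0 hB] := profile_height M0 cM L0 cL.
exists (4 * (M + 1) ^+ 2 * N); first by rewrite mulr_ge0// mulr_ge0// sqr_ge0.
move=> G lip j lip0 hG Gper Gtop dG.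
set C := 4 * _ * N; have C0 : 0 <= C by rewrite mulr_ge0// mulr_ge0// sqr_ge0.
have mF := measurable_fundamental_param M0 cM.
have fF := fundamental_param_finite.
have mW := measurable_cell_domain.
have fW := cell_domain_finite.
have mG := measurable_lip lip0 hG.
have mGc : measurable_fun setT (fun t : TR => `|G (c t)|).
  apply: measurableT_comp => //; apply: (measurable_comp_profile M0 cM).
  exact: (lip_continuous lip0 hG).
have Gc t : `|G (c t)| <= lip * (B + `|b|).
  have := hG (c t) ((c t).1, b); rewrite /= subrr normr0 add0r (Gtop (_, b))//= subr0.
  move=> /le_trans; apply; rewrite ler_wpM2l// (le_trans (ler_normB _ _))//.
  by rewrite lerD2r.
have intA : leb.-integrable (fundamental_param c) (EFin \o (fun t => `|G (c t)|)).
  apply: measurable_bounded_integrable => //; first exact: measurable_funTS.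
  exists (lip * (B + `|b|)); split; first exact: num_real.
  by move=> y Ky t _ /=; rewrite normr_id (le_trans (Gc t))// ltW.
set A := \int[leb]_(t in _) _.
pose k := 2 * lip * (M + 1); pose l := fine (leb (fundamental_param c)).
have [h [h01 hc]] : exists h : nat -> R, (forall n, 0 < h n <= 1) /\ h @ \oo --> (0 : R).
  exists harmonic; split; last exact: cvg_harmonic.
  by move=> n; rewrite /= invr_gt0 ltr0n /= invf_le1 ?ltr0n// ler1n.
pose dq n (x : R * R) : R := (G (x.1 + (step j (h n)).1, x.2 + (step j (h n)).2) - G x) / h n.
have dq_lip n x : `|dq n x| <= lip.
  have /andP[h0 _] := h01 n.
  rewrite /dq normrM normrV ?unitfE ?gt_eqF// (gtr0_norm h0) ler_pdivrMr//.
  rewrite (le_trans (hG _ _))// ler_wpM2l//= addrAC subrr add0r addrAC subrr add0r.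
  by rewrite /step; case: (j) => /=; rewrite normr0 ?add0r ?addr0 gtr0_norm.
have mdelta n : measurable_fun setT (fun x : T2 =>
    G (x.1 + (step j (h n)).1, x.2 + (step j (h n)).2) - G x).
  by apply: measurable_funB => //; exact: (measurableT_comp mG (measurable_translate _)).
have mdq n : measurable_fun setT (dq n : T2 -> R) by apply: measurable_funM.
have int_bd (q : T2 -> R) (K : R) : measurable_fun cell_domain q ->
    (forall x, cell_domain x -> `|q x| <= K) ->
    (plane_measure R).-integrable cell_domain (EFin \o q).
  move=> mq qK; apply: measurable_bounded_integrable => //.
  exists K; split; first exact: num_real.
  by move=> y Ky x xD /=; rewrite (le_trans (qK x xD))// ltW.
have bound n : `|\int[plane_measure R]_(x in cell_domain) dq n x| <= C * (A + k * l * h n).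
  have /andP[h0 h1] := h01 n.
  have id : (plane_measure R).-integrable cell_domain (EFin \o (fun x : T2 =>
      G (x.1 + (step j (h n)).1, x.2 + (step j (h n)).2) - G x)).
    apply: (@int_bd _ (lip * h n)); first exact: measurable_funTS.
    move=> x _; have := dq_lip n x; rewrite /dq normrM normrV ?unitfE ?gt_eqF//.
    by rewrite (gtr0_norm h0) ler_pdivrMr.
  rewrite /dq RintegralZr// normrM normrV ?unitfE ?gt_eqF// (gtr0_norm h0) ler_pdivrMr//.
  rewrite -lee_fin.
  have hT t : `|(c t).1| <= 2 * pi + 1 -> `|t| <= T0 + 1 - 1 by rewrite addrK; exact: hT0.
  have := step_flux lip0 hG Gper Gtop j hm hT (h01 n).
  move=> /le_trans; apply.
  have kh0 : 0 <= 2 * lip * (M + 1) * h n.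
    by rewrite (mulr_ge0 (mulr_ge0 (mulr_ge0 _ _) _) (ltW h0))// addr_ge0// ltW.
  have e1 : (\int[leb]_(t in fundamental_param c) (`|G (c t)| + 2 * lip * (M + 1) * h n)%:E =
      (A + k * l * h n)%:E)%E.
    under eq_integral do rewrite EFinD.
    rewrite ge0_integralD//; last by apply/measurable_EFinP; exact: measurable_funTS.
    rewrite integral_cst//= EFinD /A /Rintegral fineK; last exact: integrable_fin_num.
    congr (_ + _)%E; rewrite -[leb _]fineK; last by rewrite ge0_fin_numE.
    by rewrite -EFinM; congr EFin; rewrite /k /l; ring.
  apply: (@le_trans _ _ ((4 * (M + 1) ^+ 2 * h n)%:E * (N * (A + k * l * h n))%:E)%E).
    apply: lee_wpmul2l; first by rewrite lee_fin mulr_ge0 ?(ltW h0)// mulr_ge0// sqr_ge0.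
    rewrite EFinM -e1; apply: hN.
    - by apply/measurable_EFinP; exact: measurable_funD.
    - by move=> t; rewrite lee_fin addr_ge0.
    - by move=> t; rewrite cL Gper.
  by rewrite -EFinM lee_fin /C le_eqVlt; apply/orP; left; apply/eqP; ring.
have mpd : measurable_fun cell_domain (pd j G : T2 -> R).
  apply: (@measurable_fun_cvg _ _ _ cell_domain (fun n => dq n : T2 -> R)).
    by move=> n; exact: measurable_funTS.
  by move=> x xD; apply: cvg_difference_quotient => //; [move=> n; have /andP[] := h01 n|exact: dG].
have cvgI : \int[plane_measure R]_(x in cell_domain) dq n x @[n --> \oo] -->
    \int[plane_measure R]_(x in cell_domain) pd j G x.
  have [] := @dominated_convergence _ _ _ (plane_measure R) cell_domain mW
    (fun n x => (dq n x)%:E) (fun x => (pd j G x)%:E) (cst lip%:E).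
  - by move=> n; apply/measurable_EFinP; exact: measurable_funTS.
  - exact/measurable_EFinP.
  - apply: aeW => x xD; apply: cvg_EFin; first exact: nearW.
    by apply: cvg_difference_quotient => //; [move=> n; have /andP[] := h01 n|exact: dG].
  - by apply: (int_bd (cst lip)); [exact: measurable_cst|move=> x _ /=; rewrite ger0_norm].
  - by apply: aeW => x n _; rewrite lee_fin.
  move=> ipd _ hI; apply: fine_cvg.
  rewrite /Rintegral fineK; last exact: integrable_fin_num.
  exact: hI.
have cvgB : C * (A + k * l * h n) @[n --> \oo] --> C * A.
  rewrite -[X in _ --> C * X]addr0 -[X in _ --> C * (A + X)](mulr0 (k * l)).
  apply: cvgM; first exact: cvg_cst.
  by apply: cvgD; [exact: cvg_cst|apply: cvgM; [exact: cvg_cst|exact: hc]].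
apply: (ler_cvg_to _ cvgB); last by near=> n; exact: bound.
exact: cvg_norm.
Unshelve. all: by end_near. Qed.

End green.

(** * Continuously differentiable functions of the plane *)

Section c1.
Context (R : realType).
Implicit Types (F : R * R -> R) (j : bool).

Definition C1 F := forall j, continuous (pd j F) /\ forall x, derivable F x (basis2 R j).

Lemma is_derive_line1 F (x : R * R) (d : R) :
  is_derive x.1 1 (fun s => F (s, x.2)) d <-> is_derive x (basis2 R false) F d.
Proof.
case: x => x1 x2 /=.
have e : (fun h : R => h^-1 *: (((fun s => F (s, x2)) \o shift x1) (h *: 1) - F (x1, x2))) =
    (fun h : R => h^-1 *: ((F \o shift (x1, x2)) (h *: basis2 R false) - F (x1, x2))).
  apply/funext => h; congr (_ *: (F _ - _)); apply/pair_equal_spec; split=> //=.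
  by rewrite /GRing.scale /= mulr0 add0r.
by split=> -[d1 d2]; split; [rewrite /derivable -e|rewrite /derive -e|rewrite /derivable e|rewrite /derive e].
Qed.

Lemma is_derive_line2 F (x : R * R) (d : R) :
  is_derive x.2 1 (fun s => F (x.1, s)) d <-> is_derive x (basis2 R true) F d.
Proof.
case: x => x1 x2 /=.
have e : (fun h : R => h^-1 *: (((fun s => F (x1, s)) \o shift x2) (h *: 1) - F (x1, x2))) =
    (fun h : R => h^-1 *: ((F \o shift (x1, x2)) (h *: basis2 R true) - F (x1, x2))).
  apply/funext => h; congr (_ *: (F _ - _)); apply/pair_equal_spec; split=> //=.
  by rewrite /GRing.scale /= mulr0 add0r.
by split=> -[d1 d2]; split; [rewrite /derivable -e|rewrite /derive -e|rewrite /derivable e|rewrite /derive e].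
Qed.

Lemma is_derive_pd1 F (x1 x2 : R) : derivable F (x1, x2) (basis2 R false) ->
  is_derive x1 1 (fun s => F (s, x2)) (pd false F (x1, x2)).
Proof. by move=> dF; apply/(is_derive_line1 F (x1, x2)); split. Qed.

Lemma is_derive_pd2 F (x1 x2 : R) : derivable F (x1, x2) (basis2 R true) ->
  is_derive x2 1 (fun s => F (x1, s)) (pd true F (x1, x2)).
Proof. by move=> dF; apply/(is_derive_line2 F (x1, x2)); split. Qed.

Lemma derive_lipschitz (f df : R -> R) (a b K : R) : a <= b ->
  (forall x : R, is_derive x 1 f (df x)) -> (forall x, a <= x <= b -> `|df x| <= K) ->
  `|f b - f a| <= K * (b - a).
Proof.
move=> ab hf hK.
have cf : continuous f by move=> x; apply: differentiable_continuous; apply/derivable1_diffP; exact: (@ex_derive _ _ _ _ _ _ _ (hf x)).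
have [s + ->] := @MVT_segment R f df a b ab (fun x _ => hf x) (continuous_subspaceT cf).
rewrite in_itv /= => hs; rewrite normrM (ger0_norm (x := b - a)) ?subr_ge0//.
by rewrite ler_wpM2r ?subr_ge0// hK.
Qed.

Lemma derive_lipschitz_sym (f df : R -> R) (a b K : R) :
  (forall x : R, is_derive x 1 f (df x)) -> (forall x, Num.min a b <= x <= Num.max a b -> `|df x| <= K) ->
  `|f b - f a| <= K * `|b - a|.
Proof.
move=> hf; have [ab|ba] := leP a b => hK.
  by rewrite (ger0_norm (x := b - a)) ?subr_ge0//; exact: derive_lipschitz hK.
rewrite distrC [`|b - a|]distrC (ger0_norm (x := a - b)) ?subr_ge0 ?(ltW ba)//.
by apply: derive_lipschitz hK => //; exact: ltW.
Qed.

Lemma reduce_2pi (x : R) : exists (k : int) s, 0 <= s <= 2 * pi /\ x = s + k%:~R * (2 * pi).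
Proof. by apply: profile_reduce; rewrite mulr_gt0// pi_gt0. Qed.

Lemma periodic_2pi_z (f : R * R -> R) : (forall x, f (x.1 + 2 * pi, x.2) = f x) ->
  forall (k : int) x1 x2, f (x1 + k%:~R * (2 * pi), x2) = f (x1, x2).
Proof.
move=> fp k x1 x2.
have hn (n : nat) u : f (u + n%:R * (2 * pi), x2) = f (u, x2).
  elim: n => [|n ih]; first by rewrite mul0r addr0.
  by rewrite -natr1 mulrDl mul1r addrA (fp (_, _)) ih.
by case: k => n; rewrite ?hn// NegzE mulrNz mulNr -(hn n.+1 (x1 - _)) subrK.
Qed.

Lemma periodic_bounded (f : R * R -> R) (m b : R) : continuous f ->
  (forall x, f (x.1 + 2 * pi, x.2) = f x) ->
  exists2 K : R, 0 <= K & forall x, m <= x.2 <= b -> `|f x| <= K.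
Proof.
move=> cf fp.
have cK : compact (f @` (`[0, 2 * pi]%classic `*` `[m, b]%classic)).
  apply: continuous_compact; first exact: continuous_subspaceT.
  by apply: compact_setX; exact: segment_compact.
have [K [_ hK]] := compact_bounded cK.
exists (`|K| + 1); first by rewrite addr_ge0.
move=> [x1 x2] /= hx; have [k [s [hs ->]]] := reduce_2pi x1.
rewrite periodic_2pi_z//; apply: (hK (`|K| + 1)).
  by rewrite (le_lt_trans (ler_norm K))// ltrDl.
by exists (s, x2) => //; split; rewrite /= in_itv.
Qed.

Lemma pd_periodic F j : (forall x, F (x.1 + 2 * pi, x.2) = F x) ->
  forall x, pd j F (x.1 + 2 * pi, x.2) = pd j F x.
Proof.
move=> fp x; rewrite /pd /derive.
suff -> : (fun h : R => h^-1 *: ((F \o shift (x.1 + 2 * pi, x.2)) (h *: basis2 R j) - F (x.1 + 2 * pi, x.2))) =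
  (fun h : R => h^-1 *: ((F \o shift x) (h *: basis2 R j) - F x)) by [].
apply/funext => h /=.
have e2 : h *: basis2 R j + (x.1 + 2 * pi, x.2) =
    ((h *: basis2 R j + x).1 + 2 * pi, (h *: basis2 R j + x).2).
  by apply/pair_equal_spec; split => //=; rewrite addrA.
by rewrite e2 !fp.
Qed.

End c1.

Lemma clamp_lipschitz (R : realType) (b m y z : R) :
  `|Num.min b (Num.max y m) - Num.min b (Num.max z m)| <= `|y - z|.
Proof.
have hmax : `|Num.max y m - Num.max z m| <= `|y - z|.
  have a1 := ler_norm (y - z); move: (ler_norm (z - y)).
  by rewrite [`|z - y|]distrC; case: (leP y m); case: (leP z m) => h1 h2 h3; rewrite ler_norml; lra.
apply: le_trans hmax; move: (Num.max y m) (Num.max z m) => u v.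
have a1 := ler_norm (u - v); move: (ler_norm (v - u)).
by rewrite [`|v - u|]distrC; case: (leP b u); case: (leP b v) => h1 h2 h3; rewrite ler_norml; lra.
Qed.

Section green_C1.
Context (R : realType) (c : R -> R * R) (M L b : R).
Hypothesis M0 : 0 < M.
Hypothesis cM : lipschitz_coords c M.
Hypothesis L0 : 0 < L.
Hypothesis cL : shift_periodic c L.
Hypothesis cb : forall t, (c t).2 < b.

(* Replacing [x.2] by its clamping to [m, b] turns a C1 function vanishing on [x.2 = b] into a
   Lipschitz function of the whole plane vanishing above [b]. *)
Lemma green_C1 : exists2 C : R, 0 <= C & forall (F : R * R -> R) (j : bool), C1 F ->
  (forall x, F (x.1 + 2 * pi, x.2) = F x) -> (forall x1, F (x1, b) = 0) ->
  `|\int[plane_measure R]_(x in cell_domain c b) pd j F x| <=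
    C * \int[@lebesgue_measure R]_(t in fundamental_param c) `|F (c t)|.
Proof.
have [C C0 hC] := green_inequality b M0 cM L0 cL.
have [m0 hm] := above_bounded_below M0 cM L0 cL.
have [B B0 hB] := profile_height M0 cM L0 cL.
exists C => // F j cF Fp Fb.
(* The margin 1 below the domain makes [H] and [F] agree near every point of the cell, so their
   derivatives agree; [- B] puts the whole curve above [m]. *)
pose m := Num.min (m0 - 1) (- B).
have mm0 : m <= m0 - 1 by rewrite ge_min lexx.
have mB : m <= - B by rewrite ge_min lexx orbT.
have mc t : m <= (c t).2 <= b.
  rewrite (ltW (cb t)) andbT; have := hB t; rewrite ler_norml; lra.
have mb : m <= b by case/andP: (mc 0); exact: le_trans.
pose clamp (y : R) := Num.min b (Num.max y m).
have clampI y : m <= y <= b -> clamp y = y.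
  by move=> /andP[my yb]; rewrite /clamp (max_idPl my) (min_idPr yb).
have clampB y : m <= clamp y <= b.
  by rewrite /clamp le_min mb le_max lexx orbT ge_min lexx.
have clampL y z : `|clamp y - clamp z| <= `|y - z| by exact: clamp_lipschitz.
pose H (x : R * R) := F (x.1, clamp x.2).
have [K1 K10 hK1] := @periodic_bounded R (pd false F) m b (cF false).1 (pd_periodic false Fp).
have [K2 K20 hK2] := @periodic_bounded R (pd true F) m b (cF true).1 (pd_periodic true Fp).
have HF t : H (c t) = F (c t) by rewrite /H clampI//; case: (c t).
have H_near x : cell_domain c b x -> \forall y \near x, H y = F y.
  move=> [[/hm mx xb] _]; apply/nbhs2P; exists (Num.min 1 (b - x.2)).
    by rewrite lt_min ltr01 subr_gt0.
  move=> y _; rewrite lt_min => /andP[y1 y2]; rewrite /H clampI; first by case: y {y1 y2}.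
  by move: y1 y2; rewrite !ltr_norml => /andP[? ?] /andP[? ?]; move: xb => /=; lra.
have Hlip x y : `|H x - H y| <= (K1 + K2) * (`|x.1 - y.1| + `|x.2 - y.2|).
  have -> : H x - H y = (F (x.1, clamp x.2) - F (y.1, clamp x.2)) +
      (F (y.1, clamp x.2) - F (y.1, clamp y.2)) by rewrite /H; ring.
  have h1 : `|F (x.1, clamp x.2) - F (y.1, clamp x.2)| <= K1 * `|x.1 - y.1|.
    apply: (derive_lipschitz_sym (fun s => is_derive_pd1 ((cF false).2 (s, clamp x.2)))) => // s _.
    exact: (hK1 (s, clamp x.2) (clampB x.2)).
  have h2 : `|F (y.1, clamp x.2) - F (y.1, clamp y.2)| <= K2 * `|clamp x.2 - clamp y.2|.
    apply: (derive_lipschitz_sym (fun s => is_derive_pd2 ((cF true).2 (y.1, s)))) => // s hs.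
    apply: hK2 => /=; have /andP[? ?] := clampB x.2; have /andP[? ?] := clampB y.2.
    by case/andP: hs; rewrite ge_min le_max => /orP[] ? /orP[] ?; lra.
  have h3 : K2 * `|clamp x.2 - clamp y.2| <= K2 * `|x.2 - y.2| by rewrite ler_wpM2l.
  have := ler_normD (F (x.1, clamp x.2) - F (y.1, clamp x.2)) (F (y.1, clamp x.2) - F (y.1, clamp y.2)).
  have := mulr_ge0 K10 (normr_ge0 (x.2 - y.2)); have := mulr_ge0 K20 (normr_ge0 (x.1 - y.1)).
  lra.
have dH x : cell_domain c b x -> derivable H x (basis2 R j).
  move=> xD; apply: (@near_eq_derivable _ _ _ F) => //; last exact: (cF j).2.
  by apply: filterS (H_near x xD) => y ->.
have := hC H (K1 + K2) j (addr_ge0 K10 K20) Hlip _ _ dH.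
have -> : \int[plane_measure R]_(x in cell_domain c b) pd j H x =
    \int[plane_measure R]_(x in cell_domain c b) pd j F x.
  apply: eq_Rintegral => x /set_mem xD; apply: near_eq_derive; exact: H_near.
have -> : \int[@lebesgue_measure R]_(t in fundamental_param c) `|H (c t)| =
    \int[@lebesgue_measure R]_(t in fundamental_param c) `|F (c t)|.
  by apply: eq_Rintegral => t _; rewrite HF.
apply; first by move=> x; rewrite /H /= (Fp (_, _)).
move=> x bx; rewrite /H /clamp (_ : Num.min _ _ = b) ?Fb//.
by apply/min_idPl; rewrite le_max bx.
Qed.

End green_C1.

(** * Modes *)

Section modes.
Context (R : realType).
Implicit Types (a b A B : R) (k : nat) (x : R * R).

(** The free coefficients [A] and [B] close the family under both partial derivatives, which gives
    smoothness by induction; products are sums of two members. *)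
Definition trig a b A B k x : R := (A * cos (a * x.1) + B * sin (a * x.1)) * (b - x.2) ^+ k.

Definition mode a b k x : R[i] := cis (a * x.1) * ((b - x.2) ^+ k)%:C.

Lemma mode_Re a b k x : complex.Re (mode a b k x) = trig a b 1 0 k x.
Proof. by rewrite /mode /trig /= mulr0 subr0 mul1r mul0r addr0. Qed.

Lemma mode_Im a b k x : complex.Im (mode a b k x) = trig a b 0 1 k x.
Proof. by rewrite /mode /trig /= mulr0 add0r mul1r mul0r add0r. Qed.

Lemma is_derive_trig1 a b A B k x :
  is_derive x (basis2 R false) (trig a b A B k) (trig a b (a * B) (- (a * A)) k x).
Proof.
apply/is_derive_line1; rewrite /trig /=.
apply: is_derive_eq; rewrite /GRing.scale /=; ring.
Qed.

(** For [k = 0] the factor [k%:R] vanishes, so the truncated predecessor [k.-1] is harmless. *)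
Lemma is_derive_expn b k (y : R) :
  is_derive y 1 (fun s => (b - s) ^+ k) (- (k%:R * (b - y) ^+ k.-1)).
Proof.
have e : (fun s => (b - s) ^+ k) = (fun s => b - s) ^+ k.
  elim: k => [|k ih]; first by apply/funext => s; rewrite !expr0.
  by rewrite exprS -ih; apply/funext => s; rewrite exprS.
have h : is_derive y 1 (fun s => b - s) (-1).
  by apply: is_derive_eq; ring.
have hX := is_deriveX k h; rewrite e; apply: (is_derive_eq hX).
by rewrite /GRing.scale /= mulrN1.
Qed.

Lemma is_derive_trig2 a b A B k x :
  is_derive x (basis2 R true) (trig a b A B k) (trig a b (- (k%:R * A)) (- (k%:R * B)) k.-1 x).
Proof.
apply/is_derive_line2; rewrite /trig /=.
set C := A * _ + _.
have := @is_deriveZ _ _ _ _ C _ _ _ (is_derive_expn b k x.2).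
rewrite (_ : C \*: _ = fun s => C * (b - s) ^+ k) // => h.
by apply: is_derive_eq h _; rewrite /C /GRing.scale /=; ring.
Qed.

Lemma continuous_trig a b A B k : continuous (trig a b A B k).
Proof.
move=> x; apply: cvgM; last first.
  apply: (@continuous_comp _ _ _ (fun x : R * R => b - x.2) (fun y => y ^+ k)); last exact: exprn_continuous.
  by apply: cvgB; [exact: cvg_cst|exact: cvg_snd].
have c1 : (fun y : R * R => a * y.1) @ x --> a * x.1.
  by apply: cvgM; [exact: cvg_cst|exact: cvg_fst].
apply: cvgD; apply: cvgM; try exact: cvg_cst.
  by apply: (continuous_comp c1); exact: continuous_cos.
by apply: (continuous_comp c1); exact: continuous_sin.
Qed.

Lemma pd_trig a b A B k j : exists A' B' k', pd j (trig a b A B k) = trig a b A' B' k'.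
Proof.
case: j.
  exists (- (k%:R * A)), (- (k%:R * B)), k.-1; apply/funext => x.
  exact: (@derive_val _ _ _ _ _ _ _ (is_derive_trig2 a b A B k x)).
exists (a * B), (- (a * A)), k; apply/funext => x.
exact: (@derive_val _ _ _ _ _ _ _ (is_derive_trig1 a b A B k x)).
Qed.

Lemma derivable_trig a b A B k j x : derivable (trig a b A B k) x (basis2 R j).
Proof.
case: j; first exact: (@ex_derive _ _ _ _ _ _ _ (is_derive_trig2 a b A B k x)).
exact: (@ex_derive _ _ _ _ _ _ _ (is_derive_trig1 a b A B k x)).
Qed.

Lemma smooth_trig a b A B k : smooth (trig a b A B k).
Proof.
move=> s; have [A' [B' [k' ->]]] : exists A' B' k', foldr (@pd R) (trig a b A B k) s = trig a b A' B' k'.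
  elim: s => [|j s [A' [B' [k' e]]]]; first by exists A, B, k.
  by rewrite /= e; exact: pd_trig.
by split; [exact: continuous_trig|move=> j x; exact: derivable_trig].
Qed.

Lemma csmooth_mode a b k : csmooth (mode a b k).
Proof.
split.
  rewrite (_ : (fun _ => _) = trig a b 1 0 k); first exact: smooth_trig.
  by apply/funext => x; exact: mode_Re.
rewrite (_ : (fun _ => _) = trig a b 0 1 k); first exact: smooth_trig.
by apply/funext => x; exact: mode_Im.
Qed.

Lemma cpd_mode1 a b k x : cpd false (mode a b k) x = (0 +i* a) * mode a b k x.
Proof.
have h1 : pd false (fun y => complex.Re (mode a b k y)) x = trig a b (a * 0) (- (a * 1)) k x.
  rewrite (_ : (fun _ => _) = trig a b 1 0 k); last by apply/funext => y; exact: mode_Re.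
  exact: (@derive_val _ _ _ _ _ _ _ (is_derive_trig1 a b 1 0 k x)).
have h2 : pd false (fun y => complex.Im (mode a b k y)) x = trig a b (a * 1) (- (a * 0)) k x.
  rewrite (_ : (fun _ => _) = trig a b 0 1 k); last by apply/funext => y; exact: mode_Im.
  exact: (@derive_val _ _ _ _ _ _ _ (is_derive_trig1 a b 0 1 k x)).
rewrite /cpd h1 h2 /mode /trig /cis; apply/eqP; rewrite eq_complex /=.
by apply/andP; split; apply/eqP; ring.
Qed.

Lemma cpd_mode2 a b k x : cpd true (mode a b k) x = (- k%:R%:C) * mode a b k.-1 x.
Proof.
have h1 : pd true (fun y => complex.Re (mode a b k y)) x = trig a b (- (k%:R * 1)) (- (k%:R * 0)) k.-1 x.
  rewrite (_ : (fun _ => _) = trig a b 1 0 k); last by apply/funext => y; exact: mode_Re.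
  exact: (@derive_val _ _ _ _ _ _ _ (is_derive_trig2 a b 1 0 k x)).
have h2 : pd true (fun y => complex.Im (mode a b k y)) x = trig a b (- (k%:R * 0)) (- (k%:R * 1)) k.-1 x.
  rewrite (_ : (fun _ => _) = trig a b 0 1 k); last by apply/funext => y; exact: mode_Im.
  exact: (@derive_val _ _ _ _ _ _ _ (is_derive_trig2 a b 0 1 k x)).
rewrite /cpd h1 h2 /mode /trig /cis; apply/eqP; rewrite eq_complex /=.
by apply/andP; split; apply/eqP; ring.
Qed.

Lemma conjc_mode a b k x : conjc (mode a b k x) = mode (- a) b k x.
Proof.
rewrite /mode /cis mulNr cosN sinN; apply/eqP; rewrite eq_complex /=.
by apply/andP; split; apply/eqP; ring.
Qed.

Lemma trig_bounded a b A B k (m : R) x : m <= x.2 <= b ->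
  `|trig a b A B k x| <= (`|A| + `|B|) * (b - m) ^+ k.
Proof.
move=> /andP[h1 h2]; rewrite normrM ler_pM//.
  rewrite (le_trans (ler_normD _ _))// !normrM lerD//.
    by rewrite ler_piMr// cos_max.
  by rewrite ler_piMr// sin_max.
rewrite normrX lerXn2r// ?nnegrE ?normr_ge0//; first lra.
by rewrite ger0_norm; lra.
Qed.

Lemma C1_smooth (f : R * R -> R) : smooth f -> C1 f.
Proof.
move=> sf j; split; first exact: (sf [:: j]).1.
by move=> x; exact: (sf [::]).2.
Qed.

Lemma C1M (f g : R * R -> R) : C1 f -> C1 g -> continuous f -> continuous g ->
  C1 (fun x => f x * g x) /\ forall j x, pd j (fun x => f x * g x) x = f x * pd j g x + g x * pd j f x.
Proof.
move=> hf hg cf cg.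
have e j x : pd j (fun x => f x * g x) x = f x * pd j g x + g x * pd j f x.
  exact: (deriveM ((hf j).2 x) ((hg j).2 x)).
split; last exact: e.
move=> j; split; last by move=> x; exact: (derivableM ((hf j).2 x) ((hg j).2 x)).
rewrite (_ : pd j _ = fun x => f x * pd j g x + g x * pd j f x); last by apply/funext => x; exact: e.
move=> x; apply: cvgD; apply: cvgM; [exact: cf|exact: (hg j).1|exact: cg|exact: (hf j).1].
Qed.

Lemma C1D (f g : R * R -> R) : C1 f -> C1 g ->
  C1 (fun x => f x + g x) /\ forall j x, pd j (fun x => f x + g x) x = pd j f x + pd j g x.
Proof.
move=> hf hg.
have e j x : pd j (fun x => f x + g x) x = pd j f x + pd j g x.
  exact: (deriveD ((hf j).2 x) ((hg j).2 x)).
split; last exact: e.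
move=> j; split; last by move=> x; exact: (derivableD ((hf j).2 x) ((hg j).2 x)).
rewrite (_ : pd j _ = fun x => pd j f x + pd j g x); last by apply/funext => x; exact: e.
by move=> x; apply: cvgD; [exact: (hf j).1|exact: (hg j).1].
Qed.

Lemma C1B (f g : R * R -> R) : C1 f -> C1 g ->
  C1 (fun x => f x - g x) /\ forall j x, pd j (fun x => f x - g x) x = pd j f x - pd j g x.
Proof.
move=> hf hg.
have e j x : pd j (fun x => f x - g x) x = pd j f x - pd j g x.
  exact: (deriveB ((hf j).2 x) ((hg j).2 x)).
split; last exact: e.
move=> j; split; last by move=> x; exact: (derivableB ((hf j).2 x) ((hg j).2 x)).
rewrite (_ : pd j _ = fun x => pd j f x - pd j g x); last by apply/funext => x; exact: e.
by move=> x; apply: cvgB; [exact: (hf j).1|exact: (hg j).1].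
Qed.

Definition cC1 (f : R * R -> R[i]) :=
  [/\ C1 (fun x => complex.Re (f x)), C1 (fun x => complex.Im (f x)),
      continuous (fun x => complex.Re (f x)) & continuous (fun x => complex.Im (f x))].

Lemma cC1_smooth f : csmooth f -> cC1 f.
Proof. by move=> [h1 h2]; split; try exact: C1_smooth; [exact: (h1 [::]).1|exact: (h2 [::]).1]. Qed.

Lemma cC1M (f g : R * R -> R[i]) : cC1 f -> cC1 g ->
  cC1 (fun x => f x * g x) /\ forall j x, cpd j (fun x => f x * g x) x = f x * cpd j g x + cpd j f x * g x.
Proof.
move=> [f1 f2 cf1 cf2] [g1 g2 cg1 cg2].
have eR : (fun x => complex.Re (f x * g x)) =
    (fun x => complex.Re (f x) * complex.Re (g x) - complex.Im (f x) * complex.Im (g x)).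
  by apply/funext => x; case: (f x) (g x) => [? ?] [? ?].
have eI : (fun x => complex.Im (f x * g x)) =
    (fun x => complex.Re (f x) * complex.Im (g x) + complex.Im (f x) * complex.Re (g x)).
  by apply/funext => x; case: (f x) (g x) => [? ?] [? ?].
have [p1 q1] := C1M f1 g1 cf1 cg1; have [p2 q2] := C1M f2 g2 cf2 cg2.
have [p3 q3] := C1M f1 g2 cf1 cg2; have [p4 q4] := C1M f2 g1 cf2 cg1.
have [r1 s1] := C1B p1 p2; have [r2 s2] := C1D p3 p4.
split.
  split; rewrite ?eR ?eI//.
    by move=> x; apply: cvgB; apply: cvgM; [exact: cf1|exact: cg1|exact: cf2|exact: cg2].
  by move=> x; apply: cvgD; apply: cvgM; [exact: cf1|exact: cg2|exact: cf2|exact: cg1].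
move=> j x; rewrite /cpd eR eI s1 s2 q1 q2 q3 q4; apply/eqP; rewrite eq_complex.
case: (f x) (g x) => [u v] [w z] /=.
by apply/andP; split; apply/eqP; ring.
Qed.

Lemma cC1B (f g : R * R -> R[i]) : cC1 f -> cC1 g ->
  cC1 (fun x => f x - g x) /\ forall j x, cpd j (fun x => f x - g x) x = cpd j f x - cpd j g x.
Proof.
move=> [f1 f2 cf1 cf2] [g1 g2 cg1 cg2].
have eR : (fun x => complex.Re (f x - g x)) = (fun x => complex.Re (f x) - complex.Re (g x)).
  by apply/funext => x; case: (f x) (g x) => [? ?] [? ?].
have eI : (fun x => complex.Im (f x - g x)) = (fun x => complex.Im (f x) - complex.Im (g x)).
  by apply/funext => x; case: (f x) (g x) => [? ?] [? ?].
have [p1 q1] := C1B f1 g1; have [p2 q2] := C1B f2 g2.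
split; first split; rewrite ?eR ?eI//.
- by move=> x; apply: cvgB; [exact: cf1|exact: cg1].
- by move=> x; apply: cvgB; [exact: cf2|exact: cg2].
by move=> j x; rewrite /cpd eR eI q1 q2; apply/eqP; rewrite eq_complex /= !eqxx.
Qed.

End modes.

(** * Quantitative L^2 bounds *)

Section L2_estimates.
Context (R : realType) (d : measure_display) (T : measurableType d).
Variables (mu : {measure set T -> \bar R}) (D : set T).
Hypothesis mD : measurable D.
Implicit Types (f g : T -> R[i]).

Lemma sqL2_ge0 f : (0 <= sqL2 mu D f)%E.
Proof. by apply: integral_ge0 => x _; rewrite lee_fin sqnorm_ge0. Qed.

Lemma sqL2_sub3 f g h : cmeasurable D f -> cmeasurable D g -> cmeasurable D h ->
  (sqL2 mu D (fun x => (f x - g x + h x)%R) <= 3%:E * (sqL2 mu D f + sqL2 mu D g + sqL2 mu D h))%E.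
Proof.
move=> mf mg mh; rewrite /sqL2.
have mE k : cmeasurable D k -> measurable_fun D (fun x => (sqnorm (k x))%:E).
  by move=> mk; exact/measurable_EFinP/measurable_sqnorm.
have s0 k x : (0 <= (sqnorm (k x))%:E :> \bar R)%E by rewrite lee_fin sqnorm_ge0.
rewrite -ge0_integralD//; [|exact: mE|exact: mE].
rewrite -ge0_integralD//; [|by move=> x _; rewrite adde_ge0|by apply: emeasurable_funD; exact: mE|exact: mE].
rewrite -ge0_integralZl//; [|by apply: emeasurable_funD; [apply: emeasurable_funD|]; exact: mE
  |by move=> x _; rewrite !adde_ge0].
apply: ge0_le_integral => //.
- by apply: mE; apply: cmeasurableD => //; apply: cmeasurableD => //; exact: cmeasurableN.
- apply: measurable_funeM; apply: emeasurable_funD; [apply: emeasurable_funD|]; exact: mE.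
- move=> x _; rewrite -!EFinD -EFinM lee_fin /sqnorm.
  case: (f x) (g x) (h x) => [a1 a2] [b1 b2] [c1 c2] /=.
  have := (sqr_ge0 (a1 + b1), sqr_ge0 (a1 - c1), sqr_ge0 (b1 + c1),
    sqr_ge0 (a2 + b2), sqr_ge0 (a2 - c2), sqr_ge0 (b2 + c2)).
  move=> [[[[[? ?] ?] ?] ?] ?]; nra.
Qed.

(** The inequality [|x| <= e + x^2 / e] takes the place of Cauchy-Schwarz: on a finite measure
    space, if the integral of [sqnorm z] is at most [e^2], the right-hand side integrates to a
    multiple of [e]. *)
Lemma abs_ReIm_le (z w : R[i]) (e K : R) : 0 < e -> `|complex.Re w| <= K -> `|complex.Im w| <= K ->
  `|complex.Re (z * w)| <= K * (2 * e + sqnorm z / e) /\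
  `|complex.Im (z * w)| <= K * (2 * e + sqnorm z / e).
Proof.
move=> e0; case: z w => [a b] [u v] /= hu hv.
have K0 : 0 <= K by rewrite (le_trans _ hu).
have key x : `|x| <= e + x ^+ 2 / e.
  rewrite -(ler_pM2r e0) mulrDl mulfVK ?gt_eqF// -real_normK ?num_real//.
  have := sqr_ge0 (`|x| - e); have := normr_ge0 x; nra.
have h : `|a| + `|b| <= 2 * e + sqnorm (a +i* b) / e.
  have := key a; have := key b; rewrite /sqnorm /= mulrDl; lra.
have hK : K * (`|a| + `|b|) <= K * (2 * e + sqnorm (a +i* b) / e) by rewrite ler_wpM2l.
split; apply: le_trans hK; rewrite (le_trans (ler_normD _ _))// ?normrN !normrM mulrDr lerD//.
- by rewrite mulrC ler_wpM2r.
- by rewrite mulrC ler_wpM2r.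
- by rewrite mulrC ler_wpM2r.
- by rewrite mulrC ler_wpM2r.
Qed.

(** The constant summand [2 * e] contributes [2 * fine (mu D) * e], and the quadratic one
    contributes at most [e ^+ 2 / e]. *)
Lemma Rintegral_sqnorm_le f (e K : R) (h : T -> R) : (mu D < +oo)%E -> 0 < e -> 0 <= K ->
  cmeasurable D f -> (sqL2 mu D f <= (e ^+ 2)%:E)%E -> measurable_fun D h ->
  (forall x, D x -> `|h x| <= K * (2 * e + sqnorm (f x) / e)) ->
  `|\int[mu]_(x in D) h x| <= K * (2 * fine (mu D) + 1) * e /\
  \int[mu]_(x in D) `|h x| <= K * (2 * fine (mu D) + 1) * e.
Proof.
move=> fD e0 K0 mf fe mh hh.
have L2f : in_L2 mu D f by split=> //; rewrite (le_lt_trans fe) ?ltry.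
have isq := in_L2_sqnorm L2f.
have ic (r : R) : mu.-integrable D (cst r%:E).
  rewrite (_ : cst _ = EFin \o cst r) //; apply: measurable_bounded_integrable => //.
  by exists `|r|; split; [exact: num_real|move=> y ry x _ /=; exact: ltW].
have ig : mu.-integrable D (EFin \o (fun x => K * (2 * e + sqnorm (f x) / e))).
  apply: (@eq_integrable _ _ _ mu D mD (fun x => K%:E * ((2 * e)%:E + (e^-1)%:E * (sqnorm (f x))%:E))%E).
    move=> x _; transitivity ((K * (2 * e + e^-1 * sqnorm (f x)))%:E) => //.
    by rewrite /= [e^-1 * _]mulrC.
  exact: (integrableZl mD K (integrableD mD (ic (2 * e)) (integrableZl mD e^-1 isq))).
have ih : mu.-integrable D (EFin \o h).
  apply: le_integrable ig => //; first exact/measurable_EFinP.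
  by move=> x xD /=; rewrite lee_fin (le_trans (hh x xD))// ler_norm.
have iah : mu.-integrable D (EFin \o (fun x => `|h x|)).
  by apply: eq_integrable (integrable_abse ih).
have le2 : \int[mu]_(x in D) `|h x| <= K * (2 * fine (mu D) + 1) * e.
  apply: (@le_trans _ _ (\int[mu]_(x in D) (K * (2 * e + sqnorm (f x) / e)))).
    exact: le_Rintegral.
  have i2 : mu.-integrable D (EFin \o (fun x => sqnorm (f x) / e)).
    apply: eq_integrable (integrableZl mD e^-1 isq) => // x _.
    by rewrite /= -EFinM mulrC.
  have i1 : mu.-integrable D (EFin \o (fun x => 2 * e + sqnorm (f x) / e)).
    by apply: eq_integrable (integrableD mD (ic (2 * e)) i2) => // x _; rewrite /= -EFinD.
  rewrite RintegralZl// RintegralD//; last exact: ic.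
  rewrite Rintegral_cst// RintegralZr//.
  rewrite -[leRHS]mulrA ler_wpM2l//.
  have : \int[mu]_(x in D) sqnorm (f x) <= e ^+ 2.
    by rewrite /Rintegral -[leRHS]/(fine (e ^+ 2)%:E) fine_le// integrable_fin_num.
  rewrite -(ler_pM2r (_ : 0 < e^-1)) ?invr_gt0//.
  rewrite [e ^+ 2]expr2 mulfK ?gt_eqF//; lra.
by split=> //; rewrite (le_trans (le_normr_Rintegral mD ih)).
Qed.

Lemma cint_mul_small f g (e K : R) : (mu D < +oo)%E -> 0 < e -> 0 <= K ->
  cmeasurable D f -> cmeasurable D g -> (sqL2 mu D f <= (e ^+ 2)%:E)%E ->
  (forall x, D x -> `|complex.Re (g x)| <= K /\ `|complex.Im (g x)| <= K) ->
  `|complex.Re (cint mu D (fun x => f x * g x))| <= K * (2 * fine (mu D) + 1) * e /\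
  `|complex.Im (cint mu D (fun x => f x * g x))| <= K * (2 * fine (mu D) + 1) * e.
Proof.
move=> fD e0 K0 mf mg fe hg; have [m1 m2] := cmeasurableM mf mg.
split; apply: (Rintegral_sqnorm_le fD e0 K0 mf fe _ _).1 => // x xD;
  have [g1 g2] := hg x xD; by have [] := abs_ReIm_le (f x) e0 g1 g2.
Qed.

Lemma cvg_sqL2_le (F : nat -> T -> R[i]) (e : R) : 0 < e ->
  sqL2 mu D (F m) @[m --> \oo] --> 0%E ->
  \forall m \near \oo, (sqL2 mu D (F m) <= (e ^+ 2)%:E)%E.
Proof.
move=> e0 hF; have e2 : (0 < (e ^+ 2)%:E :> \bar R)%E by rewrite lte_fin exprn_gt0.
have : \forall z \near (0%E : \bar R), (z < (e ^+ 2)%:E)%E by exact: (open_ereal_lt' e2).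
move=> h; have hm : \forall m \near \oo, (sqL2 mu D (F m) < (e ^+ 2)%:E)%E := hF _ h.
by apply: filterS hm => m; exact: ltW.
Qed.

End L2_estimates.

Lemma eq0_of_small (R : realType) (x C : R) : (forall e : R, 0 < e -> `|x| <= C * e) -> x = 0.
Proof.
move=> h; apply/eqP; rewrite -normr_eq0 eq_le normr_ge0 andbT.
apply/ler_addgt0Pr => e e0; rewrite add0r.
have C1 : 0 < `|C| + 1 by rewrite ltr_wpDl.
rewrite (le_trans (h (e / (`|C| + 1)) _)) ?divr_gt0//.
rewrite mulrA ler_pdivrMr// [e * _]mulrC ler_wpM2r ?(ltW e0)//.
by rewrite (le_trans (ler_norm C))// lerDl.
Qed.

Lemma sinD2piz (R : realType) (x : R) (k : int) : sin (x + k%:~R * (2 * pi)) = sin x.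
Proof. by rewrite -cosBpihalf addrAC cosD2piz cosBpihalf. Qed.

Lemma cisD2piz (R : realType) (x : R) (k : int) : cis (x + k%:~R * (2 * pi)) = cis x.
Proof. by rewrite /cis cosD2piz sinD2piz. Qed.

Lemma continuous_cmeasurable (R : realType) (w : R * R -> R[i])
    (D : set (measurableTypeR R * measurableTypeR R)) :
  continuous (fun x => complex.Re (w x)) -> continuous (fun x => complex.Im (w x)) ->
  cmeasurable D (w : measurableTypeR R * measurableTypeR R -> R[i]).
Proof.
by move=> h1 h2; split; apply: measurable_funTS; exact: continuous_measurable_plane.
Qed.

Lemma norm_sub4_le (R : realType) (p q1 q2 q3 q4 B1 B2 : R) :
  `|p| <= B1 -> `|q1| <= B2 -> `|q2| <= B2 -> `|q3| <= B2 -> `|q4| <= B2 ->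
  `|p - (q1 - q2) - (q3 - q4)| <= B1 + 4 * B2.
Proof.
rewrite !ler_norml => /andP[? ?] /andP[? ?] /andP[? ?] /andP[? ?] /andP[? ?].
by apply/andP; split; lra.
Qed.

(** * Smooth functions are weakly differentiable *)

Section compact_support.
Context (R : realType).
Local Notation leb := (@lebesgue_measure R).
Local Notation T2 := (measurableTypeR R * measurableTypeR R)%type.

Definition vanishes_off (B : R) (h : R * R -> R) :=
  forall x, B < `|x.1| \/ B < `|x.2| -> h x = 0.

Lemma pd_vanishes_off B h j : vanishes_off B h -> vanishes_off B (pd j h).
Proof.
move=> h0 x xB; rewrite /pd -[RHS](@derive_cst R _ _ (0 : R) x (basis2 R j)).
apply: near_eq_derive; case: xB => xB.
  have : \forall y \near x, B < `|y.1|.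
    have cf : (fun y : R * R => `|y.1|) @ x --> `|x.1| by apply: cvg_norm; exact: cvg_fst.
    exact: (cvgr_gt _ cf).
  by apply: filterS => y yB; rewrite h0//; left.
have : \forall y \near x, B < `|y.2|.
  have cf : (fun y : R * R => `|y.2|) @ x --> `|x.2| by apply: cvg_norm; exact: cvg_snd.
  exact: (cvgr_gt _ cf).
by apply: filterS => y yB; rewrite h0//; right.
Qed.

Lemma integrable_vanishes_off B h : continuous h -> vanishes_off B h ->
  (plane_measure R).-integrable setT (EFin \o (h : T2 -> R)).
Proof.
move=> ch h0.
pose D : set T2 := `[- B, B]%classic `*` `[- B, B]%classic.
have mD : measurable D by exact: measurableX.
have fD : (plane_measure R D < +oo)%E.
  rewrite plane_measureX// !lebesgue_measure_itv/=.
  by case: ifP => _; rewrite ?mule0// -EFinD -EFinM ltry.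
have -> : (EFin \o h) = (EFin \o h) \_ D.
  apply/funext => x; rewrite patchE; case: ifPn => // /negP xD.
  rewrite /= h0//; apply/orP; rewrite !ltNge -negb_and; apply/negP => /andP[x1 x2]; apply: xD.
  by rewrite inE; split; rewrite /= in_itv /= -ler_norml.
rewrite -integrable_mkcond//.
apply: measurable_bounded_integrable => //; first exact: measurable_funTS (continuous_measurable_plane ch).
have cK : compact (h @` (`[- B, B]%classic `*` `[- B, B]%classic)).
  apply: continuous_compact; first exact: continuous_subspaceT.
  by apply: compact_setX; exact: segment_compact.
have [K [KR hK]] := compact_bounded cK.
by exists K; split => // y Ky x xD /=; apply: (hK y Ky); exists x.
Qed.

Lemma integral_derive_vanishing (B : R) (f df : R -> R) : 0 <= B ->
  (forall x : R, is_derive x 1 f (df x)) -> continuous df ->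
  (forall x, B < `|x| -> f x = 0) -> (forall x, B < `|x| -> df x = 0) ->
  (\int[leb]_x (df x)%:E = 0)%E.
Proof.
move=> B0 hf cdf f0 df0.
(* Enlarging the interval by 1 places its endpoints where [f] vanishes. *)
have -> : (fun x => (df x)%:E) = (fun x => (df x)%:E) \_ `[- (B + 1), B + 1].
  apply/funext => x; rewrite patchE; case: ifPn => // /negP xD; rewrite df0//.
  rewrite ltNge; apply/negP => xB; apply: xD; rewrite inE /= in_itv /= -ler_norml; lra.
rewrite -integral_mkcond.
have cf : continuous f.
  move=> x; apply: differentiable_continuous; apply/derivable1_diffP.
  exact: (@ex_derive _ _ _ _ _ _ _ (hf x)).
rewrite (@continuous_FTC2 _ df f).
- rewrite !f0 ?subee//.
    by rewrite ltr_normr; apply/orP; right; lra.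
  by rewrite ltr_normr; apply/orP; left; lra.
- lra.
- exact: continuous_subspaceT.
- split.
  + by move=> x _; exact: (@ex_derive _ _ _ _ _ _ _ (hf x)).
  + by apply: cvg_at_right_filter; exact: cf.
  + by apply: cvg_at_left_filter; exact: cf.
- by move=> x _; rewrite derive1E; exact: (@derive_val _ _ _ _ _ _ _ (hf x)).
Qed.

(** Fubini with the inner integral taken in the direction of the derivative, where the fundamental
    theorem of calculus gives 0. *)
Lemma integral_pd_vanishing B h j : 0 <= B -> C1 h -> vanishes_off B h ->
  (\int[plane_measure R]_x (pd j h x)%:E = 0)%E.
Proof.
move=> B0 ch h0; have hj := pd_vanishes_off j h0.
have ij := integrable_vanishes_off (ch j).1 hj.
case: j hj ij => hj ij.
- apply: (eq_trans (esym (@integral12_prod_meas1 _ _ _ _ _ leb leb _ ij))).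
  rewrite integral0_eq// => x _.
  apply: (@integral_derive_vanishing B (fun s => h (x, s)) (fun s => pd true h (x, s))) => //.
  + by move=> y; apply: is_derive_pd2; exact: (ch true).2.
  + move=> y; apply: (@continuous_comp _ _ _ (fun s => (x, s)) (pd true h)); last exact: (ch true).1.
    exact: (cvg_pair (@cvg_cst _ x _ _ _) (@cvg_id _ (nbhs y))).
  + by move=> y yB; apply: h0; right.
  + by move=> y yB; apply: hj; right.
- apply: (eq_trans (esym (@integral21_prod_meas1 _ _ _ _ _ leb leb _ ij))).
  rewrite integral0_eq// => x _.
  apply: (@integral_derive_vanishing B (fun s => h (s, x)) (fun s => pd false h (s, x))) => //.
  + by move=> y; apply: is_derive_pd1; exact: (ch false).2.
  + move=> y; apply: (@continuous_comp _ _ _ (fun s => (s, x)) (pd false h)); last exact: (ch false).1.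
    exact: (cvg_pair (@cvg_id _ (nbhs y)) (@cvg_cst _ x _ _ _)).
  + by move=> y yB; apply: h0; left.
  + by move=> y yB; apply: hj; left.
Qed.

Lemma pd_vanishes_outside (K : set (R * R)) h j : closed K ->
  (forall x, ~ K x -> h x = 0) -> forall x, ~ K x -> pd j h x = 0.
Proof.
move=> cK h0 x Kx; rewrite /pd -[RHS](@derive_cst R _ _ (0 : R) x (basis2 R j)).
apply: near_eq_derive.
have : \forall y \near x, (~` K) y by apply: open_nbhs_nbhs; split => //; rewrite openC.
by apply: filterS => y /h0.
Qed.

(** The test function is supported in a compact subset of [O], so both integrals extend to the
    plane. Their sum is then the integral of a derivative of the compactly supported product. *)
Lemma weak_pd_real (O : set T2) (f g : R * R -> R) j : measurable O ->
  test_function O f -> C1 g -> continuous g ->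
  \int[plane_measure R]_(x in O) (pd j f x * g x) =
  - \int[plane_measure R]_(x in O) (f x * pd j g x).
Proof.
move=> mO [sf [K [cK KO f0]]] cg ctg.
have cf := C1_smooth sf; have ctf : continuous f := (sf [::]).1.
have df0 : forall x, ~ K x -> pd j f x = 0.
  by apply: pd_vanishes_outside => //; exact: (compact_closed _ cK).
have [B B0 hB] : exists2 B : R, 0 <= B & forall x, K x -> `|x.1| <= B /\ `|x.2| <= B.
  have [B [_ hB]] := compact_bounded cK.
  exists (`|B| + 1); first by rewrite addr_ge0.
  move=> x Kx; have := hB (`|B| + 1) _ x Kx.
  rewrite (le_lt_trans (ler_norm B)) ?ltrDl// => /(_ isT).
  by move=> /=; rewrite {1}/Num.norm /= ge_max => /andP.
have off (q : R * R -> R) : (forall x, ~ K x -> q x = 0) -> vanishes_off B q.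
  move=> q0 x xB; apply: q0 => /hB[x1 x2].
  by case: xB => xB; [move: x1|move: x2]; rewrite leNgt xB.
have toO (q : R * R -> R) : (forall x, ~ K x -> q x = 0) ->
    \int[plane_measure R]_(x in O) q x = \int[plane_measure R]_x q x.
  move=> q0; rewrite /Rintegral integral_mkcond; congr fine; apply: eq_integral => x _.
  rewrite patchE; case: ifPn => // /negP xO; rewrite q0// => /KO Ox.
  by apply: xO; rewrite inE.
have [ch e] := C1M cf cg ctf ctg.
have z1 x : ~ K x -> pd j f x * g x = 0 by move=> /df0 ->; rewrite mul0r.
have z2 x : ~ K x -> f x * pd j g x = 0 by move=> /f0 ->; rewrite mul0r.
rewrite (toO _ z1) (toO _ z2).
have i1 : (plane_measure R).-integrable setT (EFin \o ((fun x => pd j f x * g x) : T2 -> R)).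
  apply: integrable_vanishes_off (off _ z1).
  by move=> x; apply: cvgM; [exact: (cf j).1|exact: ctg].
have i2 : (plane_measure R).-integrable setT (EFin \o ((fun x => f x * pd j g x) : T2 -> R)).
  apply: integrable_vanishes_off (off _ z2).
  by move=> x; apply: cvgM; [exact: ctf|exact: (cg j).1].
apply/eqP; rewrite -addr_eq0 -RintegralD//; apply/eqP.
rewrite /Rintegral -[RHS]/(fine 0%E).
rewrite -(@integral_pd_vanishing B (fun x => f x * g x) j B0 ch); last first.
  by apply: off => x /f0 ->; rewrite mul0r.
by congr fine; apply: eq_integral => x _; rewrite e addrC [g x * _]mulrC.
Qed.

Lemma weak_pd_smooth (O : set T2) (w : R * R -> R[i]) j : measurable O -> cC1 w ->
  weak_pd O j w (cpd j w).
Proof.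
move=> mO [c1 c2 ct1 ct2] f tf; rewrite /cint.
have h1 := weak_pd_real j mO tf c1 ct1; have h2 := weak_pd_real j mO tf c2 ct2.
have -> : (fun x => complex.Re ((pd j f x)%:C * w x)) = fun x => pd j f x * complex.Re (w x).
  by apply/funext => x; case: (w x) => a b; rewrite /= mul0r subr0.
have -> : (fun x => complex.Im ((pd j f x)%:C * w x)) = fun x => pd j f x * complex.Im (w x).
  by apply/funext => x; case: (w x) => a b; rewrite /= mul0r addr0.
rewrite h1 h2; have -> : (fun x => complex.Re ((f x)%:C * cpd j w x)) =
    fun x => f x * pd j (fun y => complex.Re (w y)) x.
  by apply/funext => x; rewrite /= mul0r subr0.
have -> // : (fun x => complex.Im ((f x)%:C * cpd j w x)) =
    fun x => f x * pd j (fun y => complex.Im (w y)) x.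
by apply/funext => x; rewrite /= mul0r addr0.
Qed.

End compact_support.

Lemma sqL2_subrr (R : realType) (d : measure_display) (T : measurableType d)
    (nu : {measure set T -> \bar R}) (D : set T) (f : T -> R[i]) :
  sqL2 nu D (fun x => f x - f x) = 0%E.
Proof.
by apply: integral0_eq => x _; rewrite subrr /sqnorm /= expr0n /= addr0.
Qed.

Lemma sqnorm_cisM (R : realType) (t : R) (z : R[i]) : sqnorm (cis t * z) = sqnorm z.
Proof.
have h := cos2Dsin2 t; case: z => a b; rewrite /sqnorm /cis /=.
have -> : (cos t * a - sin t * b) ^+ 2 + (cos t * b + sin t * a) ^+ 2 =
  (cos t ^+ 2 + sin t ^+ 2) * (a ^+ 2 + b ^+ 2) by ring.
by rewrite h mul1r.
Qed.

Lemma quasiperiodicS (R : realType) (a : R) (D E : set (R * R)) f :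
  D `<=` E -> quasiperiodic a E f -> quasiperiodic a D f.
Proof. by move=> DE qf x /DE; exact: qf. Qed.

Lemma cpd_cst (R : realType) (j : bool) (z : R[i]) x : cpd j (fun=> z) x = 0.
Proof. by rewrite /cpd /pd !derive_cst. Qed.

Lemma csmooth_cst (R : realType) (z : R[i]) : csmooth (fun=> z).
Proof.
suff sm (r : R) : smooth (fun=> r) by split; exact: sm.
move=> s; have [r' ->] : exists r', foldr (@pd R) (fun=> r) s = fun=> r'.
  elim: s => [|j s [r' e]]; first by exists r.
  by exists 0; apply/funext => x; rewrite /= e /pd derive_cst.
by split=> [x|j x]; [exact: cvg_cst|exact: derivable_cst].
Qed.

Lemma cellE (R : realType) : @cell R = `]0, 2 * pi[%classic.
Proof. by apply/seteqP; split=> t /=; rewrite in_itv. Qed.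

Lemma cell_finite (R : realType) : (@lebesgue_measure R (@cell R) < +oo)%E.
Proof.
rewrite (eq_trans (congr1 (@lebesgue_measure R) (cellE R)) (lebesgue_measure_itv _))/=.
by case: ifP => _; rewrite -?EFinD ltry.
Qed.

Lemma Im_sum (R : realType) (I : Type) (r : seq I) (P : pred I) (F : I -> R[i]) :
  complex.Im (\sum_(i <- r | P i) F i) = \sum_(i <- r | P i) complex.Im (F i).
Proof. by elim/big_rec2: _ => // i a x _ <-; case: (F i) x => [? ?] [? ?]. Qed.

(** * Symmetric sums, the energy form and the moment recursion *)

Section symmetric_sums.
Context (R : realType).
Implicit Types (a p q r s : int -> R) (N : nat).

Definition psumZ a N := \sum_(0 <= m < N.*2.+1) a (m%:Z - N%:Z).

Lemma psumZS a N : psumZ a N.+1 = psumZ a N + (a (- N.+1%:Z) + a N.+1%:Z).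
Proof.
rewrite /psumZ doubleS big_nat_recl// big_nat_recr//= sub0r addrCA; congr (_ + (_ + _)).
  by apply: eq_bigr => i _; congr a; lia.
by congr a; lia.
Qed.

Lemma psumZ_tail a N0 N : (forall n, (N0 < `|n|)%N -> a n = 0) -> (N0 <= N)%N ->
  psumZ a N = psumZ a N0.
Proof.
move=> a0; elim: N => [|N ih]; first by rewrite leqn0 => /eqP ->.
rewrite leq_eqVlt => /orP[/eqP -> //|]; rewrite ltnS => h.
by rewrite psumZS ih// !a0 ?addr0//; lia.
Qed.

Lemma psumZ_le0 a N : (forall n, a n <= 0) -> psumZ a N <= 0.
Proof. by move=> a0; apply: sumr_le0 => i _. Qed.

Lemma lim_psumZ a N0 : (forall n, (N0 < `|n|)%N -> a n = 0) ->
  lim (psumZ a N @[N --> \oo]) = psumZ a N0.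
Proof.
move=> a0; apply: lim_near_cst => //; near=> N; apply: psumZ_tail => //.
by near: N; exact: nbhs_infty_ge.
Unshelve. all: by end_near. Qed.

(* [lim] is [0] on divergent sequences, and the two cross sums diverge
   together as their terms cancel for large [n]. *)
Lemma lim_cross_le0 p q r s N0 :
  (forall n, p n <= 0) -> (forall n, q n <= 0) ->
  (forall n, (N0 < `|n|)%N -> [/\ p n = 0, q n = 0 & r n + s n = 0]) ->
  (forall n, p n - r n - s n + q n <= 0) ->
  lim (psumZ p N @[N --> \oo]) - lim (psumZ r N @[N --> \oo])
  - lim (psumZ s N @[N --> \oo]) + lim (psumZ q N @[N --> \oo]) <= 0.
Proof.
move=> p0 q0 far near.
rewrite (@lim_psumZ p N0) ?(@lim_psumZ q N0); try by move=> n /far[].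
pose t n := r n + s n.
have tE N : psumZ t N = psumZ r N + psumZ s N by exact: big_split.
have ct : psumZ t N @[N --> \oo] --> psumZ t N0.
  apply: cvg_near_cst; exists N0 => // N /= hN; rewrite (psumZ_tail (N0 := N0))// => n /far[] //.
have [cr|dr] := pselect (cvg (psumZ r N @[N --> \oo])).
  have cs : psumZ s N @[N --> \oo] --> psumZ t N0 - lim (psumZ r N @[N --> \oo]).
    rewrite (_ : psumZ s = fun N => psumZ t N - psumZ r N); first exact: cvgB.
    by apply/funext => N; rewrite tE addrC addKr.
  rewrite (cvg_lim _ cs)//.
  have : psumZ (fun n => p n - r n - s n + q n) N0 <= 0 by exact: psumZ_le0.
  rewrite (_ : psumZ _ N0 = psumZ p N0 - psumZ t N0 + psumZ q N0); first lra.
  by rewrite /psumZ -sumrB -big_split /=; apply: eq_bigr => i _; rewrite /t; ring.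
have ds : ~ cvg (psumZ s N @[N --> \oo]).
  move=> cs; apply: dr; rewrite (_ : psumZ r = fun N => psumZ t N - psumZ s N); last first.
    by apply/funext => N; rewrite tE addrK.
  by apply: is_cvgB => //; apply: cvgP ct.
rewrite (dvgP dr) (dvgP ds) /= !subr0.
by rewrite -[leRHS]addr0 lerD// psumZ_le0.
Unshelve. all: by end_near. Qed.

End symmetric_sums.

(** * Hermitian structure of the boundary and volume forms *)

Section hermitian.
Context (R : realType).

(** The sesquilinear form of the matrix with diagonal [x1 + i y1], [x2 + i y2] and off-diagonal
    entries [i t], [- i t], which is the shape of [M_n]. Only the imaginary parts [y1] and [y2] keep
    it from being Hermitian. *)
Definition form2 (x1 y1 x2 y2 t : R) (w z : R[i] * R[i]) : R[i] :=
  (x1 +i* y1) * w.1 * conjc z.1 + (0 +i* t) * w.2 * conjc z.1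
  - (0 +i* t) * w.1 * conjc z.2 + (x2 +i* y2) * w.2 * conjc z.2.

Lemma Im_form2_diag x1 y1 x2 y2 t w :
  complex.Im (form2 x1 y1 x2 y2 t w w) = y1 * sqnorm w.1 + y2 * sqnorm w.2.
Proof. by case: w => -[a b] [a' b']; rewrite /form2 /sqnorm /=; ring. Qed.

Lemma Im_form2_cross x1 x2 t w z :
  complex.Im (form2 x1 0 x2 0 t w z) + complex.Im (form2 x1 0 x2 0 t z w) = 0.
Proof.
by case: w z => -[a b] [a' b'] [[e f] [e' f']]; rewrite /form2 /=; ring.
Qed.

Lemma form2_sub x1 y1 x2 y2 t w z :
  complex.Im (form2 x1 y1 x2 y2 t w w) - complex.Im (form2 x1 y1 x2 y2 t w z)
  - complex.Im (form2 x1 y1 x2 y2 t z w) + complex.Im (form2 x1 y1 x2 y2 t z z) =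
  y1 * sqnorm (w.1 - z.1) + y2 * sqnorm (w.2 - z.2).
Proof.
by case: w z => -[a b] [a' b'] [[e f] [e' f']]; rewrite /form2 /sqnorm /=; ring.
Qed.

End hermitian.

Section cint_combination.
Context (R : realType) (d : measure_display) (T : measurableType d).
Variables (nu : {measure set T -> \bar R}) (D : set T).
Hypothesis mD : measurable D.

Lemma cint_four (f1 f2 f3 f4 : T -> R[i]) : cintegrable nu D f1 -> cintegrable nu D f2 ->
  cintegrable nu D f3 -> cintegrable nu D f4 ->
  cint nu D f1 - cint nu D f2 - cint nu D f3 + cint nu D f4 =
  cint nu D (fun x => f1 x - f2 x - f3 x + f4 x).
Proof.
move=> i1 i2 i3 i4; have i12 := cintegrableB mD i1 i2; have i123 := cintegrableB mD i12 i3.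
by rewrite (cintD mD i123 i4) (cintB mD i12 i3) (cintB mD i1 i2).
Qed.

Lemma Im_cint_eq0 (f : T -> R[i]) : (forall x, complex.Im (f x) = 0) ->
  complex.Im (cint nu D f) = 0.
Proof.
move=> f0; rewrite /cint /= /Rintegral integral0_eq// => x _.
by rewrite f0.
Qed.

Lemma Rintegral_sqnorm (f : T -> R[i]) : in_L2 nu D f ->
  sqL2 nu D f = (\int[nu]_(x in D) sqnorm (f x))%:E.
Proof.
move=> hf; rewrite /sqL2 /Rintegral fineK//.
exact: (integrable_fin_num mD (in_L2_sqnorm hf)).
Qed.

End cint_combination.

Lemma Im_sub4 (R : realType) (a b c e : R[i]) :
  complex.Im (a - b - c + e) = complex.Im a - complex.Im b - complex.Im c + complex.Im e.
Proof. by case: a b c e => [? ?] [? ?] [? ?] [? ?]. Qed.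

Section volume_form.
Context (R : realType) (ce cg cm we wm : R).

(* The arguments list the two gradients and the two values. *)
Definition vform (p q : (R[i] * R[i] * R[i]) * (R[i] * R[i] * R[i])) : R[i] :=
  ce%:C * dot2 (p.1.1.1, p.1.1.2) (conjc q.1.1.1, conjc q.1.1.2)
  - cg%:C * dot2 (p.2.1.1, p.2.1.2) (- conjc q.1.1.2, conjc q.1.1.1)
  + cm%:C * dot2 (p.2.1.1, p.2.1.2) (conjc q.2.1.1, conjc q.2.1.2)
  + cg%:C * dot2 (p.1.1.1, p.1.1.2) (- conjc q.2.1.2, conjc q.2.1.1)
  - we%:C * p.1.2 * conjc q.1.2
  - wm%:C * p.2.2 * conjc q.2.2.

(** All coefficients are real, and the two terms with [cg] are adjoint to each other, so the form is
    Hermitian. *)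
Lemma Im_vform_herm p q : complex.Im (vform p q) + complex.Im (vform q p) = 0.
Proof.
case: p => [[[[a1 a2] [b1 b2]] [c1 c2]] [[[d1 d2] [e1 e2]] [f1 f2]]].
case: q => [[[[a1' a2'] [b1' b2']] [c1' c2']] [[[d1' d2'] [e1' e2']] [f1' f2']]].
rewrite /vform /dot2 /=; ring.
Qed.

Lemma Im_vform_diag p : complex.Im (vform p p) = 0.
Proof. by have := Im_vform_herm p p; lra. Qed.

End volume_form.

Lemma cint_mul_eq0 (R : realType) (d : measure_display) (T : measurableType d)
    (nu : {measure set T -> \bar R}) (D : set T) (mD : measurable D) (f g : T -> R[i]) (K : R) :
  (nu D < +oo)%E -> 0 <= K -> cmeasurable D f -> cmeasurable D g -> sqL2 nu D f = 0%E ->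
  (forall x, D x -> `|complex.Re (g x)| <= K /\ `|complex.Im (g x)| <= K) ->
  cint nu D (fun x => f x * g x) = 0.
Proof.
move=> fD K0 mf mg f0 gK.
have h e : 0 < e -> `|complex.Re (cint nu D (fun x => f x * g x))| <= K * (2 * fine (nu D) + 1) * e /\
    `|complex.Im (cint nu D (fun x => f x * g x))| <= K * (2 * fine (nu D) + 1) * e.
  by move=> e0; apply: cint_mul_small => //; rewrite f0 lee_fin sqr_ge0.
have h1 := eq0_of_small (fun e e0 => (h e e0).1).
have h2 := eq0_of_small (fun e e0 => (h e e0).2).
by apply/eqP; rewrite eq_complex h1 h2 eqxx.
Qed.

(* Iterating the recursion upwards gains a factor [1/2] at each step for large
   indices, while the growth bound allows only a factor [l ^+ 2]. *)
Lemma moments_eq0 (R : realType) (m : nat -> R) (c l C : R) : 0 < l ->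
  (forall k, `|m k| <= C * l ^+ k) ->
  (forall k, (k.+2 * k.+1)%:R * m k = c * m k.+2) -> forall k, m k = 0.
Proof.
move=> l0 mC rec.
(* From this index on [(k + 2) (k + 1)] exceeds [2 |c| l^2], so two steps up at least double the
   modulus relative to the allowed growth [l ^+ 2]. *)
pose K0 := Num.bound (2 * `|c| * l ^+ 2).
have C0 : 0 <= C by have := mC 0%N; rewrite expr0 mulr1; apply: le_trans.
have half k : (K0 <= k)%N -> 2 * (`|m k| * l ^+ 2) <= `|m k.+2|.
  move=> hk; have e : (k.+2 * k.+1)%:R * `|m k| = `|c| * `|m k.+2|.
    by rewrite -normrM -rec normrM normr_nat.
  have hN : 2 * `|c| * l ^+ 2 <= (k.+2 * k.+1)%:R.
    have h1 : 2 * `|c| * l ^+ 2 < K0%:R by apply: archi_boundP; rewrite !mulr_ge0// ltW.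
    by rewrite (le_trans (ltW h1))// ler_nat; nia.
  have [c0|c0] := eqVneq `|c| 0.
    have /eqP : (k.+2 * k.+1)%:R * `|m k| = 0 by rewrite e c0 mul0r.
    by rewrite mulf_eq0 pnatr_eq0 /= => /eqP ->; rewrite mul0r mulr0.
  have c1 : 0 < `|c| by rewrite lt_neqAle eq_sym c0 normr_ge0.
  rewrite -(ler_pM2l c1) -e; apply: le_trans (ler_wpM2r (normr_ge0 (m k)) hN).
  by rewrite le_eqVlt; apply/orP; left; apply/eqP; ring.
have iter k j : (K0 <= k)%N -> 2 ^+ j * (`|m k| * l ^+ j.*2) <= `|m (k + j.*2)%N|.
  move=> hk; elim: j => [|j ih]; first by rewrite !expr0 mul1r mulr1 addn0.
  rewrite doubleS !addnS; apply: le_trans (half _ _); last by rewrite (leq_trans hk)// leq_addr.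
  have l2 : 0 <= l ^+ 2 by rewrite exprn_ge0// ltW.
  have := ler_wpM2r l2 ih; rewrite -(ler_pM2l (ltr0n R 2)) => h.
  apply: le_trans h; rewrite le_eqVlt; apply/orP; left; apply/eqP.
  by rewrite !exprS; ring.
have large k : (K0 <= k)%N -> m k = 0.
  move=> hk; apply/eqP; rewrite -normr_eq0 eq_le normr_ge0 andbT leNgt; apply/negP => mk.
  have [j hj] : exists j : nat, C * l ^+ k / `|m k| < j%:R.
    by exists (Num.bound (C * l ^+ k / `|m k|)); apply: archi_boundP; rewrite divr_ge0// mulr_ge0// exprn_ge0// ltW.
  have h2 : j%:R <= 2 ^+ j :> R by rewrite -natrX ler_nat ltnW// ltn_expl.
  have := le_trans (iter k j hk) (mC _).
  rewrite exprD !mulrA ler_pM2r; last exact: exprn_gt0.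
  move=> h3.
  move: hj; rewrite ltr_pdivrMr// => hj; have := le_lt_trans h3 hj.
  by rewrite ltr_pM2r// ltNge h2.
(* Smaller indices follow by descending two at a time: the recursion determines [m k] from
   [m k.+2]. *)
move=> k; have [j] : exists j, (K0 <= k + j.*2)%N by exists K0; lia.
elim: j k => [|j ih] k hk; first by apply: large; rewrite addn0 in hk.
have m2 : m k.+2 = 0 by apply: ih; move: hk; rewrite doubleS !addnS !addSn.
by have /eqP := rec k; rewrite m2 mulr0 mulf_eq0 pnatr_eq0 /= => /eqP.
Qed.

Section volume_form_test.
Context (R : realType) (ce cg cm we wm : R).
Implicit Types p q : (R[i] * R[i] * R[i]) * (R[i] * R[i] * R[i]).
Local Notation vf := (vform ce cg cm we wm).

Lemma vform_test1 p p' (q1 q2 q0 : R[i]) :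
  vf p ((q1, q2, q0), (0, 0, 0)) - vf p' ((q1, q2, q0), (0, 0, 0)) =
  ce%:C * (conjc q1 * (p.1.1.1 - p'.1.1.1)) + ce%:C * (conjc q2 * (p.1.1.2 - p'.1.1.2))
  + cg%:C * (conjc q2 * (p.2.1.1 - p'.2.1.1)) - cg%:C * (conjc q1 * (p.2.1.2 - p'.2.1.2))
  - we%:C * (conjc q0 * (p.1.2 - p'.1.2)).
Proof.
case: p => [[[[a1 a2] [b1 b2]] [c1 c2]] [[[d1 d2] [e1 e2]] [f1 f2]]].
case: p' => [[[[a1' a2'] [b1' b2']] [c1' c2']] [[[d1' d2'] [e1' e2']] [f1' f2']]].
case: q1 q2 q0 => [x1 y1] [x2 y2] [x0 y0].
by rewrite /vform /dot2 /=; apply/eqP; rewrite eq_complex /=; apply/andP; split; apply/eqP; ring.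
Qed.

Lemma vform_test2 p p' (q1 q2 q0 : R[i]) :
  vf p ((0, 0, 0), (q1, q2, q0)) - vf p' ((0, 0, 0), (q1, q2, q0)) =
  cm%:C * (conjc q1 * (p.2.1.1 - p'.2.1.1)) + cm%:C * (conjc q2 * (p.2.1.2 - p'.2.1.2))
  - cg%:C * (conjc q2 * (p.1.1.1 - p'.1.1.1)) + cg%:C * (conjc q1 * (p.1.1.2 - p'.1.1.2))
  - wm%:C * (conjc q0 * (p.2.2 - p'.2.2)).
Proof.
case: p => [[[[a1 a2] [b1 b2]] [c1 c2]] [[[d1 d2] [e1 e2]] [f1 f2]]].
case: p' => [[[[a1' a2'] [b1' b2']] [c1' c2']] [[[d1' d2'] [e1' e2']] [f1' f2']]].
case: q1 q2 q0 => [x1 y1] [x2 y2] [x0 y0].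
by rewrite /vform /dot2 /=; apply/eqP; rewrite eq_complex /=; apply/andP; split; apply/eqP; ring.
Qed.

End volume_form_test.

(** * Completeness of the modes *)

Section step_functions.
Context (R : realType).
Implicit Types p q x s : R.

Lemma bernoulli_ge p n : -1 <= p -> 1 + n%:R * p <= (1 + p) ^+ n.
Proof.
move=> p1; elim: n => [|n ih]; first by rewrite mul0r addr0 expr0.
rewrite exprS; have h : 0 <= 1 + p by lra.
apply: le_trans (ler_wpM2l h ih); rewrite -natr1.
have : 0 <= n%:R * (p * p) :> R by rewrite mulr_ge0// -expr2 sqr_ge0.
lra.
Qed.

(** Bernoulli's inequality on both sides: the sequence is at least [1 - (2 p)^n], and at most
    [(2 p)^(- n)] because its product with [(1 + p^n)^(2^n)], which is at least [(2 p)^n], does not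
    exceed 1. Polynomials in [p] thus produce the indicator of a sublevel set. *)
Lemma step_cvg p : 0 <= p <= 1 -> p != 2^-1 ->
  (1 - p ^+ n) ^+ (2 ^ n) @[n --> \oo] --> ((p < 2^-1)%R%:R : R).
Proof.
move=> /andP[p0 p1] p2.
have pn n : 0 <= p ^+ n <= 1 by rewrite exprn_ge0//= exprn_ile1.
have up n : (1 - p ^+ n) ^+ (2 ^ n) <= 1.
  by apply: exprn_ile1; have /andP[? ?] := pn n; lra.
have nn n : 0 <= (1 - p ^+ n) ^+ (2 ^ n).
  by rewrite exprn_ge0//; have /andP[? ?] := pn n; lra.
have [lt|ge] := ltP p 2^-1.
  have lo n : 1 - (2 * p) ^+ n <= (1 - p ^+ n) ^+ (2 ^ n).
    rewrite exprMn -natrX -mulrN; apply: bernoulli_ge.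
    by have /andP[? ?] := pn n; lra.
  apply: (@squeeze_cvgr _ _ _ _ (fun n => 1 - (2 * p) ^+ n) (fun=> 1)).
  - by apply: nearW => n; rewrite lo up.
  - rewrite -[X in _ --> X]subr0; apply: cvgB; first exact: cvg_cst.
    by apply: cvg_expr; rewrite ger0_norm; lra.
  - exact: cvg_cst.
have gt : 2^-1 < p by rewrite lt_neqAle eq_sym p2.
have lo n : (1 - p ^+ n) ^+ (2 ^ n) <= ((2 * p)^-1) ^+ n.
  have q0 : 0 < 2 * p by lra.
  rewrite exprVn -[leRHS]mul1r ler_pdivlMr ?exprn_gt0//.
  have h1 : (2 * p) ^+ n <= (1 + p ^+ n) ^+ (2 ^ n).
    rewrite exprMn -natrX; have := @bernoulli_ge (p ^+ n) (2 ^ n).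
    by have /andP[? ?] := pn n; move=> /(_ _); lra.
  apply: le_trans (ler_wpM2l (nn n) h1) _; rewrite -exprMn; apply: exprn_ile1.
    by have /andP[? ?] := pn n; nra.
  by have /andP[? ?] := pn n; nra.
apply: (@squeeze_cvgr _ _ _ _ (fun=> 0) (fun n => ((2 * p)^-1) ^+ n)).
- by apply: nearW => n; rewrite lo nn.
- exact: cvg_cst.
- apply: cvg_expr; rewrite ger0_norm; last by rewrite invr_ge0; lra.
  by rewrite invf_lt1; lra.
Qed.

(** The points 0 and [s] are symmetric about [s / 2], so on the open period this cosine crosses the
    level [cos (s / 2)] exactly at [s]. *)
Lemma cos_shift_lt x s : 0 < s < 2 * pi -> 0 < x < 2 * pi -> x < s -> cos (s / 2) < cos (x - s / 2).
Proof.
move=> hs hx xs; rewrite -[cos (x - _)]cos_norm ltr_cos; first by rewrite ltr_norml; lra.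
  by rewrite in_itv /= normr_ge0 /= ler_norml; lra.
by rewrite in_itv /=; lra.
Qed.

Lemma cos_shift_gt x s : 0 < s < 2 * pi -> 0 < x < 2 * pi -> s < x -> cos (x - s / 2) < cos (s / 2).
Proof.
move=> hs hx xs; have [le|gt] := leP (x - s / 2) pi.
  by rewrite ltr_cos ?in_itv /=; lra.
have -> : cos (x - s / 2) = cos (2 * pi - (x - s / 2)).
  by rewrite -cosN -[LHS](cosD2piz _ 1); congr cos; rewrite mulr1z mul1r addrC.
by rewrite ltr_cos ?in_itv /=; lra.
Qed.

Lemma trigM (a a' b A B A' B' : R) k k' (x : R * R) :
  trig a' b A' B' k' x * trig a b A B k x =
  trig (a' + a) b ((A' * A - B' * B) / 2) ((A' * B + B' * A) / 2) (k' + k) x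
  + trig (a' - a) b ((A' * A + B' * B) / 2) ((B' * A - A' * B) / 2) (k' + k) x.
Proof.
rewrite /trig !mulrDl !mulNr !exprD cosD sinD cosB sinB.
by field.
Qed.

End step_functions.

(** * From annihilated modes to a null function *)

Section completeness.
Context (R : realType).
Local Notation T2 := (measurableTypeR R * measurableTypeR R)%type.
Local Notation nu := (plane_measure R).
Variables (m b : R) (D : set T2) (h : T2 -> R).
Hypothesis mD : measurable D.
Hypothesis Ds : forall x : R * R, D x -> 0 < x.1 < 2 * pi /\ m <= x.2 <= b.
Hypothesis ih : nu.-integrable D (EFin \o h).
Implicit Types (p q f g : T2 -> R) (B : set T2).

Definition bmeas f := measurable_fun D f /\ exists K, forall x, D x -> `|f x| <= K.

Lemma bmeasD f g : bmeas f -> bmeas g -> bmeas (fun x => f x + g x).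
Proof.
move=> [mf [K hK]] [mg [K' hK']]; split; first exact: measurable_funD.
by exists (K + K') => x xD; rewrite (le_trans (ler_normD _ _))// lerD ?hK ?hK'.
Qed.

Lemma bmeasM f g : bmeas f -> bmeas g -> bmeas (fun x => f x * g x).
Proof.
move=> [mf [K hK]] [mg [K' hK']]; split; first exact: measurable_funM.
by exists (K * K') => x xD; rewrite normrM ler_pM ?hK ?hK'.
Qed.

Lemma bmeas_trig (a A A' : R) k : bmeas (trig a b A A' k : T2 -> R).
Proof.
split; first exact: measurable_funTS (continuous_measurable_plane (@continuous_trig _ a b A A' k)).
by exists ((`|A| + `|A'|) * (b - m) ^+ k) => x /Ds[_]; exact: trig_bounded.
Qed.

Lemma bmeas_ext f g : (forall x, D x -> f x = g x) -> bmeas f -> bmeas g.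
Proof.
move=> fg [mf [K hK]]; split.
  by apply: (eq_measurable_fun f) => // x; rewrite inE => /fg.
by exists K => x xD; rewrite -fg// hK.
Qed.

Lemma integrable_bmeas f : bmeas f -> nu.-integrable D (EFin \o (fun x => h x * f x)).
Proof.
move=> [mf [K hK]].
have bf : [bounded f x | x in D].
  by exists K; split; [exact: num_real|move=> y Ky x xD; exact: le_trans (hK x xD) (ltW Ky)].
by apply: eq_integrable (integrableMl mD ih mf bf).
Qed.

(** The product [h * f] is orthogonal to every [trig] of integer frequency. Asking this for all of
    them at once makes the class stable under multiplication by any one. *)
Definition annih f := bmeas f /\ forall (n : int) (A A' : R) k,
  (\int[nu]_(x in D) (h x * (f x * trig n%:~R b A A' k x))%:E = 0)%E.

Lemma annih_ext f g : (forall x, D x -> f x = g x) -> annih f -> annih g.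
Proof.
move=> fg [bf hf]; split; first exact: bmeas_ext bf.
by move=> n A A' k; rewrite -[RHS](hf n A A' k); apply: eq_integral => x; rewrite inE => /fg ->.
Qed.

Lemma annihD f g : annih f -> annih g -> annih (fun x => f x + g x).
Proof.
move=> [bf hf] [bg hg]; split; first exact: bmeasD.
move=> n A A' k; have bt := bmeas_trig n%:~R A A' k.
have i1 := integrable_bmeas (bmeasM bf bt); have i2 := integrable_bmeas (bmeasM bg bt).
have := integralD mD i1 i2; rewrite /= hf hg adde0 => <-.
by apply: eq_integral => x _; rewrite /= -EFinD; congr (_%:E); ring.
Qed.

Lemma annih_trig f (n : int) A A' k : annih f -> annih (fun x => trig n%:~R b A A' k x * f x).
Proof.
move=> [bf hf]; split; first exact: bmeasM (bmeas_trig _ _ _ _) bf.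
move=> n' C C' k'.
pose F l P Q := fun x : T2 => h x * (f x * trig l b P Q (k + k') x).
have i l P Q := integrable_bmeas (bmeasM bf (bmeas_trig l P Q (k + k'))).
have E x : h x * (trig n%:~R b A A' k x * f x * trig n'%:~R b C C' k' x) =
    F (n%:~R + n'%:~R) ((A * C - A' * C') / 2) ((A * C' + A' * C) / 2) x +
    F (n%:~R - n'%:~R) ((A * C + A' * C') / 2) ((A' * C - A * C') / 2) x.
  by rewrite /F -mulrDr -mulrDr -trigM; ring.
under eq_integral do rewrite E EFinD.
rewrite (integralD mD (i _ _ _) (i _ _ _)) /F /= -rmorphD -rmorphB /= hf.
by rewrite hf adde0.
Qed.

(* The sets whose indicator is a multiplier form a sigma-algebra, because multipliers are closed
   under products, complements and bounded almost everywhere limits. *)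
Definition mult p := forall f, annih f -> annih (fun x => p x * f x).

Lemma mult_ext p q : (forall x, D x -> p x = q x) -> mult p -> mult q.
Proof. by move=> pq hp f /hp; apply: annih_ext => x /pq ->. Qed.

Lemma mult_trig (n : int) A A' k : mult (trig n%:~R b A A' k : T2 -> R).
Proof. by move=> f; exact: annih_trig. Qed.

Lemma mult_cst (r : R) : mult (fun=> r).
Proof.
apply: mult_ext (mult_trig 0 r 0 0) => x _.
by rewrite /trig mulr0z !mul0r cos0 expr0 addr0 !mulr1.
Qed.

Lemma multD p q : mult p -> mult q -> mult (fun x => p x + q x).
Proof.
move=> hp hq f hf; apply: annih_ext (annihD (hp f hf) (hq f hf)) => x _.
by rewrite mulrDl.
Qed.

Lemma multM p q : mult p -> mult q -> mult (fun x => p x * q x).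
Proof. by move=> hp hq f hf; apply: annih_ext (hp _ (hq f hf)) => x _; rewrite mulrA. Qed.

Lemma mult1B p : mult p -> mult (fun x => 1 - p x).
Proof.
move=> hp; apply: mult_ext (multD (mult_cst 1) (multM (mult_cst (-1)) hp)) => x _.
by rewrite mulN1r.
Qed.

Lemma multX p n : mult p -> mult (fun x => p x ^+ n).
Proof.
move=> hp; elim: n => [|n ih']; first by apply: mult_ext (mult_cst 1) => x _.
by apply: mult_ext (multM hp ih') => x _; rewrite exprS.
Qed.

Lemma mult_lim (p_ : nat -> T2 -> R) p : (forall n, mult (p_ n)) ->
  (forall n, measurable_fun D (p_ n)) -> measurable_fun D p ->
  (forall n x, D x -> `|p_ n x| <= 1) -> (forall x, D x -> `|p x| <= 1) ->
  {ae nu, forall x, D x -> p_ n x @[n --> \oo] --> p x} -> mult p.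
Proof.
move=> hp_ mp_ mp p1_ p1 cp f hf; have [bf _] := hf.
have bp : bmeas p by split=> //; exists 1.
split; first exact: bmeasM.
move=> n A A' k; have bt := bmeas_trig n%:~R A A' k.
pose F q := fun x : T2 => h x * (q x * f x * trig n%:~R b A A' k x).
have mh : measurable_fun D h by apply/measurable_EFinP; exact: (measurable_int nu).
have iw := integrable_bmeas (bmeasM bf bt).
have mF q : measurable_fun D q -> measurable_fun D (EFin \o F q).
  move=> mq; apply/measurable_EFinP; apply: measurable_funM => //.
  by apply: measurable_funM; [apply: measurable_funM; [|exact: bf.1]|exact: bt.1].
have [] := @dominated_convergence _ _ _ nu D mD (fun j => EFin \o F (p_ j)) (EFin \o F p)
  (fun x => `|(h x * (f x * trig n%:~R b A A' k x))%:E|%E).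
- by move=> j; exact: mF.
- exact: mF.
- apply: filterS cp => x cx /cx cx' /=; apply: cvg_EFin; first exact: nearW.
  rewrite /F /=; apply: cvgM; first exact: cvg_cst.
  by apply: cvgM; [apply: cvgM; [exact: cx'|exact: cvg_cst]|exact: cvg_cst].
- exact: (integrable_abse iw).
- apply/nearW => x j xD /=; rewrite lee_fin /F.
  rewrite (_ : _ * (_ * _ * _) = p_ j x * (h x * (f x * trig n%:~R b A A' k x))); last by ring.
  by rewrite normrM ler_piMl// p1_.
move=> _ _; rewrite (_ : (fun j => _) = fun=> 0%E); last first.
  by apply/funext => j; have [_ ->] := hp_ j f hf.
by move=> /(cvg_unique _ (cvg_cst _)) <-.
Qed.

(** The polynomials [(1 - p^n)^(2^n)] are multipliers and tend to the indicator away from [p = 1/2].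
    On that level set the limit would be [1/e], hence the assumption that it is negligible. *)
Lemma mult_step p : mult p -> measurable_fun D p -> (forall x, D x -> 0 <= p x <= 1) ->
  nu.-negligible (D `&` [set x | p x = 2^-1]) -> mult (fun x => (p x < 2^-1)%R%:R).
Proof.
move=> hp mp p01 neg.
apply: (@mult_lim (fun n x => (1 - p x ^+ n) ^+ (2 ^ n))).
- by move=> n; apply: multX; apply: mult1B; exact: multX.
- move=> n; apply: measurable_funX; apply: measurable_funB => //; exact: measurable_funX.
- have mlt := @measurable_fun_ltr _ _ _ D _ _ mp (@measurable_cst _ _ _ _ D (2^-1 : R)).
  by apply: (@measurableT_comp _ _ _ _ _ _ (fun b : bool => b%:R : R)) mlt.
- move=> n x /p01 /andP[p0 p1].
  have /andP[q0 q1] : 0 <= p x ^+ n <= 1 by rewrite exprn_ge0//= exprn_ile1.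
  by rewrite ger0_norm ?exprn_ge0 ?exprn_ile1//; lra.
- by move=> x _; case: ltP; rewrite ?normr1 ?normr0.
- apply: negligibleS neg => x /= /not_implyP[xD hx]; split => //=.
  by apply: contrapT => /eqP px; apply: hx; exact: step_cvg (p01 x xD) px.
Qed.

Lemma negligible_line1 (s : R) : nu.-negligible [set x : T2 | x.1 = s].
Proof.
exists ([set s] `*` setT); split; first exact: measurableX.
  by rewrite plane_measureX// lebesgue_measure_set1 mul0e.
by move=> x /= ->.
Qed.

Lemma negligible_line2 (s : R) : nu.-negligible [set x : T2 | x.2 = s].
Proof.
exists (setT `*` [set s]); split; first exact: measurableX.
  by rewrite plane_measureX// lebesgue_measure_set1 mule0.
by move=> x /= ->.
Qed.

Lemma mult_ray1 (s : R) : mult (fun x => (x.1 < s)%R%:R).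
Proof.
have [s0|s0] := leP s 0.
  apply: mult_ext (mult_cst 0) => x /Ds[/andP[x1 _] _].
  by rewrite ltNge (le_trans s0 (ltW x1)).
have [s1|s1] := leP (2 * pi) s.
  apply: mult_ext (mult_cst 1) => x /Ds[/andP[_ x1] _].
  by rewrite (lt_le_trans x1 s1).
(* A trigonometric polynomial of degree one that is below 1/2 exactly for [x.1 < s]; the factor 1/4
   keeps it in [[0, 1]]. *)
pose p : T2 -> R := fun x => 2^-1 + (cos (s / 2) - cos (x.1 - s / 2)) / 4.
have hs : 0 < s < 2 * pi by rewrite s0.
have pE x : p x = trig 0%:~R b (2^-1 + cos (s / 2) / 4) 0 0 x +
    trig 1%:~R b (- (cos (s / 2) / 4)) (- (sin (s / 2) / 4)) 0 x.
  rewrite /p /trig mulr0z mulr1z !mul0r mul1r cos0 cosB expr0; ring.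
have mp : measurable_fun D p.
  apply: (eq_measurable_fun _ _ (bmeasD (bmeas_trig 0%:~R (2^-1 + cos (s / 2) / 4) 0 0)
    (bmeas_trig 1%:~R (- (cos (s / 2) / 4)) (- (sin (s / 2) / 4)) 0)).1) => x _.
  by rewrite pE.
apply: mult_ext (_ : mult (fun x => (p x < 2^-1)%R%:R)).
  move=> x /Ds[hx _]; congr (nat_of_bool _)%:R; rewrite /p.
  have [lt|gt|->] := ltgtP (x : R * R).1 s.
  - by have := cos_shift_lt hs hx lt; lra.
  - by apply/negbTE; rewrite -leNgt; have := cos_shift_gt hs hx gt; lra.
  - by rewrite (_ : s - s / 2 = s / 2) ?subrr ?mul0r ?addr0 ?ltxx//; field.
apply: mult_step => //.
- apply: mult_ext (multD (mult_trig 0 _ 0 0) (mult_trig 1 _ _ 0)) => x _; exact/esym/pE.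
- move=> x _; rewrite /p; have := cos_max (s / 2); have := cos_max ((x : R * R).1 - s / 2).
  by rewrite !ler_norml; lra.
- apply: negligibleS (negligible_line1 s) => x [/Ds[hx _] /= px].
  move: px; rewrite /p; have [lt|gt|//] := ltgtP (x : R * R).1 s.
    by have := cos_shift_lt hs hx lt; lra.
  by have := cos_shift_gt hs hx gt; lra.
Qed.

Lemma mult_ray2 (s : R) : mult (fun x => (x.2 < s)%R%:R).
Proof.
(* On [D] the distance from [x.2] to [s] is at most [C], which keeps the affine function [p] in
   [[0, 1]]. *)
pose C := `|m| + `|b| + `|s| + 1.
have C0 : 0 < C by rewrite ltr_wpDl// !addr_ge0.
pose p : T2 -> R := fun x => 2^-1 + (x.2 - s) / (2 * C).
have pE x : p x = trig 0%:~R b (2^-1 + (b - s) / (2 * C)) 0 0 x +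
    trig 0%:~R b (- (2 * C)^-1) 0 1 x.
  rewrite /p /trig mulr0z !mul0r cos0 expr0 expr1; ring.
have mp : measurable_fun D p.
  apply: (eq_measurable_fun _ _ (bmeasD (bmeas_trig 0%:~R (2^-1 + (b - s) / (2 * C)) 0 0)
    (bmeas_trig 0%:~R (- (2 * C)^-1) 0 1)).1) => x _.
  by rewrite pE.
have C2 : 0 < (2 * C)^-1 by rewrite invr_gt0 mulr_gt0.
apply: mult_ext (_ : mult (fun x => (p x < 2^-1)%R%:R)).
  move=> x _; congr (nat_of_bool _)%:R.
  by rewrite /p gtrDl pmulr_llt0// subr_lt0.
apply: mult_step => //.
- apply: mult_ext (multD (mult_trig 0 _ 0 0) (mult_trig 0 _ _ 1)) => x _; exact/esym/pE.
- move=> x /Ds[_ /andP[x1 x2]].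
  have xs : `|(x : R * R).2 - s| <= C.
    rewrite /C ler_norml; have := ler_norm m; have := ler_norm (- m); have := ler_norm b.
    have := ler_norm (- b); have := ler_norm s; have := ler_norm (- s); rewrite !normrN.
    have := normr_ge0 m; have := normr_ge0 b; lra.
  have : `|((x : R * R).2 - s) / (2 * C)| <= 2^-1.
    rewrite normrM (gtr0_norm C2) ler_pdivrMr ?mulr_gt0// mulrA mulVf ?mul1r//.
  by rewrite /p ler_norml; lra.
- apply: negligibleS (negligible_line2 s) => x [_ /= px].
  have /eqP : ((x : R * R).2 - s) / (2 * C) = 0 by move: px; rewrite /p; lra.
  by rewrite mulf_eq0 (gt_eqF C2) orbF subr_eq0 => /eqP.
Qed.

Definition mult_set B := measurable B /\ mult (\1_B : T2 -> R).

Lemma mult_setC B : mult_set B -> mult_set (~` B).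
Proof.
move=> [mB hB]; split; first exact: measurableC.
apply: mult_ext (mult1B hB) => x _; rewrite !indicE in_setC.
by case: (x \in B); rewrite ?subrr ?subr0.
Qed.

Lemma mult_setU A B : mult_set A -> mult_set B -> mult_set (A `|` B).
Proof.
move=> [mA hA] [mB hB]; split; first exact: measurableU.
apply: mult_ext (mult1B (multM (mult1B hA) (mult1B hB))) => x _; rewrite !indicE in_setU.
by case: (x \in A); case: (x \in B); rewrite /= ?subrr ?subr0 ?mul0r ?mulr0 ?mulr1 ?subr0 ?subrr.
Qed.

Lemma mult_set0 : mult_set set0.
Proof. by split=> //; apply: mult_ext (mult_cst 0) => x _; rewrite indic0. Qed.

Lemma mult_bigcup (A : (set T2)^nat) : (forall n, mult_set (A n)) -> mult_set (\bigcup_k A k).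
Proof.
move=> hA; have mA : measurable (\bigcup_k A k) by apply: bigcup_measurable => k _; have [] := hA k.
have hU n : mult_set (\bigcup_(k < n) A k).
  elim: n => [|n ih']; first by rewrite bigcup_mkord big_ord0; exact: mult_set0.
  rewrite bigcup_mkord big_ord_recr /= -bigcup_mkord; exact: mult_setU.
split=> //; apply: (@mult_lim (fun n => \1_(\bigcup_(k < n) A k))).
- by move=> n; exact: (hU n).2.
- by move=> n; apply: measurable_indic; exact: (hU n).1.
- exact: measurable_indic.
- by move=> n x _; rewrite indicE; case: (_ \in _); rewrite ?normr1 ?normr0.
- by move=> x _; rewrite indicE; case: (_ \in _); rewrite ?normr1 ?normr0.
- apply/nearW => x _; have [[k _ Ak]|nx] := pselect ((\bigcup_k A k) x).
    rewrite indicE mem_set; last by exists k.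
    apply: cvg_near_cst; exists k.+1 => // n /= kn.
    by rewrite indicE mem_set//; exists k.
  rewrite indicE memNset//; apply: cvg_near_cst; apply: nearW => n.
  by rewrite indicE memNset// => -[k _ Ak]; apply: nx; exists k.
Qed.

(** Two generation steps: rays generate the measurable sets of the line, and preimages of these
    under the two projections generate the product sigma-algebra. *)
Lemma mult_set_measurable B : measurable B -> mult_set B.
Proof.
have line (pr : T2 -> measurableTypeR R) : measurable_fun setT pr ->
    (forall s : R, mult (fun x => (pr x < s)%R%:R)) ->
    forall A : set (measurableTypeR R), measurable A -> mult_set (pr @^-1` A).
  move=> mpr ray A mA; have {mA} : (RGenInftyO.G (R:=R)).-sigma.-measurable A.
    by rewrite -RGenInftyO.measurableE.
  move: A.
  apply: (@smallest_sub _ (sigma_algebra setT) _ [set A | mult_set (pr @^-1` A)]).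
    split=> [|A' hA'|A' hA'] /=.
    - by rewrite preimage_set0; exact: mult_set0.
    - by rewrite setTD preimage_setC; exact: mult_setC.
    - by rewrite preimage_bigcup; exact: mult_bigcup.
  move=> _ [s ->] /=; split; first by rewrite -[X in measurable X]setTI; apply: mpr.
  apply: mult_ext (ray s) => x _; rewrite indicE; congr (nat_of_bool _)%:R.
  by apply/idP/idP; rewrite inE /= in_itv.
apply: (@smallest_sub _ (sigma_algebra setT) _ mult_set).
  split=> [|A' hA'|A' hA'] /=; first exact: mult_set0.
    by rewrite setTD; exact: mult_setC.
  exact: mult_bigcup.
move=> _ [[A mA <-]|[A mA <-]]; rewrite setTI; apply: line => //.
- exact: mult_ray1.
- exact: mult_ray2.
Qed.

(** With [B] the part of [D] where [h] is positive, [|h|] equals [2 h 1_B - h], and both summands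
    integrate to 0 because the indicator of [B] is a multiplier. *)
Lemma complete_trig : annih (fun=> 1) -> {ae nu, forall x, D x -> h x = 0}.
Proof.
move=> a1; pose B : set T2 := D `&` h @^-1` `]0, +oo[%classic.
have mh : measurable_fun D h by apply/measurable_EFinP; exact: (measurable_int nu).
have mB : measurable B by apply: mh.
have one f : annih f -> (\int[nu]_(x in D) (h x * f x)%:E = 0)%E.
  move=> [_ hf]; rewrite -[RHS](hf 0 1 0 0%N); apply: eq_integral => x _.
  by rewrite /trig mulr0z !mul0r cos0 expr0 addr0 !mulr1.
have hB := one _ ((mult_set_measurable mB).2 _ a1).
have h1 := one _ a1.
have iB := integrable_bmeas ((mult_set_measurable mB).2 _ a1).1.
have i1 := integrable_bmeas a1.1.
have habs : (\int[nu]_(x in D) `|(h x)%:E| = 0)%E.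
  have := integralB mD (integrableZl mD 2 iB) i1.
  rewrite /= integralZl//= hB h1 mule0 subee// => <-.
  apply: eq_integral => x; rewrite inE => xD; rewrite /= -EFinM -EFinB; congr (_%:E).
  rewrite indicE !mulr1; have [hx|hx] := ltP 0 (h x).
    rewrite mem_set; last by split => //=; rewrite in_itv /= hx.
    by rewrite (gtr0_norm hx) mulr1; ring.
  rewrite memNset; last by move=> [_ /=]; rewrite in_itv /= andbT ltNge hx.
  by rewrite (ler0_norm hx) mulr0; ring.
have := (ae_eq_integral_abs nu mD (measurable_int nu ih)).1 habs.
by apply: filterS => x hx /hx [].
Qed.

End completeness.

(** * The grating problem *)

Section grating_problem.
Context (R : realType) (G : grating R) (M L : R).
Hypothesis M0 : 0 < M.
Hypothesis cM : lipschitz_coords (profile G) M.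
Hypothesis L0 : 0 < L.
Hypothesis cL : shift_periodic (profile G) L.
Hypothesis cb : forall t, (profile G t).2 < height G.
Hypothesis omega0 : 0 < omega G.
Hypothesis eps0 : 0 < eps G.
Hypothesis mu0 : 0 < mu G.
Hypothesis kappa0 : 0 < kappa G.
Hypothesis lambda0 : lambda G < 0.

Local Notation c := (profile G).
Local Notation b := (height G).
Local Notation leb := (@lebesgue_measure R).
Local Notation nu := (plane_measure R).
Local Notation W := (Omega_b G).
Local Notation Gam := (Gamma_param G).
Local Notation T2 := (measurableTypeR R * measurableTypeR R)%type.
Local Notation psi n k := (mode (- alpha_n G n) (height G) k).

Lemma measurable_Omega_b : measurable (W : set T2).
Proof. exact: (measurable_cell_domain b M0 cM L0 cL). Qed.

Lemma Omega_b_finite : (nu W < +oo)%E.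
Proof. exact: (cell_domain_finite b M0 cM L0 cL). Qed.

Lemma measurable_periodic_domain : measurable (periodic_domain G : set T2).
Proof. exact: (measurable_half_domain b M0 cM L0 cL). Qed.

Lemma Omega_b_sub : W `<=` periodic_domain G.
Proof. by move=> x []. Qed.

Lemma measurable_Gamma : measurable (Gam : set (measurableTypeR R)).
Proof. exact: (measurable_fundamental_param M0 cM). Qed.

Lemma Gamma_finite : (leb Gam < +oo)%E.
Proof. exact: (fundamental_param_finite M0 cM L0 cL). Qed.

Lemma low_bound : exists m : R, (forall x, W x -> m <= x.2 <= b) /\ (forall t, m <= (c t).2 <= b).
Proof.
have [m0 hm] := above_bounded_below M0 cM L0 cL.
have [B B0 hB] := profile_height M0 cM L0 cL.
exists (Num.min m0 (- B)); split.
  by move=> x [[/hm mx xb] _]; rewrite ge_min mx (ltW xb).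
move=> t; rewrite ge_min (ltW (cb t)) andbT; apply/orP; right.
by have := hB t; rewrite ler_norml => /andP[].
Qed.

Lemma quasiperiodic_shift a (w : R * R -> R[i]) : quasiperiodic a setT w ->
  forall x, w (x.1 + 2 * pi, x.2) = cis (a * (2 * pi)) * w x.
Proof.
move=> hw x; have := congr1 (fun z => cis (a * (x.1 + 2 * pi)) * z) (hw x I).
rewrite !mulrA -!cisD subrr cis0 mul1r => ->; congr (cis _ * _); ring.
Qed.

(** The conjugate frequency [- alpha_n] makes the product of [psi n k] with an alpha-quasiperiodic
    function truly periodic, as [green_C1] requires. *)
Lemma mode_shift (n : int) k x :
  mode (- alpha_n G n) b k (x.1 + 2 * pi, x.2) = cis (- (alpha G * (2 * pi))) * mode (- alpha_n G n) b k x.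
Proof.
rewrite /mode /= mulrA -cisD; congr (_ * _).
rewrite -[RHS](cisD2piz _ (- n)); congr cis.
by rewrite /alpha_n mulrNz; ring.
Qed.

Lemma mode_top a k x1 : (0 < k)%N -> mode a b k (x1, b) = 0.
Proof. by move=> k0; rewrite /mode /= subrr expr0n gtn_eqF// mulr0. Qed.

Lemma green_mode : exists2 C : R, 0 <= C & forall (w : R * R -> R[i]) (n : int) k j,
  cC1 w -> quasiperiodic (alpha G) setT w -> (0 < k)%N ->
  let psi := mode (- alpha_n G n) b k in
  let Y := cint nu W (fun x => cpd j w x * psi x + w x * cpd j psi x) in
  `|complex.Re Y| <= C * \int[leb]_(t in Gam) `|complex.Re (w (c t) * psi (c t))| /\
  `|complex.Im Y| <= C * \int[leb]_(t in Gam) `|complex.Im (w (c t) * psi (c t))|.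
Proof.
have [C C0 hC] := green_C1 M0 cM L0 cL cb.
exists C => // w n k j cw qw k0 psi Y.
have [[f1 f2 cf1 cf2] e] := cC1M cw (cC1_smooth (csmooth_mode (- alpha_n G n) b k)).
have per x : w (x.1 + 2 * pi, x.2) * psi (x.1 + 2 * pi, x.2) = w x * psi x.
  by rewrite (quasiperiodic_shift qw) /psi mode_shift mulrACA -cisD subrr cis0 mul1r.
have top x1 : w (x1, b) * psi (x1, b) = 0 by rewrite /psi mode_top// mulr0.
have YE : Y = cint nu W (cpd j (fun x => w x * psi x)).
  by apply: eq_cint => x _; rewrite e addrC.
rewrite YE; split.
- apply: (hC (fun x => complex.Re (w x * psi x)) j f1) => x; first by rewrite per.
  by rewrite top.
- apply: (hC (fun x => complex.Im (w x * psi x)) j f2) => x; first by rewrite per.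
  by rewrite top.
Qed.

Lemma mode_bounded a k : exists2 K : R, 0 <= K & forall j x, (W x \/ range c x) ->
  (`|complex.Re (mode a b k x)| <= K /\ `|complex.Im (mode a b k x)| <= K) /\
  (`|complex.Re (cpd j (mode a b k) x)| <= K /\ `|complex.Im (cpd j (mode a b k) x)| <= K).
Proof.
have [m [hW hc]] := low_bound.
have mb : m <= b by have /andP[h1 h2] := hc 0; exact: le_trans h2.
pose q l := (b - m) ^+ l.
have q0 l : 0 <= q l by rewrite exprn_ge0// subr_ge0.
exists (q k + `|a| * q k + k%:R * q k.-1).
  by rewrite !addr_ge0// mulr_ge0.
move=> j x hx.
have {}hx : m <= x.2 <= b by case: hx => [/hW//|[t _ <-]].
have hm l : `|complex.Re (mode a b l x)| <= q l /\ `|complex.Im (mode a b l x)| <= q l.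
  rewrite mode_Re mode_Im; split; apply: le_trans (trig_bounded _ _ _ _ hx) _;
  by rewrite normr0 normr1 ?addr0 ?add0r mul1r.
have [h1 h2] := hm k; have [h3 h4] := hm k.-1.
have a0 : 0 <= `|a| * q k by rewrite mulr_ge0.
have k0 : 0 <= k%:R * q k.-1 by rewrite mulr_ge0.
split; first by split; have := q0 k; lra.
case: j.
  rewrite cpd_mode2; move: h3 h4; case: (mode a b k.-1 x) => u v /= h3 h4.
  rewrite !(mul0r, subr0, addr0, oppr0).
  have e1 : `|k%:R * u| <= k%:R * q k.-1 by rewrite normrM normr_nat ler_wpM2l.
  have e2 : `|k%:R * v| <= k%:R * q k.-1 by rewrite normrM normr_nat ler_wpM2l.
  have := q0 k; rewrite !mulNr !normrN; lra.
rewrite cpd_mode1; move: h1 h2; case: (mode a b k x) => u v /= h1 h2.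
rewrite !(mul0r, sub0r, add0r) normrN.
have e1 : `|a * u| <= `|a| * q k by rewrite normrM ler_wpM2l.
have e2 : `|a * v| <= `|a| * q k by rewrite normrM ler_wpM2l.
have := q0 k; lra.
Qed.

(* Integration by parts over [Omega_b]: the boundary terms on [Gamma] vanish because the traces
   agree there, those on [Gamma_b] because of the factor [(b - x_2)^k], and those on the vertical
   sides by quasiperiodicity. *)
Lemma green_H1 (U U' : h1fun R) (n : int) k j : H1_alpha G U -> H1_alpha G U' -> (0 < k)%N ->
  sqL2 leb Gam (fun t => trace U (c t) - trace U' (c t)) = 0%E ->
  let psi := mode (- alpha_n G n) b k in
  cint nu W (fun x => (fpd U j x - fpd U' j x) * psi x +
     (fval U x - fval U' x) * cpd j psi x) = 0.
Proof.
move=> [[_ mU sU] dU [mtU _] _ [w [hw [w0 w1 wG _]]]].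
move=> [[_ mU' sU'] dU' [mtU' _] _ [w' [hw' [w0' w1' wG' _]]]] k0 tr0 psi.
have mW := measurable_Omega_b; have fW := Omega_b_finite.
have mGam := measurable_Gamma; have fGam := Gamma_finite.
have [C C0 hC] := green_mode.
have [K K0 hK] := mode_bounded (- alpha_n G n) k.
pose psi' := cpd j psi.
set X := cint _ _ _.
have sub (f : T2 -> R[i]) : cmeasurable (periodic_domain G : set T2) f -> cmeasurable (W : set T2) f.
  by move=> [f1 f2]; split; [apply: measurable_funS f1|apply: measurable_funS f2];
    try exact: Omega_b_sub; exact: measurable_periodic_domain.
have {}mU := sub _ mU; have {}mU' := sub _ mU'.
have mp : cmeasurable (W : set T2) (fpd U j) by have [[_ /sub]] := dU j.
have mp' : cmeasurable (W : set T2) (fpd U' j) by have [[_ /sub]] := dU' j.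
have csm := csmooth_mode (- alpha_n G n) b k.
have mpsi : cmeasurable (W : set T2) psi.
  by apply: continuous_cmeasurable; [exact: (csm.1 [::]).1|exact: (csm.2 [::]).1].
have mpsi' : cmeasurable (W : set T2) psi'.
  by apply: continuous_cmeasurable; [exact: (csm.1 [:: j]).1|exact: (csm.2 [:: j]).1].
have mw m : cmeasurable (W : set T2) (w m) /\ cmeasurable (W : set T2) (cpd j (w m)).
  have [[s1 s2] _] := hw m.
  by split; apply: continuous_cmeasurable; [exact: (s1 [::]).1|exact: (s2 [::]).1|exact: (s1 [:: j]).1|exact: (s2 [:: j]).1].
have mw' m : cmeasurable (W : set T2) (w' m) /\ cmeasurable (W : set T2) (cpd j (w' m)).
  have [[s1 s2] _] := hw' m.
  by split; apply: continuous_cmeasurable; [exact: (s1 [::]).1|exact: (s2 [::]).1|exact: (s1 [:: j]).1|exact: (s2 [:: j]).1].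
have L2psi : in_L2 nu W psi.
  apply: (@in_L2_bounded _ _ _ _ _ mW psi (K ^+ 2 + K ^+ 2)) => // x xW.
  have [[h1 h2] _] := hK j x (or_introl xW).
  by rewrite lerD// -[leLHS]real_normK ?num_real// lerXn2r// nnegrE.
have L2psi' : in_L2 nu W psi'.
  apply: (@in_L2_bounded _ _ _ _ _ mW psi' (K ^+ 2 + K ^+ 2)) => // x xW.
  have [_ [h1 h2]] := hK j x (or_introl xW).
  by rewrite lerD// -[leLHS]real_normK ?num_real// lerXn2r// nnegrE.
pose mu1 := fine (nu W); pose mu2 := fine (leb Gam).
(* Four approximation errors over the domain, plus Green's constant times a boundary integral whose
   trace error is [3 * e]. *)
pose Cst := 4 * (K * (2 * mu1 + 1)) + C * (K * (2 * mu2 + 1) * 3).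
suff key e : 0 < e -> `|complex.Re X| <= Cst * e /\ `|complex.Im X| <= Cst * e.
  have h1 : complex.Re X = 0 by apply: (@eq0_of_small _ _ Cst) => e /key[].
  have h2 : complex.Im X = 0 by apply: (@eq0_of_small _ _ Cst) => e /key[].
  by apply/eqP; rewrite eq_complex h1 h2 !eqxx.
move=> e0.
have [m [[[a1 a2] [a3 a4]] [a5 a6]]] : exists m,
   (((sqL2 nu W (fun x => w m x - fval U x)%R <= (e ^+ 2)%:E)%E /\
    (sqL2 nu W (fun x => w' m x - fval U' x)%R <= (e ^+ 2)%:E)%E) /\
   ((sqL2 nu W (fun x => cpd j (w m) x - fpd U j x)%R <= (e ^+ 2)%:E)%E /\
    (sqL2 nu W (fun x => cpd j (w' m) x - fpd U' j x)%R <= (e ^+ 2)%:E)%E)) /\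
   ((sqL2 leb Gam (fun t => w m (c t) - trace U (c t))%R <= (e ^+ 2)%:E)%E /\
    (sqL2 leb Gam (fun t => w' m (c t) - trace U' (c t))%R <= (e ^+ 2)%:E)%E).
  have n1 := cvg_sqL2_le e0 w0; have n2 := cvg_sqL2_le e0 w0'.
  have n3 := cvg_sqL2_le e0 (w1 j); have n4 := cvg_sqL2_le e0 (w1' j).
  have n5 := cvg_sqL2_le e0 wG; have n6 := cvg_sqL2_le e0 wG'.
  apply: (@filter_ex _ (nbhs \oo)); near=> m.
  by split; [split; split|split]; near: m.
have ltoo (x : \bar R) : (x <= (e ^+ 2)%:E)%E -> (x < +oo)%E by move=> h; rewrite (le_lt_trans h) ?ltry.
pose A1 x := w m x - fval U x; pose A2 x := w' m x - fval U' x.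
pose A3 x := cpd j (w m) x - fpd U j x; pose A4 x := cpd j (w' m) x - fpd U' j x.
have mA1 : cmeasurable (W : set T2) A1 by apply: cmeasurableD; [exact: (mw m).1|exact: cmeasurableN].
have mA2 : cmeasurable (W : set T2) A2 by apply: cmeasurableD; [exact: (mw' m).1|exact: cmeasurableN].
have mA3 : cmeasurable (W : set T2) A3 by apply: cmeasurableD; [exact: (mw m).2|exact: cmeasurableN].
have mA4 : cmeasurable (W : set T2) A4 by apply: cmeasurableD; [exact: (mw' m).2|exact: cmeasurableN].
have L1 : in_L2 nu W A1 by split=> //; exact: ltoo.
have L2 : in_L2 nu W A2 by split=> //; exact: ltoo.
have L3 : in_L2 nu W A3 by split=> //; exact: ltoo.
have L4 : in_L2 nu W A4 by split=> //; exact: ltoo.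
pose dd x := w m x - w' m x.
have [cdd edd] := cC1B (cC1_smooth (hw m).1) (cC1_smooth (hw' m).1).
have qdd : quasiperiodic (alpha G) setT dd.
  move=> x _; rewrite /dd !mulrBr; congr (_ - _); first exact: (hw m).2.
  exact: (hw' m).2.
(* The same integral for the smooth approximations, to which [green_mode] applies. It differs from
   [X] only by the errors [z1] to [z4]. *)
set Y := cint nu W (fun x => cpd j dd x * psi x + dd x * psi' x).
have i1 := in_L2M mW L1 L2psi'; have i2 := in_L2M mW L2 L2psi'.
have i3 := in_L2M mW L3 L2psi; have i4 := in_L2M mW L4 L2psi.
have LU : in_L2 nu W (fval U) by split.
have LU' : in_L2 nu W (fval U') by split.
have LP : in_L2 nu W (fpd U j) by split=> //; have [[]] := dU j.
have LP' : in_L2 nu W (fpd U' j) by split=> //; have [[]] := dU' j.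
have iP := in_L2M mW (in_L2B mW LP LP') L2psi.
have iV := in_L2M mW (in_L2B mW LU LU') L2psi'.
have XE : X = cint nu W (fun x => (fpd U j x - fpd U' j x) * psi x) +
    cint nu W (fun x => (fval U x - fval U' x) * psi' x) by exact: cintD.
pose z1 := cint nu W (fun x => A1 x * psi' x).
pose z2 := cint nu W (fun x => A2 x * psi' x).
pose z3 := cint nu W (fun x => A3 x * psi x).
pose z4 := cint nu W (fun x => A4 x * psi x).
have YE : Y = X + (z1 - z2) + (z3 - z4).
  have h0 := cintegrableD mW iP iV; have h12 := cintegrableB mW i1 i2.
  have h34 := cintegrableB mW i3 i4; have h01 := cintegrableD mW h0 h12.
  rewrite XE -(cintB mW i1 i2) -(cintB mW i3 i4) -(cintD mW iP iV) -(cintD mW h0 h12).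
  rewrite -(cintD mW h01 h34).
  apply: eq_cint => x _; rewrite edd /A1 /A2 /A3 /A4 /dd; ring.
have W1 x : W x -> `|complex.Re (psi x)| <= K /\ `|complex.Im (psi x)| <= K.
  by move=> xW; have [] := hK j x (or_introl xW).
have W2 x : W x -> `|complex.Re (psi' x)| <= K /\ `|complex.Im (psi' x)| <= K.
  by move=> xW; have [] := hK j x (or_introl xW).
have [r1 t1] : `|complex.Re z1| <= K * (2 * mu1 + 1) * e /\ `|complex.Im z1| <= K * (2 * mu1 + 1) * e :=
  cint_mul_small mW fW e0 K0 mA1 mpsi' a1 W2.
have [r2 t2] : `|complex.Re z2| <= K * (2 * mu1 + 1) * e /\ `|complex.Im z2| <= K * (2 * mu1 + 1) * e :=
  cint_mul_small mW fW e0 K0 mA2 mpsi' a2 W2.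
have [r3 t3] : `|complex.Re z3| <= K * (2 * mu1 + 1) * e /\ `|complex.Im z3| <= K * (2 * mu1 + 1) * e :=
  cint_mul_small mW fW e0 K0 mA3 mpsi a3 W1.
have [r4 t4] : `|complex.Re z4| <= K * (2 * mu1 + 1) * e /\ `|complex.Im z4| <= K * (2 * mu1 + 1) * e :=
  cint_mul_small mW fW e0 K0 mA4 mpsi a4 W1.
have [y1 y2] := hC dd n k j cdd qdd k0.
have mc (f : R * R -> R) : continuous f -> measurable_fun Gam (fun t : measurableTypeR R => f (c t)).
  by move=> cf; apply: measurable_funTS; exact: (measurable_comp_profile M0 cM).
have mwc m' : cmeasurable (Gam : set (measurableTypeR R)) (fun t => w m' (c t)).
  have [[q1 q2] _] := hw m'; split; first exact: (mc (fun x => complex.Re (w m' x)) (q1 [::]).1).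
  exact: (mc (fun x => complex.Im (w m' x)) (q2 [::]).1).
have mwc' m' : cmeasurable (Gam : set (measurableTypeR R)) (fun t => w' m' (c t)).
  have [[q1 q2] _] := hw' m'; split; first exact: (mc (fun x => complex.Re (w' m' x)) (q1 [::]).1).
  exact: (mc (fun x => complex.Im (w' m' x)) (q2 [::]).1).
pose D1 t := w m (c t) - trace U (c t); pose D2 t := w' m (c t) - trace U' (c t).
pose D0 t := trace U (c t) - trace U' (c t).
have mD1 : cmeasurable (Gam : set (measurableTypeR R)) D1 by apply: cmeasurableD => //; exact: cmeasurableN.
have mD2 : cmeasurable (Gam : set (measurableTypeR R)) D2 by apply: cmeasurableD => //; exact: cmeasurableN.
have mD0 : cmeasurable (Gam : set (measurableTypeR R)) D0 by apply: cmeasurableD => //; exact: cmeasurableN.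
have mdd : cmeasurable (Gam : set (measurableTypeR R)) (fun t => dd (c t)) by apply: cmeasurableD => //; exact: cmeasurableN.
have e3 : 0 < 3 * e by rewrite mulr_gt0.
(* On the curve [dd] is [D1 - D2 + D0], and [D0] is null because the traces agree. So
   [3 (e^2 + e^2)] is the bound, which is at most [9 e^2]. *)
have sdd : (sqL2 leb Gam (fun t => dd (c t)) <= ((3 * e) ^+ 2)%:E)%E.
  have -> : (fun t => dd (c t)) = (fun t => D1 t - D2 t + D0 t).
    by apply/funext => t; rewrite /dd /D1 /D2 /D0; ring.
  rewrite (le_trans (sqL2_sub3 _ _ _ _ _))//.
  rewrite [X in (_ * (_ + X))%E]tr0 adde0.
  apply: (@le_trans _ _ (3%:E * ((e ^+ 2)%:E + (e ^+ 2)%:E))%E).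
    by apply: lee_wpmul2l => //; exact: leeD.
  by rewrite -EFinD -EFinM lee_fin; have := sqr_ge0 e; lra.
have cpsi1 : continuous (fun x => complex.Re (psi x)) := (csm.1 [::]).1.
have cpsi2 : continuous (fun x => complex.Im (psi x)) := (csm.2 [::]).1.
have mpc : cmeasurable (Gam : set (measurableTypeR R)) (fun t => psi (c t)).
  by split; [exact: (mc (fun x => complex.Re (psi x)))|exact: (mc (fun x => complex.Im (psi x)))].
have [mm1 mm2] := cmeasurableM mdd mpc.
have Gb t : `|complex.Re (psi (c t))| <= K /\ `|complex.Im (psi (c t))| <= K.
  by have [] := hK j (c t) (or_intror (ex_intro2 _ _ t I erefl)).
have g1 : \int[leb]_(t in Gam) `|complex.Re (dd (c t) * psi (c t))| <= K * (2 * mu2 + 1) * (3 * e).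
  apply: (Rintegral_sqnorm_le mGam fGam e3 K0 mdd sdd mm1 _).2 => t _.
  by have [q1 q2] := Gb t; have [] := abs_ReIm_le (dd (c t)) e3 q1 q2.
have g2 : \int[leb]_(t in Gam) `|complex.Im (dd (c t) * psi (c t))| <= K * (2 * mu2 + 1) * (3 * e).
  apply: (Rintegral_sqnorm_le mGam fGam e3 K0 mdd sdd mm2 _).2 => t _.
  by have [q1 q2] := Gb t; have [] := abs_ReIm_le (dd (c t)) e3 q1 q2.
have {}y1 : `|complex.Re Y| <= C * (K * (2 * mu2 + 1) * (3 * e)).
  by rewrite (le_trans y1)// ler_wpM2l.
have {}y2 : `|complex.Im Y| <= C * (K * (2 * mu2 + 1) * (3 * e)).
  by rewrite (le_trans y2)// ler_wpM2l.
have -> : X = Y - (z1 - z2) - (z3 - z4) by rewrite YE; ring.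
have eC : Cst * e = C * (K * (2 * mu2 + 1) * (3 * e)) + 4 * (K * (2 * mu1 + 1) * e) by rewrite /Cst; ring.
rewrite eC; move: y1 y2 r1 r2 r3 r4 t1 t2 t3 t4.
case: (Y) (z1) (z2) (z3) (z4) => [? ?] [? ?] [? ?] [? ?] [? ?] /= *.
by split; exact: norm_sub4_le.
Unshelve. all: by end_near. Qed.

(** * Modes as elements of the energy space *)

Lemma quasiperiodic_bounded (f : R * R -> R[i]) (m : R) :
  continuous (fun x => complex.Re (f x)) -> continuous (fun x => complex.Im (f x)) ->
  quasiperiodic (alpha G) setT f ->
  exists K, forall x, m <= x.2 <= b -> sqnorm (f x) <= K.
Proof.
move=> c1 c2 qf.
have sc : continuous (fun x => sqnorm (f x)).
  rewrite (_ : (fun x => _) = fun x => complex.Re (f x) * complex.Re (f x) +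
    complex.Im (f x) * complex.Im (f x)); last by apply/funext => x; rewrite /sqnorm !expr2.
  by move=> x; apply: cvgD; apply: cvgM; [exact: c1|exact: c1|exact: c2|exact: c2].
have sp x : sqnorm (f (x.1 + 2 * pi, x.2)) = sqnorm (f x).
  by rewrite (quasiperiodic_shift qf) sqnorm_cisM.
have [K _ hK] := periodic_bounded m b sc sp.
by exists K => x /hK; exact/le_trans/ler_norm.
Qed.

Lemma quasiperiodic_L2 (f : R * R -> R[i]) :
  continuous (fun x => complex.Re (f x)) -> continuous (fun x => complex.Im (f x)) ->
  quasiperiodic (alpha G) setT f ->
  [/\ L2_alpha G f, in_L2 leb Gam (fun t => f (c t)) &
    in_L2 leb (@cell R) (fun t => f (t, b))].
Proof.
move=> c1 c2 qf; have [m [mW mc]] := low_bound.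
have [K hK] := quasiperiodic_bounded m c1 c2 qf.
have mb : m <= b <= b by rewrite lexx andbT; case/andP: (mc 0) => /le_trans; exact.
split.
- split; first exact: quasiperiodicS qf.
    exact: continuous_cmeasurable.
  have [] // := @in_L2_bounded _ _ _ nu W
    (measurable_Omega_b) (f : T2 -> R[i]) K.
  + exact: (Omega_b_finite).
  + exact: continuous_cmeasurable.
  + by move=> x /mW; exact: hK.
- apply: (@in_L2_bounded _ _ _ _ _ _ _ K).
  + exact: (measurable_Gamma).
  + exact: (Gamma_finite).
  + by split; apply: measurable_funTS; [exact: (measurable_comp_profile M0 cM c1)|
      exact: (measurable_comp_profile M0 cM c2)].
  + by move=> t _; exact: hK.
- apply: (@in_L2_bounded _ _ _ _ _ _ _ K).
  + by rewrite cellE; exact: measurable_itv.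
  + exact: cell_finite.
  + have cl : continuous (fun t : R => (t, b)).
      by move=> t; exact: (cvg_pair (@cvg_id _ (nbhs t)) (@cvg_cst _ b _ _ _)).
    by split; apply: measurable_funTS; apply: continuous_measurable_fun => t;
      [exact: (continuous_comp (cl t) (c1 (t, b)))|exact: (continuous_comp (cl t) (c2 (t, b)))].
  + by move=> t _; exact: hK.
Qed.

Lemma smooth_H1 (w : R * R -> R[i]) : csmooth w -> quasiperiodic (alpha G) setT w ->
  (forall j, quasiperiodic (alpha G) setT (cpd j w)) ->
  H1_alpha G (H1Fun w (fun j => cpd j w) w).
Proof.
move=> sw qw qdw.
have [h1 h2 h3] := quasiperiodic_L2 (sw.1 [::]).1 (sw.2 [::]).1 qw.
split=> //.
- move=> j; split.
    by have [] := @quasiperiodic_L2 (cpd j w) (sw.1 [:: j]).1 (sw.2 [:: j]).1 (qdw j).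
  apply: weak_pd_smooth; last exact: cC1_smooth.
  exact: (measurable_periodic_domain).
- exists (fun=> w); split => //=.
  by split=> [|j||]; rewrite sqL2_subrr; exact: cvg_cst.
Qed.

Lemma quasiperiodic_mode (n : int) k : quasiperiodic (alpha G) setT (mode (alpha_n G n) b k).
Proof.
move=> x _; rewrite /mode /= !mulrA -!cisD; congr (_ * _).
rewrite -[RHS](cisD2piz _ n); congr cis.
by rewrite /alpha_n; ring.
Qed.

Lemma quasiperiodicZ a D (z : R[i]) f : quasiperiodic a D f -> quasiperiodic a D (fun x => z * f x).
Proof. by move=> qf x Dx; rewrite mulrCA qf// mulrCA. Qed.

(** The conjugate of its value is [psi n k], the weight in the moments below. *)
Definition mode_fun (n : int) k : h1fun R :=
  let w := mode (alpha_n G n) b k in H1Fun w (fun j => cpd j w) w.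

Definition zero_fun : h1fun R := H1Fun (fun=> 0) (fun _ _ => 0) (fun=> 0).

Lemma mode_H1 n k : H1_alpha G (mode_fun n k).
Proof.
apply: smooth_H1; [exact: csmooth_mode|exact: quasiperiodic_mode|].
case.
  rewrite (_ : cpd true _ = fun x => (- k%:R%:C) * mode (alpha_n G n) b k.-1 x); last first.
    by apply/funext => x; rewrite cpd_mode2.
  exact/quasiperiodicZ/quasiperiodic_mode.
rewrite (_ : cpd false _ = fun x => (0 +i* alpha_n G n) * mode (alpha_n G n) b k x); last first.
  by apply/funext => x; rewrite cpd_mode1.
exact/quasiperiodicZ/quasiperiodic_mode.
Qed.

Lemma zero_H1 : H1_alpha G zero_fun.
Proof.
rewrite /zero_fun (_ : (fun _ _ => 0) = fun j => cpd j (fun=> 0)); last first.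
  by apply/funext => j; apply/funext => x; rewrite cpd_cst.
apply: smooth_H1; first exact: csmooth_cst.
  by move=> x _; rewrite !mulr0.
by move=> j x _; rewrite !cpd_cst !mulr0.
Qed.

Lemma H1_L2 U : H1_alpha G U -> in_L2 nu W (fval U) /\
  forall j, in_L2 nu W (fpd U j).
Proof.
move=> [[_ [m1 m2] fo] hd _ _ _].
have mP := measurable_periodic_domain.
have mr (f : T2 -> R[i]) : cmeasurable (periodic_domain G : set T2) f -> cmeasurable (W : set T2) f.
  by move=> [h1 h2]; split; [apply: measurable_funS h1|apply: measurable_funS h2] => //;
    exact: Omega_b_sub.
split; first by split => //; exact: mr.
by move=> j; have [[_ m f] _] := hd j; split => //; exact: mr.
Qed.

(** * Sign of the boundary operator and the energy estimate *)

Definition dual_term (w z : int -> 'cV[R[i]]_(1 + 1)) (n : int) : R[i] :=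
  \sum_j DtN G w n j 0 * conjc (z n j 0).

(** Multiplication by [- i] turns the nonnegative real part of [beta_n] into a nonpositive imaginary
    part on the diagonal. For evanescent modes, with [|alpha_n| > kappa], that real part is 0. *)
Lemma dual_term_form2 n : exists x1 y1 x2 y2 t : R,
  [/\ y1 <= 0, y2 <= 0, (kappa G < `|alpha_n G n| -> y1 = 0 /\ y2 = 0) &
  forall f g f' g', dual_term (fourier2 G f g) (fourier2 G f' g') n =
    form2 x1 y1 x2 y2 t (fourier G f n, fourier G g n) (fourier G f' n, fourier G g' n)].
Proof.
have [x [y [y0 far bE]]] : exists x y : R, [/\ 0 <= x, (kappa G < `|alpha_n G n| -> x = 0)
    & beta_n G n = x +i* y].
  rewrite /beta_n; case: ifPn => h.
    by exists (Num.sqrt (kappa G ^+ 2 - alpha_n G n ^+ 2)), 0; split; rewrite ?sqrtr_ge0// ltNge h.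
  exists 0, (Num.sqrt (alpha_n G n ^+ 2 - kappa G ^+ 2)); split=> //.
  by apply/eqP; rewrite eq_complex /=; apply/andP; split; apply/eqP; ring.
pose k := (kappa G ^+ 2)^-1.
have k0 : 0 <= k by rewrite invr_ge0 sqr_ge0.
have e0 : 0 <= omega G * eps G by rewrite mulr_ge0// ltW.
have m0 : 0 <= omega G * mu G by rewrite mulr_ge0// ltW.
exists (k * (omega G * eps G * y)), (- (k * (omega G * eps G * x))),
  (k * (omega G * mu G * y)), (- (k * (omega G * mu G * x))), (k * (gamma G * alpha_n G n)).
split.
- by rewrite oppr_le0 !mulr_ge0// ltW.
- by rewrite oppr_le0 !mulr_ge0// ltW.
- by move=> /far ->; rewrite !mulr0 oppr0.
move=> f g f' g'.
rewrite /dual_term /DtN /M_n /fourier2 big_split_ord /= !big_ord1.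
move: (fourier G f n) (fourier G g n) (fourier G f' n) (fourier G g' n) => u v u' v'.
rewrite scale_block_mx mul_block_col !col_mxEu !col_mxEd !mxE !big_ord1 !mxE /= !mulr1n bE.
rewrite -/k /form2 /ci.
case: u v u' v' => [a b] [a' b'] [e h] [e' h'] /=.
by apply/eqP; rewrite eq_complex /=; apply/andP; split; apply/eqP; ring.
Qed.

Lemma alpha_n_far : exists N0 : nat, forall n, (N0 < `|n|)%N -> kappa G < `|alpha_n G n|.
Proof.
exists (Num.bound (`|kappa G| + `|alpha G|)) => n hn.
have h1 : `|kappa G| + `|alpha G| < `|n|%N%:R.
  by apply: lt_trans (_ : (Num.bound (`|kappa G| + `|alpha G|))%:R < _); rewrite ?ltr_nat//;
    apply: archi_boundP; rewrite addr_ge0.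
have h2 : (`|n|%N%:R : R) = `|n%:~R| by rewrite natr_absz intr_norm.
have h3 : `|n%:~R : R| <= `|alpha_n G n| + `|alpha G|.
  by rewrite -[X in `|X| <= _](addrK (alpha G)) -/(alpha_n G n) (le_trans (ler_normB _ _)).
by have := ler_norm (kappa G); lra.
Qed.

(** Mode by mode the four terms combine to the form at the difference of the coefficients. No
    convergence of the cross sums is established, so the passage to the limit goes through
    [lim_cross_le0]. *)
Lemma Im_duality_sub (f g f' g' : R * R -> R[i]) :
  forall w w', w = fourier2 G f g -> w' = fourier2 G f' g' ->
  complex.Im (duality (DtN G w) w) - complex.Im (duality (DtN G w) w')
  - complex.Im (duality (DtN G w') w) + complex.Im (duality (DtN G w') w') <= 0.
Proof.
move=> w w' ew ew'.
have E w1 w2 : complex.Im (duality (DtN G w1) w2) =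
    2 * pi * lim (psumZ (fun n => complex.Im (dual_term w1 w2 n)) N @[N --> \oo]).
  have sE : psumZ (fun n => complex.Im (dual_term w1 w2 n)) =
      fun N => complex.Im (\sum_(0 <= m < N.*2.+1) dual_term w1 w2 (m%:Z - N%:Z)).
    by apply/funext => N; rewrite Im_sum.
  by rewrite sE /duality /csumZ /= mul0r addr0.
have pi2 : 0 <= 2 * pi :> R by rewrite mulr_ge0// pi_ge0.
have fin (l1 l2 l3 l4 : R) : l1 - l2 - l3 + l4 <= 0 ->
    2 * pi * l1 - 2 * pi * l2 - 2 * pi * l3 + 2 * pi * l4 <= 0.
  by move=> h; rewrite -!mulrBr -mulrDr mulr_ge0_le0.
rewrite (E w w) (E w w') (E w' w) (E w' w'); apply: fin; rewrite ew ew'.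
have [N0 far] := alpha_n_far.
apply: (@lim_cross_le0 _ _ _ _ _ N0).
- move=> n; have [x1 [y1 [x2 [y2 [t [h1 h2 _ h]]]]]] := dual_term_form2 n.
  by rewrite h Im_form2_diag -[leRHS]addr0 lerD// mulr_le0_ge0// sqnorm_ge0.
- move=> n; have [x1 [y1 [x2 [y2 [t [h1 h2 _ h]]]]]] := dual_term_form2 n.
  by rewrite h Im_form2_diag -[leRHS]addr0 lerD// mulr_le0_ge0// sqnorm_ge0.
- move=> n /far hn; have [x1 [y1 [x2 [y2 [t [_ _ h0 h]]]]]] := dual_term_form2 n.
  have [y10 y20] := h0 hn; rewrite !h y10 y20 Im_form2_cross !Im_form2_diag.
  by rewrite !mul0r addr0.
- move=> n; have [x1 [y1 [x2 [y2 [t [h1 h2 _ h]]]]]] := dual_term_form2 n.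
  by rewrite !h form2_sub -[leRHS]addr0 lerD// mulr_le0_ge0// sqnorm_ge0.
Qed.

Definition gamma_term (w z : h1fun R * h1fun R) (x : R * R) : R[i] :=
  ci R * ((lambda G)^-1)%:C * trace w.1 x * conjc (trace z.1 x)
  + ci R * (lambda G)%:C * trace w.2 x * conjc (trace z.2 x).

Definition jet (w : h1fun R * h1fun R) (x : R * R) :=
  ((fpd w.1 false x, fpd w.1 true x, fval w.1 x), (fpd w.2 false x, fpd w.2 true x, fval w.2 x)).

Definition volume_term (w z : h1fun R * h1fun R) (x : R * R) : R[i] :=
  vform (omega G * eps G / kappa G ^+ 2) (gamma G / kappa G ^+ 2)
    (omega G * mu G / kappa G ^+ 2) (omega G * eps G) (omega G * mu G) (jet w x) (jet z x).

Definition top_term (w z : h1fun R * h1fun R) : R[i] :=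
  duality (DtN G (fourier2 G (trace w.1) (trace w.2))) (fourier2 G (trace z.1) (trace z.2)).

Lemma BformE w z : Bform G w z =
  int_Gamma G (gamma_term w z) + int_Omega_b G (volume_term w z) + top_term w z.
Proof. by case: w z => u v [f g]. Qed.

Lemma gamma_term_integrable w z : in_X G w -> in_X G z ->
  cintegrable leb Gam (fun t => gamma_term w z (profile G t)).
Proof.
move=> [[_ _ u1 _ _] [_ _ u2 _ _]] [[_ _ v1 _ _] [_ _ v2 _ _]].
have mG := measurable_Gamma.
have i1 := cintegrableZ mG (ci R * ((lambda G)^-1)%:C) (in_L2MJ mG u1 v1).
have i2 := cintegrableZ mG (ci R * (lambda G)%:C) (in_L2MJ mG u2 v2).
rewrite (_ : (fun t => _) = fun t => ci R * ((lambda G)^-1)%:C *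
    (trace w.1 (profile G t) * conjc (trace z.1 (profile G t))) +
  ci R * (lambda G)%:C * (trace w.2 (profile G t) * conjc (trace z.2 (profile G t)))); last first.
  by apply/funext => t; rewrite /gamma_term !mulrA.
exact: cintegrableD.
Qed.

Lemma volume_term_integrable w z : in_X G w -> in_X G z ->
  cintegrable nu W (volume_term w z).
Proof.
move=> [hw1 hw2] [hz1 hz2].
have mW := measurable_Omega_b.
have [u0 du] := H1_L2 hw1; have [v0 dv] := H1_L2 hw2.
have [f0 df] := H1_L2 hz1; have [g0 dg] := H1_L2 hz2.
pose P (a : R) (p q : T2 -> R[i]) x := a%:C * (p x * conjc (q x)).
have iP a p q : in_L2 nu W p -> in_L2 nu W q ->
    cintegrable nu W (P a p q).
  by move=> hp hq; apply: (cintegrableZ mW); exact: in_L2MJ.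
pose ce := omega G * eps G / kappa G ^+ 2; pose cg := gamma G / kappa G ^+ 2.
pose cm := omega G * mu G / kappa G ^+ 2.
have E : volume_term w z = fun x =>
    P ce (fpd w.1 false) (fpd z.1 false) x + P ce (fpd w.1 true) (fpd z.1 true) x
    + P cg (fpd w.2 false) (fpd z.1 true) x - P cg (fpd w.2 true) (fpd z.1 false) x
    + P cm (fpd w.2 false) (fpd z.2 false) x + P cm (fpd w.2 true) (fpd z.2 true) x
    - P cg (fpd w.1 false) (fpd z.2 true) x + P cg (fpd w.1 true) (fpd z.2 false) x
    - P (omega G * eps G) (fval w.1) (fval z.1) x - P (omega G * mu G) (fval w.2) (fval z.2) x.
  apply/funext => x; rewrite /volume_term /vform /P /dot2 /jet /= -/ce -/cg -/cm; ring.
rewrite E.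
do ![apply: (cintegrableB mW)|apply: (cintegrableD mW)]; by apply: iP.
Qed.

(** By sesquilinearity the alternating sum of four values of [Bform] stands for the form at [w - z].
    Its imaginary part is the left-hand side plus a nonpositive term from [Gamma_b], and it is 0. *)
Lemma energy_identity w z : solution G w -> solution G z ->
  (lambda G)^-1 * \int[leb]_(t in Gam) sqnorm (trace w.1 (profile G t) - trace z.1 (profile G t))
  + lambda G * \int[leb]_(t in Gam) sqnorm (trace w.2 (profile G t) - trace z.2 (profile G t)) >= 0.
Proof.
move=> [wX ws] [zX zs].
have mG := measurable_Gamma; have mW := measurable_Omega_b.
(* [Fform] depends only on the test pair, so its values cancel in pairs. *)
have B0 : Bform G w w - Bform G w z - Bform G z w + Bform G z z = 0.
  by rewrite !ws// !zs//; ring.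
have gI : complex.Im (int_Gamma G (gamma_term w w) - int_Gamma G (gamma_term w z)
    - int_Gamma G (gamma_term z w) + int_Gamma G (gamma_term z z)) =
  (lambda G)^-1 * \int[leb]_(t in Gam) sqnorm (trace w.1 (profile G t) - trace z.1 (profile G t))
  + lambda G * \int[leb]_(t in Gam) sqnorm (trace w.2 (profile G t) - trace z.2 (profile G t)).
  rewrite /int_Gamma (cint_four mG); try exact: gamma_term_integrable.
  have [[_ _ u1 _ _] [_ _ u2 _ _]] := wX; have [[_ _ v1 _ _] [_ _ v2 _ _]] := zX.
  have i1 := in_L2_sqnorm (in_L2B mG u1 v1); have i2 := in_L2_sqnorm (in_L2B mG u2 v2).
  rewrite -!RintegralZl// -RintegralD//; last 2 first.
  - exact: (integrableZl mG _ i1).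
  - exact: (integrableZl mG _ i2).
  rewrite /cint /=; apply: eq_Rintegral => t _.
  rewrite /gamma_term /ci /sqnorm.
  case: (trace w.1 _) (trace w.2 _) (trace z.1 _) (trace z.2 _) => [? ?] [? ?] [? ?] [? ?] /=.
  ring.
have vI : complex.Im (int_Omega_b G (volume_term w w) - int_Omega_b G (volume_term w z)
    - int_Omega_b G (volume_term z w) + int_Omega_b G (volume_term z z)) = 0.
  rewrite /int_Omega_b (cint_four mW); try exact: volume_term_integrable.
  apply: Im_cint_eq0 => x; rewrite Im_sub4 /volume_term !Im_vform_diag.
  rewrite addr0 sub0r -opprD; apply/eqP; rewrite oppr_eq0; apply/eqP; exact: Im_vform_herm.
have tI : complex.Im (top_term w w - top_term w z - top_term z w + top_term z z) <= 0.
  by rewrite Im_sub4; exact: (Im_duality_sub erefl erefl).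
have : complex.Im (Bform G w w - Bform G w z - Bform G z w + Bform G z z) = 0 by rewrite B0.
rewrite !BformE; move: gI vI tI; rewrite !Im_sub4 => <-.
move: (int_Gamma G (gamma_term w w)) (int_Gamma G (gamma_term w z))
  (int_Gamma G (gamma_term z w)) (int_Gamma G (gamma_term z z)).
move: (int_Omega_b G (volume_term w w)) (int_Omega_b G (volume_term w z))
  (int_Omega_b G (volume_term z w)) (int_Omega_b G (volume_term z z)).
move: (top_term w w) (top_term w z) (top_term z w) (top_term z z).
move=> [? ?] [? ?] [? ?] [? ?] [? ?] [? ?] [? ?] [? ?] [? ?] [? ?] [? ?] [? ?] /=.
lra.
Qed.

(** Here the sign of [lambda] enters: both weights in the energy inequality are negative and both
    integrals nonnegative, so both vanish. *)
Lemma traces_eq w z : solution G w -> solution G z ->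
  sqL2 leb Gam (fun t => trace w.1 (profile G t) - trace z.1 (profile G t)) = 0%E /\
  sqL2 leb Gam (fun t => trace w.2 (profile G t) - trace z.2 (profile G t)) = 0%E.
Proof.
move=> ws zs; have := energy_identity ws zs.
have [[[_ _ u1 _ _] [_ _ u2 _ _]] _] := ws; have [[[_ _ v1 _ _] [_ _ v2 _ _]] _] := zs.
have mG := measurable_Gamma.
rewrite (Rintegral_sqnorm mG (in_L2B mG u1 v1)) (Rintegral_sqnorm mG (in_L2B mG u2 v2)).
set I1 := \int[leb]_(t in Gam) _; set I2 := \int[leb]_(t in Gam) _.
have I10 : 0 <= I1 by apply: Rintegral_ge0 => t _; exact: sqnorm_ge0.
have I20 : 0 <= I2 by apply: Rintegral_ge0 => t _; exact: sqnorm_ge0.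
have l1 : (lambda G)^-1 < 0 by rewrite invr_lt0.
have h1 : (lambda G)^-1 * I1 <= 0 by rewrite mulr_le0_ge0// ltW.
have h2 : lambda G * I2 <= 0 by rewrite mulr_le0_ge0// ltW.
move=> h; have /eqP : (lambda G)^-1 * I1 = 0 by lra.
have /eqP : lambda G * I2 = 0 by lra.
by rewrite !mulf_eq0 (lt_eqF l1) (lt_eqF lambda0)/= => /eqP -> /eqP ->.
Qed.

(** * Moments of the difference of two solutions *)

Definition moment (U U' : h1fun R) n k : R[i] :=
  cint nu W (fun x => (fval U x - fval U' x) * psi n k x).

Lemma mode_L2 n k : in_L2 nu W (psi n k : T2 -> R[i]).
Proof.
have [h _] := H1_L2 (mode_H1 n k).
have := in_L2J h; rewrite (_ : (fun x => _) = psi n k)//.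
by apply/funext => x; exact: conjc_mode.
Qed.

(** The rate [l] is [b - m], the largest value that [b - x_2] can take in a box containing the
    domain. *)
Lemma moment_bound U U' : H1_alpha G U -> H1_alpha G U' ->
  exists l C : R, 0 < l /\ forall n k, `|complex.Re (moment U U' n k)| <= C * l ^+ k /\
    `|complex.Im (moment U U' n k)| <= C * l ^+ k.
Proof.
move=> hU hU'; have [m [mW mc]] := low_bound.
have mO := measurable_Omega_b; have fO := Omega_b_finite.
have mb : m < b by have := mc 0; have := cb 0; lra.
have dL := in_L2B mO (H1_L2 hU).1 (H1_L2 hU').1.
(* The summand 1 makes [e] positive and its square at least the squared norm. *)
pose e := 1 + fine (sqL2 nu W (fun x => fval U x - fval U' x)).
have f0 : 0 <= fine (sqL2 nu W (fun x => fval U x - fval U' x)).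
  by rewrite fine_ge0// sqL2_ge0.
have e0 : 0 < e by rewrite ltr_pwDl.
have fe : (sqL2 nu W (fun x => (fval U x - fval U' x)%R) <= (e ^+ 2)%:E)%E.
  rewrite -[leLHS]fineK; last by rewrite ge0_fin_numE ?sqL2_ge0//; case: dL.
  by rewrite lee_fin /e; nra.
exists (b - m), ((2 * fine (nu W) + 1) * e); split; first lra.
move=> n k.
have K0 : 0 <= (b - m) ^+ k by rewrite exprn_ge0//; lra.
have [] := cint_mul_small mO fO e0 K0 dL.1 (mode_L2 n k).1 fe.
  move=> x /mW xm; rewrite mode_Re mode_Im.
  have := trig_bounded (- alpha_n G n) 1 0 k xm; have := trig_bounded (- alpha_n G n) 0 1 k xm.
  by rewrite !normr0 !normr1 addr0 add0r !mul1r.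
by rewrite -/(moment U U' n k) => h1 h2; split; [move: h1|move: h2]; congr (_ <= _); ring.
Qed.

Section pair.
Variables U U' : h1fun R.
Hypothesis hU : H1_alpha G U.
Hypothesis hU' : H1_alpha G U'.
Hypothesis tr0 : sqL2 leb Gam (fun t => trace U (c t) - trace U' (c t)) = 0%E.

Lemma grad_integrable n k j : cintegrable nu W
  (fun x => (fpd U j x - fpd U' j x) * psi n k x).
Proof.
have mO := measurable_Omega_b.
apply: (in_L2M mO); last exact: mode_L2.
exact: (in_L2B mO ((H1_L2 hU).2 j) ((H1_L2 hU').2 j)).
Qed.

Lemma val_integrable n k : cintegrable nu W
  (fun x => (fval U x - fval U' x) * psi n k x).
Proof.
have mO := measurable_Omega_b.
apply: (in_L2M mO); last exact: mode_L2.
exact: (in_L2B mO (H1_L2 hU).1 (H1_L2 hU').1).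
Qed.

(** [green_H1] moves the derivative onto [psi], where it acts as multiplication by [- i alpha_n]. In
    the vertical direction it lowers the exponent instead, hence the index shift in the companion
    lemma. *)
Lemma moment_grad1 n k : (0 < k)%N ->
  cint nu W (fun x => (fpd U false x - fpd U' false x) * psi n k x) =
  (0 +i* alpha_n G n) * moment U U' n k.
Proof.
move=> k0; have mO := measurable_Omega_b.
have : cint nu W (fun x => (fpd U false x - fpd U' false x) * psi n k x +
    (0 -i* alpha_n G n) * ((fval U x - fval U' x) * psi n k x)) = 0.
  rewrite -[RHS](green_H1 n false hU hU' k0 tr0); congr cint.
  by apply/funext => x; congr (_ + _); rewrite cpd_mode1 mulrCA.
rewrite (cintD mO (grad_integrable n k false) (cintegrableZ mO _ (val_integrable n k))).
rewrite (cintZ mO _ (val_integrable n k)) -/(moment U U' n k) => /eqP.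
rewrite addr_eq0 => /eqP ->; rewrite -mulNr; congr (_ * _).
by apply/eqP; rewrite eq_complex /= oppr0 opprK !eqxx.
Qed.

Lemma moment_grad2 n k :
  cint nu W (fun x => (fpd U true x - fpd U' true x) * psi n k.+1 x) =
  k.+1%:R%:C * moment U U' n k.
Proof.
have mO := measurable_Omega_b.
have : cint nu W (fun x => (fpd U true x - fpd U' true x) * psi n k.+1 x +
    (- k.+1%:R%:C) * ((fval U x - fval U' x) * psi n k x)) = 0.
  rewrite -[RHS](green_H1 n true hU hU' (ltn0Sn k) tr0); congr cint.
  by apply/funext => x; congr (_ + _); rewrite cpd_mode2 mulrCA.
rewrite (cintD mO (grad_integrable n k.+1 true) (cintegrableZ mO _ (val_integrable n k))).
rewrite (cintZ mO _ (val_integrable n k)) -/(moment U U' n k) => /eqP.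
by rewrite addr_eq0 => /eqP ->; rewrite mulNr opprK.
Qed.

End pair.

Lemma fourier_eq0 f n : (forall x1, f (x1, b) = 0) -> fourier G f n = 0.
Proof.
move=> f0; rewrite /fourier /int_Gamma_b /cint /Rintegral !integral0_eq.
- by apply/eqP; rewrite eq_complex /= !mulr0 subr0 addr0 eqxx.
- by move=> x _; rewrite f0 mul0r.
- by move=> x _; rewrite f0 mul0r.
Qed.

Lemma top_term_eq0 w z : (forall x1, trace z.1 (x1, b) = 0) -> (forall x1, trace z.2 (x1, b) = 0) ->
  top_term w z = 0.
Proof.
move=> z1 z2; rewrite /top_term /duality.
have -> : (fun n => \sum_j DtN G (fourier2 G (trace w.1) (trace w.2)) n j 0 *
    conjc (fourier2 G (trace z.1) (trace z.2) n j 0)) = fun=> 0.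
  apply/funext => n; rewrite big1// => j _.
  have c0 : conjc 0 = 0 :> R[i] by apply/eqP; rewrite eq_complex /= oppr0 !eqxx.
  rewrite [X in _ * conjc X](_ : _ = 0); first by rewrite c0 mulr0.
  by rewrite /fourier2 (fourier_eq0 n z1) (fourier_eq0 n z2) raddf0 col_mx0 mxE.
rewrite /csumZ; have -> : (fun N => complex.Re (\sum_(0 <= m < N.*2.+1) (0 : R[i]))) = fun=> 0 :> R.
  by apply/funext => N; rewrite big1.
have -> : (fun N => complex.Im (\sum_(0 <= m < N.*2.+1) (0 : R[i]))) = fun=> 0 :> R.
  by apply/funext => N; rewrite big1.
by rewrite !lim_cst// mulr0.
Qed.

Lemma conjc_mode_fpd1 n k x :
  conjc (fpd (mode_fun n k) false x) = (0 -i* alpha_n G n) * psi n k x.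
Proof.
by rewrite -[fpd _ _ _]/(cpd false (mode (alpha_n G n) b k) x) cpd_mode1 conjcM conjc_mode.
Qed.

Lemma conjc_mode_fpd2 n k x :
  conjc (fpd (mode_fun n k.+1) true x) = (- k.+1%:R)%:C * psi n k x.
Proof.
rewrite -[fpd _ _ _]/(cpd true (mode (alpha_n G n) b k.+1) x) cpd_mode2 conjcM conjc_mode; congr (_ * _).
by apply/eqP; rewrite eq_complex /= !oppr0 !eqxx.
Qed.

(** The volume integrand left after testing with one mode of exponent [k + 2], written once for both
    equations: [a] is the leading coefficient, [s] the signed coupling, and [V], [V'] the other
    component. In both equations the zero-order coefficient is [a * kappa^2]. *)
Definition residual (a s : R) (U U' V V' : h1fun R) n k x : R[i] :=
  a%:C * ((0 -i* alpha_n G n) * psi n k.+2 x * (fpd U false x - fpd U' false x))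
  + a%:C * ((- k.+2%:R)%:C * psi n k.+1 x * (fpd U true x - fpd U' true x))
  + s%:C * ((- k.+2%:R)%:C * psi n k.+1 x * (fpd V false x - fpd V' false x))
  - s%:C * ((0 -i* alpha_n G n) * psi n k.+2 x * (fpd V true x - fpd V' true x))
  - (a * kappa G ^+ 2)%:C * (psi n k.+2 x * (fval U x - fval U' x)).

(** The coupling terms give [- s (k + 2) i alpha_n] and [+ s (k + 2) i alpha_n] times the same
    moment of [V - V'], so they cancel. The rest is divided by [a]. *)
Lemma moment_rec (a s : R) (U U' V V' : h1fun R) n k : a != 0 ->
  H1_alpha G U -> H1_alpha G U' -> H1_alpha G V -> H1_alpha G V' ->
  sqL2 leb Gam (fun t => trace U (c t) - trace U' (c t)) = 0%E ->
  sqL2 leb Gam (fun t => trace V (c t) - trace V' (c t)) = 0%E ->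
  cint nu W (residual a s U U' V V' n k) = 0 ->
  (k.+2 * k.+1)%:R%:C * moment U U' n k =
  (alpha_n G n ^+ 2 - kappa G ^+ 2)%:C * moment U U' n k.+2.
Proof.
move=> a0 hU hU' hV hV' trU trV.
have mO := measurable_Omega_b.
have i1 := grad_integrable hU hU' n k.+2 false.
have i2 := grad_integrable hU hU' n k.+1 true.
have i3 := grad_integrable hV hV' n k.+1 false.
have i4 := grad_integrable hV hV' n k.+2 true.
have i5 := val_integrable hU hU' n k.+2.
pose c1 : R[i] := 0 -i* (a * alpha_n G n).
pose c2 : R[i] := (- (a * k.+2%:R))%:C.
pose c3 : R[i] := (- (s * k.+2%:R))%:C.
pose c4 : R[i] := 0 +i* (s * alpha_n G n).
pose c5 : R[i] := (- (a * kappa G ^+ 2))%:C.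
have j1 := cintegrableZ mO c1 i1; have j2 := cintegrableZ mO c2 i2.
have j3 := cintegrableZ mO c3 i3; have j4 := cintegrableZ mO c4 i4.
have j5 := cintegrableZ mO c5 i5.
have j12 := cintegrableD mO j1 j2; have j123 := cintegrableD mO j12 j3.
have j1234 := cintegrableD mO j123 j4.
have -> : cint nu W (residual a s U U' V V' n k) =
    cint nu W (fun x =>
      c1 * ((fpd U false x - fpd U' false x) * psi n k.+2 x)
      + c2 * ((fpd U true x - fpd U' true x) * psi n k.+1 x)
      + c3 * ((fpd V false x - fpd V' false x) * psi n k.+1 x)
      + c4 * ((fpd V true x - fpd V' true x) * psi n k.+2 x)
      + c5 * ((fval U x - fval U' x) * psi n k.+2 x)).
  apply: eq_cint => x _; rewrite /residual.
  move: (fpd U false x - _) (fpd U true x - _) (fpd V false x - _) (fpd V true x - _) (fval U x - _).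
  move: (psi n k.+1 x) (psi n k.+2 x).
  move=> [p1 q1] [p2 q2] [r1 s1] [r2 s2] [r3 s3] [r4 s4] [r5 s5].
  apply/eqP; rewrite eq_complex /=; apply/andP; split; apply/eqP; ring.
rewrite (cintD mO j1234 j5) (cintD mO j123 j4) (cintD mO j12 j3) (cintD mO j1 j2).
rewrite (cintZ mO _ i1) (cintZ mO _ i2) (cintZ mO _ i3) (cintZ mO _ i4) (cintZ mO _ i5).
rewrite (moment_grad1 hU hU' trU)// (moment_grad2 hU hU' trU).
rewrite (moment_grad1 hV hV' trV)// (moment_grad2 hV hV' trV).
rewrite -/(moment U U' n k.+2) natrM.
have ac : a%:C != 0 by apply/eqP => -[] /eqP; apply/negP.
move: (moment U U' n k) (moment U U' n k.+2) (moment V V' n k.+1) => [x1 y1] [x2 y2] [x3 y3] h.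
apply: (mulfI ac); apply/eqP; rewrite -subr_eq0 -oppr_eq0 -[X in _ == X]h; apply/eqP.
rewrite /c1 /c2 /c3 /c4 /c5.
apply/eqP; rewrite eq_complex /=; apply/andP; split; apply/eqP; ring.
Qed.

Lemma gamma_test_eq w z (Z : h1fun R * h1fun R) n k : solution G w -> solution G z -> in_X G Z ->
  (Z = (mode_fun n k, zero_fun) \/ Z = (zero_fun, mode_fun n k)) ->
  int_Gamma G (gamma_term w Z) = int_Gamma G (gamma_term z Z).
Proof.
move=> ws zs ZX hZ; have [wX zX] := (ws.1, zs.1).
have mG := measurable_Gamma; have fG := Gamma_finite.
have [tr1 tr2] := traces_eq ws zs.
have [[_ _ u1 _ _] [_ _ u2 _ _]] := wX; have [[_ _ v1 _ _] [_ _ v2 _ _]] := zX.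
have [K K0 hK] := mode_bounded (- alpha_n G n) k.
have [[_ _ f1 _ _] [_ _ f2 _ _]] := ZX.
have bd (f : h1fun R) : f = mode_fun n k \/ f = zero_fun -> forall t,
    `|complex.Re (conjc (trace f (c t)))| <= K /\ `|complex.Im (conjc (trace f (c t)))| <= K.
  move=> [->|->] t; last by rewrite /= oppr0 normr0.
  by rewrite -[trace _ _]/(mode (alpha_n G n) b k (c t)) conjc_mode; have [] := hK true (c t) (or_intror (ex_intro2 _ _ t I erefl)).
have [b1 b2] : (Z.1 = mode_fun n k \/ Z.1 = zero_fun) /\ (Z.2 = mode_fun n k \/ Z.2 = zero_fun).
  by case: hZ => ->; split; [left|right|right|left].
have d1 := in_L2B mG u1 v1; have d2 := in_L2B mG u2 v2.
have z1 := cint_mul_eq0 mG fG K0 d1.1 (cmeasurableJ f1.1) tr1 (fun t _ => bd _ b1 t).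
have z2 := cint_mul_eq0 mG fG K0 d2.1 (cmeasurableJ f2.1) tr2 (fun t _ => bd _ b2 t).
have i1 := in_L2MJ mG d1 f1; have i2 := in_L2MJ mG d2 f2.
apply/eqP; rewrite -subr_eq0 /int_Gamma; apply/eqP.
have iw := gamma_term_integrable wX ZX; have iz := gamma_term_integrable zX ZX.
rewrite -(cintB mG iw iz).
have -> : (fun t => gamma_term w Z (c t) - gamma_term z Z (c t)) = fun t =>
    ci R * ((lambda G)^-1)%:C * ((trace w.1 (c t) - trace z.1 (c t)) * conjc (trace Z.1 (c t)))
    + ci R * (lambda G)%:C * ((trace w.2 (c t) - trace z.2 (c t)) * conjc (trace Z.2 (c t))).
  by apply/funext => t; rewrite /gamma_term; ring.
rewrite (cintD mG (cintegrableZ mG _ i1) (cintegrableZ mG _ i2)) (cintZ mG _ i1) (cintZ mG _ i2).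
by rewrite z1 z2 !mulr0 addr0.
Qed.

(** A positive exponent makes the test pair vanish on [Gamma_b], which removes the nonlocal term,
    and equal traces remove the terms on [Gamma]. *)
Lemma volume_test_eq0 w z (Z : h1fun R * h1fun R) n k : solution G w -> solution G z -> in_X G Z ->
  (Z = (mode_fun n k.+1, zero_fun) \/ Z = (zero_fun, mode_fun n k.+1)) ->
  cint nu W (fun x => volume_term w Z x - volume_term z Z x) = 0.
Proof.
move=> ws zs ZX hZ; have [wX zX] := (ws.1, zs.1).
have mO := measurable_Omega_b.
have tops : (forall x1, trace Z.1 (x1, b) = 0) /\ (forall x1, trace Z.2 (x1, b) = 0).
  by case: hZ => ->; split=> x1 //=; rewrite mode_top.
have := ws.2 Z ZX; rewrite -(zs.2 Z ZX) !BformE (gamma_test_eq ws zs ZX hZ).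
rewrite !(top_term_eq0 _ tops.1 tops.2) !addr0 => /addrI /eqP.
have iw := volume_term_integrable wX ZX; have iz := volume_term_integrable zX ZX.
by rewrite -subr_eq0 /int_Omega_b -(cintB mO iw iz) => /eqP.
Qed.

Lemma moment_eq0 w z n k : solution G w -> solution G z ->
  moment w.1 z.1 n k = 0 /\ moment w.2 z.2 n k = 0.
Proof.
move=> ws zs; have [[w1 w2] [z1 z2]] := (ws.1, zs.1).
have [tr1 tr2] := traces_eq ws zs.
have k20 : 0 < kappa G ^+ 2 by rewrite exprn_gt0.
have k21 : kappa G ^+ 2 != 0 by rewrite gt_eqF.
have H0 := zero_H1; have Hm k' := mode_H1 n k'.
(* The coefficients of the recursion are real, so it holds for real and imaginary parts
   separately. *)
have conclude U U' : H1_alpha G U -> H1_alpha G U' -> (forall k,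
    (k.+2 * k.+1)%:R%:C * moment U U' n k =
    (alpha_n G n ^+ 2 - kappa G ^+ 2)%:C * moment U U' n k.+2) -> moment U U' n k = 0.
  move=> hU hU' rec; have [l [C [l0 hC]]] := moment_bound hU hU'.
  have r1 := moments_eq0 l0 (fun k => (hC n k).1) (c := alpha_n G n ^+ 2 - kappa G ^+ 2).
  have r2 := moments_eq0 l0 (fun k => (hC n k).2) (c := alpha_n G n ^+ 2 - kappa G ^+ 2).
  apply/eqP; rewrite eq_complex r1 ?r2 ?eqxx// => k'.
    by have := congr1 (@complex.Im R) (rec k'); rewrite /= !mul0r !addr0.
  by have := congr1 (@complex.Re R) (rec k'); rewrite /= !mul0r !subr0.
have X1 k' : in_X G (mode_fun n k', zero_fun) by split; [exact: Hm|exact: H0].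
have X2 k' : in_X G (zero_fun, mode_fun n k') by split; [exact: H0|exact: Hm].
split; apply: conclude => // k'.
- apply: (moment_rec (a := omega G * eps G / kappa G ^+ 2) (s := gamma G / kappa G ^+ 2)
    _ w1 z1 w2 z2 tr1 tr2); first by rewrite gt_eqF// divr_gt0// mulr_gt0.
  rewrite -[RHS](volume_test_eq0 ws zs (X1 k'.+2) (or_introl erefl)); congr cint.
  apply/funext => x; rewrite /volume_term vform_test1 /residual.
  by rewrite conjc_mode_fpd1 conjc_mode_fpd2 conjc_mode divfK.
(* The coupling enters the second equation with the opposite sign. *)
- apply: (moment_rec (a := omega G * mu G / kappa G ^+ 2) (s := - (gamma G / kappa G ^+ 2))
    _ w2 z2 w1 z1 tr2 tr1); first by rewrite gt_eqF// divr_gt0// mulr_gt0.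
  rewrite -[RHS](volume_test_eq0 ws zs (X2 k'.+2) (or_intror erefl)); congr cint.
  apply/funext => x; rewrite /volume_term vform_test2 /residual.
  rewrite conjc_mode_fpd1 conjc_mode_fpd2 conjc_mode divfK//.
  have -> : (- (gamma G / kappa G ^+ 2))%:C = - (gamma G / kappa G ^+ 2)%:C :> R[i].
    by apply/eqP; rewrite eq_complex /= oppr0 !eqxx.
  by rewrite !mulNr opprK.
Qed.

(** Splitting off the unimodular factor [psi 0 0] leaves integer frequencies, as the completeness
    argument demands. *)
Lemma mode_alpha (n : int) k (x : R * R) : psi n k x = psi 0 0 x * mode (- n%:~R) b k x.
Proof.
rewrite /mode expr0 mulr1 mulrA -cisD; congr (cis _ * _).
by rewrite /alpha_n mulr0z; ring.
Qed.

Lemma trig_modes a (A A' : R) k (x : R * R) :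
  (trig a b A A' k x)%:C = ((A / 2) -i* (A' / 2)) * mode a b k x + ((A / 2) +i* (A' / 2)) * mode (- a) b k x.
Proof.
rewrite /trig /mode /cis mulNr cosN sinN.
by apply/eqP; rewrite eq_complex /=; apply/andP; split; apply/eqP; field.
Qed.

(** Completeness is applied to the real and imaginary parts of [g], the difference times [psi 0 0].
    Euler's formula turns vanishing moments for [n] and [- n] into orthogonality to every [trig],
    and dividing by the nonzero factor recovers the difference. *)
Lemma moments_complete U U' : H1_alpha G U -> H1_alpha G U' ->
  (forall n k, moment U U' n k = 0) ->
  {ae nu, forall x, W x -> fval U x = fval U' x}.
Proof.
move=> hU hU' mom; have mO := measurable_Omega_b.
have vi n k := val_integrable hU hU' n k.
pose g (x : T2) := (fval U x - fval U' x) * psi 0 0 x.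
have [m [mW _]] := low_bound.
have Ds (x : R * R) : W x -> 0 < x.1 < 2 * pi /\ m <= x.2 <= b by move=> xW; split; [case: xW|exact: mW].
have E (n : int) k x : (fval U x - fval U' x) * psi n k x = g x * mode (- n%:~R) b k x.
  by rewrite mode_alpha mulrA.
have ci0 (n : int) A A' k : cintegrable nu W (fun x => g x * (trig n%:~R b A A' k x)%:C) /\
    cint nu W (fun x => g x * (trig n%:~R b A A' k x)%:C) = 0.
  have i1 := cintegrableZ mO ((A / 2) -i* (A' / 2)) (vi (- n) k).
  have i2 := cintegrableZ mO ((A / 2) +i* (A' / 2)) (vi n k).
  have e : (fun x => g x * (trig n%:~R b A A' k x)%:C) = fun x =>
      ((A / 2) -i* (A' / 2)) * ((fval U x - fval U' x) * psi (- n) k x) +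
      ((A / 2) +i* (A' / 2)) * ((fval U x - fval U' x) * psi n k x).
    apply/funext => x; rewrite !E trig_modes mulrNz opprK; ring.
  rewrite e; split; first exact: cintegrableD.
  rewrite (cintD mO i1 i2) (cintZ mO _ (vi _ _)) (cintZ mO _ (vi _ _)).
  by rewrite -/(moment U U' (- n) k) -/(moment U U' n k) !mom !mulr0 addr0.
have [ig1 ig2] : cintegrable nu W g by exact: vi.
have bone : bmeas W (fun=> 1 : R) by split; [exact: measurable_cst|exists 1 => x _; rewrite normr1].
(* The real-valued integral is also 0 when the extended one is infinite; integrability excludes this
   case. *)
have fine_eq0 (q : T2 -> R) : nu.-integrable W (EFin \o q) -> \int[nu]_(x in W) q x = 0 ->
    (\int[nu]_(x in W) (q x)%:E = 0)%E.
  move=> iq; rewrite /Rintegral => q0.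
  by rewrite -[LHS]fineK ?q0//; exact: (integrable_fin_num mO iq).
have a1 : annih b W (fun x => complex.Re (g x)) (fun=> 1).
  split=> // n A A' k; have [[i1 _] /(congr1 (@complex.Re R)) /= z1] := ci0 n A A' k.
  rewrite -[RHS](fine_eq0 _ i1 z1); apply: eq_integral => x _.
  by case: (g x) => r s /=; rewrite mul1r mulr0 subr0.
have a2 : annih b W (fun x => complex.Im (g x)) (fun=> 1).
  split=> // n A A' k; have [[_ i1] /(congr1 (@complex.Im R)) /= z1] := ci0 n A A' k.
  rewrite -[RHS](fine_eq0 _ i1 z1); apply: eq_integral => x _.
  by case: (g x) => r s /=; rewrite mul1r mulr0 add0r.
have c1 := complete_trig mO Ds ig1 a1; have c2 := complete_trig mO Ds ig2 a2.
apply: filterS2 c1 c2 => x h1 h2 xW; apply/eqP; rewrite -subr_eq0.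
have /eqP : g x = 0 by apply/eqP; rewrite eq_complex (h1 xW) (h2 xW) !eqxx.
rewrite /g mulf_eq0 => /orP[//|]; rewrite /mode expr0 mulr1 => /eqP c0.
have := sqnorm_cisM (- alpha_n G 0 * x.1) 1.
rewrite c0 mul0r /sqnorm /= !expr0n /= expr1n !addr0 => /eqP.
by rewrite eq_sym oner_eq0.
Qed.

End grating_problem.

Lemma periodic_profile_bounds (R : realType) (c : R -> R * R) : periodic_profile c ->
  exists M L : R, [/\ 0 < M, lipschitz_coords c M, 0 < L & shift_periodic c L].
Proof.
move=> [_ [M hM] _ [L L0 cL]]; exists (Num.max M 1), L; split=> //.
  by rewrite lt_max ltr01 orbT.
move=> s t; have := hM (s, t) (conj I I).
rewrite /= [`|c s - c t|]/Num.norm /= ge_max => /andP[h1 h2].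
have le : M * `|s - t| <= Num.max M 1 * `|s - t| by rewrite ler_wpM2r// le_max lexx.
by split; [exact: le_trans h1 le|exact: le_trans h2 le].
Qed.

Lemma kappa_gt0 (R : realType) (G : grating R) : 0 < omega G -> 0 < eps G -> 0 < mu G ->
  - (pi / 2) < inc_phi G < pi / 2 -> 0 < kappa G.
Proof.
move=> w0 e0 m0 hphi; rewrite /kappa /wavenumber !mulr_gt0 ?sqrtr_gt0 ?mulr_gt0//.
exact: cos_gt0_pihalf.
Qed.

Local Close Scope complex_scope.

Theorem theorem3p5 (R : realType) (G : grating R)
  (homega : 0 < omega G) (heps : 0 < eps G) (hmu : 0 < mu G)
  (htheta : - (pi / 2) < inc_theta G < pi / 2)
  (hphi : - (pi / 2) < inc_phi G < pi / 2)
  (hp : dot3 (pvec G) (kvec G) = 0)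
  (hprofile : periodic_profile (profile G))
  (hheight : forall t, (profile G t).2 < height G)
  (hlip : lipschitz_curve (profile G))
  (hkgamma : wavenumber G ^+ 2 != gamma G ^+ 2)
  (hlambda : lambda G < 0)
  (W W' : h1fun R * h1fun R) :
  solution G W -> solution G W' ->
  {ae plane_measure R, forall x, Omega_b G x ->
    fval W.1 x = fval W'.1 x /\ fval W.2 x = fval W'.2 x}.
Proof.
move=> sW sW'; have kappa0 := kappa_gt0 homega heps hmu hphi.
have [M [L [M0 cM L0 cL]]] := periodic_profile_bounds hprofile.
have mom n k := moment_eq0 M0 cM L0 cL hheight homega heps hmu kappa0 hlambda n k sW sW'.
have [[W1 W2] [W'1 W'2]] := (sW.1, sW'.1).
have h1 := moments_complete M0 cM L0 cL hheight W1 W'1 (fun n k => (mom n k).1).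
have h2 := moments_complete M0 cM L0 cL hheight W2 W'2 (fun n k => (mom n k).2).
have aeF := ae_filter_ringOfSetsType (plane_measure R).
by apply: (@filterS2 _ _ aeF _ _ _ _ h1 h2) => x e1 e2 xW; split; [exact: e1|exact: e2].
Qed.
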